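(* Let $t>0$ be fixed, let $a>0$, and let $A\in\mathbb{C}$. Consider doubly infinite sequences $\{f_k\}_{k\in\mathbb{Z}}$ of functions on $\mathbb{R}^d$ satisfying, for all $k\in\mathbb{Z}$, (1) $B_tf_k=Af_{k+1}$, and (2) $|f_k(x)|\le Me^{a|x|}$ for all $x\in\mathbb{R}^d$, where $M>0$ is a constant independent of $k$ and $x$. Then: (a) If $|A|=\psi_{ia}(te_1)$, then $\Delta f_0=-a^2f_0$ for every such sequence. (b) If $|A|>\psi_{ia}(te_1)$, then $f_0=0$ for every such sequence. (c) If $|A|<\psi_{ia}(te_1)$, then $f_0$ may not be an eigenfunction of $\Delta$; that is, there is a sequence satisfying (1) and (2) such that $\Delta f_0=\mu f_0$ holds for no $\mu\in\mathbb{C}$.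
   Context: Functions are complex-valued and measurable (hence locally integrable under (2)); equalities between functions are almost everywhere, and $\Delta f$ is understood in the sense of distributions. $\Delta=-\sum_{j=1}^d\frac{\partial^2}{\partial x_j^2}$ (note the sign). $e_1=(1,0,\dots,0)$. For $\lambda\in\mathbb{C}$, $\psi_\lambda(\xi)=\frac{1}{|B(0,1)|}\int_{B(0,1)}e^{-i\lambda\xi\cdot y}\,dy$, $\xi\in\mathbb{R}^d$, where $B(0,r)$ is the ball of radius $r$ centered at the origin and $|\cdot|$ denotes volume; in particular $\psi_{ia}(te_1)>0$. The volume (ball) average of $f\in L^1_{loc}(\mathbb{R}^d)$ is $B_tf(x)=\frac{1}{|B(0,t)|}(f*\chi_{B(0,t)})(x)$. *)

(* Defs.v *)
From HB Require Import structures.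
From mathcomp Require Import all_boot all_order all_algebra.
From mathcomp Require Import all_classical all_reals all_analysis.
From mathcomp Require Import complex.

Set Implicit Arguments.
Unset Strict Implicit.
Unset Printing Implicit Defensive.
Import Order.TTheory GRing.Theory Num.Theory.
Import numFieldNormedType.Exports.

Local Open Scope classical_set_scope.
Local Open Scope ring_scope.
Local Open Scope complex_scope.

(* R^d is 'rV[R]_d, with the library's (product) topology and the Borel       *)
(* sigma-algebra generated by the coordinates.                                *)

Definition rV_display : measure_display -> measure_display.
Proof. exact. Qed.

Section measurable_rV.
Context {R : realType} (d : nat).

Let coord (i : 'I_d) (x : 'rV[R]_d) : measurableTypeR R := x 0 i.

Let rV_set0 : g_sigma_preimage coord set0.
Proof. exact: sigma_algebra0. Qed.

Let rV_setC A : g_sigma_preimage coord A -> g_sigma_preimage coord (~` A).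
Proof. exact: sigma_algebraC. Qed.

Let rV_bigcup (F : (set 'rV[R]_d)^nat) :
  (forall i, g_sigma_preimage coord (F i)) ->
  g_sigma_preimage coord (\bigcup_i F i).
Proof. exact: sigma_algebra_bigcup. Qed.

HB.instance Definition _ := @isMeasurable.Build (rV_display default_measure_display)
  'rV[R]_d (g_sigma_preimage coord) rV_set0 rV_setC rV_bigcup.

Lemma measurable_coord (i : 'I_d) :
  measurable_fun [set: 'rV[R]_d] (fun x : 'rV[R]_d => x 0 i : measurableTypeR R).
Proof.
move=> _ Y mY; rewrite setTI; apply: sub_sigma_algebra => /=.
rewrite -bigcup_seq/=; exists i => /=; first by rewrite mem_index_enum.
by exists Y => //; rewrite setTI.
Qed.

Lemma measurable_fun_rV d1 (T : measurableType d1) (f : T -> 'rV[R]_d) :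
  (forall i, measurable_fun setT (fun x => f x 0 i : measurableTypeR R)) ->
  measurable_fun setT f.
Proof.
move=> mf; apply: (@measurability _ _ _ _ _ _
  (\big[setU/set0]_(i < d) preimage_set_system setT (coord i) measurable)).
  by [].
move=> _ [A hA <-]; move: hA; rewrite -bigcup_seq/= => -[i _ [B mB <-]].
rewrite [X in measurable X](_ : _ = setT `&` (fun x => f x 0 i) @^-1` B).
  exact: mf.
by rewrite !setTI.
Qed.

End measurable_rV.

Section lebesgue_rV_succ.
Context {R : realType} (d : nat).

Definition rV_cons (p : measurableTypeR R * 'rV[R]_d) : 'rV[R]_d.+1 :=
  row_mx (p.1%:M : 'rV[R]_1) p.2.

Lemma rV_cons0 p : rV_cons p 0 ord0 = p.1.
Proof.
have -> : ord0 = lshift d (ord0 : 'I_1) :> 'I_(1 + d) by exact/val_inj.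
by apply: etrans (row_mxEl _ _ _ _) _; rewrite mxE.
Qed.

Lemma rV_consS p i : rV_cons p 0 (lift ord0 i) = p.2 0 i.
Proof.
have -> : lift ord0 i = rshift 1 i :> 'I_(1 + d) by exact/val_inj.
exact: row_mxEr.
Qed.

Lemma measurable_rV_cons : measurable_fun setT rV_cons.
Proof.
apply: measurable_fun_rV => i; case: (unliftP ord0 i) => [j|] ->.
  under eq_fun do rewrite rV_consS.
  exact: (measurableT_comp (measurable_coord j) measurable_snd).
by under eq_fun do rewrite rV_cons0; exact: measurable_fst.
Qed.

Variable mu : {sigma_finite_measure set 'rV[R]_d -> \bar R}.

Definition lebesgue_rV_succ : set 'rV[R]_d.+1 -> \bar R :=
  pushforward (@lebesgue_measure R \x mu)%E rV_cons.

Let succ0 : lebesgue_rV_succ set0 = 0%E.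
Proof. by rewrite /lebesgue_rV_succ /pushforward preimage_set0 measure0. Qed.

Let succ_ge0 A : (0 <= lebesgue_rV_succ A)%E.
Proof. by rewrite /lebesgue_rV_succ /pushforward; exact: measure_ge0. Qed.

Let succ_sigma_additive : semi_sigma_additive lebesgue_rV_succ.
Proof.
move=> F mF tF mUF; rewrite /lebesgue_rV_succ /pushforward preimage_bigcup.
apply: measure_semi_sigma_additive.
- by move=> n; rewrite -[X in measurable X]setTI; exact: measurable_rV_cons.
- apply/trivIsetP => /= i j _ _ ij; rewrite -preimage_setI.
  by move/trivIsetP : tF => /(_ _ _ _ _ ij) ->//; rewrite preimage_set0.
- by rewrite -preimage_bigcup -[X in measurable X]setTI; exact: measurable_rV_cons.
Qed.

HB.instance Definition _ := isMeasure.Build _ _ _ lebesgue_rV_succ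
  succ0 succ_ge0 succ_sigma_additive.

Let succ_sigma_finite : sigma_finite setT lebesgue_rV_succ.
Proof.
have [F FT mF] : sigma_finite setT (@lebesgue_measure R \x mu)%E.
  have /sigma_finiteP[F [TF ndF Foo]] := sigma_finiteT (@lebesgue_measure R).
  have /sigma_finiteP[G [TG ndG Goo]] := sigma_finiteT mu.
  exists (fun n => F n `*` G n).
    rewrite -setXTT TF TG predeqE => -[x y]; split.
      move=> [/= [n _ Fnx] [k _ Gky]]; exists (maxn n k) => //; split.
      - by move: x Fnx; exact/subsetPset/ndF/leq_maxl.
      - by move: y Gky; exact/subsetPset/ndG/leq_maxr.
    by move=> [n _ []/= ? ?]; split; exists n.
  move=> k; have [? ?] := Foo k; have [? ?] := Goo k.
  split; first exact: measurableX.
  by rewrite product_measure1E// lte_mul_pinfty// ge0_fin_numE.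
pose uncons (x : 'rV[R]_d.+1) : measurableTypeR R * 'rV[R]_d :=
  (x 0 ord0, \row_j x 0 (lift ord0 j)).
have unconsK p : uncons (rV_cons p) = p.
  case: p => a v; rewrite /uncons rV_cons0; congr pair.
  by apply/rowP => j; rewrite mxE rV_consS.
have muncons : measurable_fun setT uncons.
  apply/measurable_fun_pairP; split; first exact: measurable_coord.
  apply: measurable_fun_rV => i; rewrite /=.
  under eq_fun do rewrite mxE.
  exact: measurable_coord.
exists (fun n => uncons @^-1` F n).
  by rewrite -preimage_bigcup -FT preimage_setT.
move=> n; have [mFn Fn] := mF n; split.
  by rewrite -[X in measurable X]setTI; exact: muncons.
rewrite /lebesgue_rV_succ /pushforward -comp_preimage.
by rewrite (_ : uncons \o rV_cons = id) //; apply/funext => p; exact: unconsK.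
Qed.

HB.instance Definition _ := Measure_isSigmaFinite.Build _ _ _ lebesgue_rV_succ
  succ_sigma_finite.

End lebesgue_rV_succ.

(* Lebesgue measure on R^d as a d-fold product, see lebesgue_rV_box.          *)
Fixpoint lebesgue_rV {R : realType} (d : nat) :
    {sigma_finite_measure set 'rV[R]_d -> \bar R} :=
  if d is d'.+1 then lebesgue_rV_succ (lebesgue_rV d')
  else \d_(0 : 'rV[R]_0).

Lemma lebesgue_rV_box (R : realType) (d : nat) (a b : 'rV[R]_d) :
  (forall i, a 0 i <= b 0 i) ->
  lebesgue_rV d [set x : 'rV[R]_d | forall i, x 0 i \in `[a 0 i, b 0 i]] =
  (\prod_(i < d) (b 0 i - a 0 i))%:E.
Proof.
elim: d a b => [|d IH] a b ab.
  rewrite big_ord0 /= diracE mem_set//=.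
  by case.
rewrite big_ord_recl /=.
pose a' : 'rV[R]_d := \row_j a 0 (lift ord0 j).
pose b' : 'rV[R]_d := \row_j b 0 (lift ord0 j).
pose box' := [set x : 'rV[R]_d | forall i, x 0 i \in `[a' 0 i, b' 0 i]].
have mbox' : measurable box'.
  rewrite (_ : box' = \bigcap_(i in [set: 'I_d])
      ((fun x : 'rV[R]_d => x 0 i : measurableTypeR R) @^-1`
       [set` `[a' 0 i, b' 0 i]])); last first.
    by apply/seteqP; split => x /= h i; [move=> _; exact: h|exact: h].
  apply: fin_bigcap_measurable => // i _.
  by rewrite -[X in measurable X]setTI; apply: measurable_coord.
rewrite /lebesgue_rV_succ /pushforward.
rewrite (_ : _ @^-1` _ = [set` `[a 0 ord0, b 0 ord0]] `*` box'); last first.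
  apply/seteqP; split => -[x v] /=.
    move=> h; split; first by have := h ord0; rewrite rV_cons0.
    by move=> i; have := h (lift ord0 i); rewrite rV_consS !mxE.
  move=> [h1 h2] i; case: (unliftP ord0 i) => [j|] ->.
    by have := h2 j; rewrite rV_consS !mxE.
  by rewrite rV_cons0.
rewrite product_measure1E// /box' IH; last first.
  by move=> i; rewrite !mxE.
rewrite EFinM; congr (_ * _)%E; last first.
  by congr EFin; apply: eq_bigr => i _; rewrite !mxE.
apply: etrans (lebesgue_measure_itv _) _; rewrite /= lte_fin.
case: ltP => // h; have /eqP -> : a 0 ord0 == b 0 ord0 by rewrite eq_le ab h.
by rewrite subrr.
Qed.

Section euclidean.
Context {R : realType} {d : nat}.
Implicit Types (x y xi : 'rV[R]_d) (r t : R) (f g : 'rV[R]_d -> R[i]).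

Definition dotp x y : R := \sum_(j < d) x 0 j * y 0 j.

(* The library norm `|x| and balls on 'rV[R]_d are those of the sup norm.     *)
Definition enorm x : R := Num.sqrt (dotp x x).

Definition eball r : set 'rV[R]_d := [set x | enorm x < r].

Definition volume (E : set 'rV[R]_d) : R := fine (lebesgue_rV d E).

Definition e1 : 'rV[R]_d := \row_(j < d) ((j : nat) == 0%N)%:R.

Definition cintegral (E : set 'rV[R]_d) f : R[i] :=
  (\int[lebesgue_rV d]_(x in E) complex.Re (f x)) +i*
  (\int[lebesgue_rV d]_(x in E) complex.Im (f x)).

Definition cexp (z : R[i]) : R[i] :=
  (expR (complex.Re z))%:C * (cos (complex.Im z) +i* sin (complex.Im z)).

Definition psi (lambda : R[i]) xi : R[i] :=
  ((volume (eball 1))^-1)%:C *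
  cintegral (eball 1) (fun y => cexp (- 'i%C * lambda * (dotp xi y)%:C)).

Definition convolution f g x : R[i] :=
  cintegral setT (fun y => f y * g (x - y)).

Definition ball_average t f x : R[i] :=
  ((volume (eball t))^-1)%:C *
  convolution f (fun y => (\1_(eball t) y : R)%:C) x.

Definition borel_measurable f : Prop :=
  measurable_fun setT (fun x => complex.Re (f x) : measurableTypeR R) /\
  measurable_fun setT (fun x => complex.Im (f x) : measurableTypeR R).

Definition ae_equal f g : Prop := {ae lebesgue_rV d, forall x, f x = g x}.

(* Measurability for the completed (Lebesgue) sigma-algebra. cintegral is     *)
(* unaffected by the Borel-null set where f and g differ, since the integral  *)
(* of a nonnegative function is a supremum over Borel simple functions.       *)
Definition lebesgue_measurable f : Prop :=
  exists2 g, borel_measurable g & ae_equal f g.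

Definition partial (j : 'I_d) (u : 'rV[R]_d -> R) : 'rV[R]_d -> R :=
  fun x => 'D_(delta_mx 0 j) u x.

Definition smooth (u : 'rV[R]_d -> R) : Prop :=
  forall s : seq 'I_d, continuous (foldr partial u s) /\
    forall (j : 'I_d) x, derivable (foldr partial u s) x (delta_mx 0 j).

Definition laplacian (u : 'rV[R]_d -> R) : 'rV[R]_d -> R :=
  fun x => - \sum_(j < d) partial j (partial j u) x.

Definition claplacian f : 'rV[R]_d -> R[i] := fun x =>
  laplacian (fun y => complex.Re (f y)) x +i*
  laplacian (fun y => complex.Im (f y)) x.

Definition test_function (phi : 'rV[R]_d -> R[i]) : Prop :=
  [/\ smooth (fun x => complex.Re (phi x)),
      smooth (fun x => complex.Im (phi x)) &
      compact (closure [set x | phi x != 0])].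

(* Delta f = mu f in the sense of distributions, for f locally integrable.    *)
Definition laplacian_eigen f (mu : R[i]) : Prop :=
  forall phi, test_function phi ->
    cintegral setT (fun x => f x * claplacian phi x) =
    cintegral setT (fun x => mu * f x * phi x).

End euclidean.
Arguments e1 {R} d.

(* Main.v *)
Require Import Defs.
From mathcomp Require Import all_boot all_order all_algebra.
From mathcomp Require Import all_classical all_reals all_analysis.
From mathcomp Require Import measurable_realfun complex.
From mathcomp Require Import ring lra.

(* Let T average over B(0,t), normalised to fix exp(a y_1).  The superposition F
   of the exponentials exp(a w.x), |w| = 1, is fixed by all normalised averages
   S_s, and exp(a|x|) <= C (1 + |x|)^d F(x).  Multiplying f_k by powers of the
   phase of A and taking real and imaginary parts, (1) becomes
   T r_k = l r_(k+1) with l = |A| / psi_(ia)(t e_1), and (2) dominates r_k by a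
   power of 1 + |x| times F.

   If l > 1, then r_k = l^-n T^n r_(k-n) tends to 0, as T^n only moves the
   argument of the polynomial factor by n t.

   If l = 1, write T^2 = c S_s + (1 - c) Q for s <= t, where Q is again positive
   and fixes F.  Expanding T^(2n) binomially shows that (S_s - T^2) r_k gains a
   factor n^(-1/2); with n comparable to |x| this lowers the growth by half a
   power.  Iterating with s = t, a finite difference of r_k in k vanishes, so r_k,
   being bounded in k, is constant: T r = r.  By induction on the growth,
   S_s r - r is an eigenfunction, so the pairing of S_s r with
   D phi = sum_j d_j^2 phi - a^2 phi does not depend on s <= t.  The Darboux
   equation for the ball averages of y |-> <r, phi(. + y)>, together with
   T r = r, then forces this pairing to be 0.

   If l < 1, the averages of exp(s x_1) have modulus |A| at some s on each path
   from a to a zero on the imaginary axis.  Two such zeros exist by Sturm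
   comparison, and give two exponentials whose sum is not an eigenfunction. *)

Set Implicit Arguments.
Unset Strict Implicit.
Unset Printing Implicit Defensive.
Import Order.TTheory GRing.Theory Num.Theory.
Import numFieldNormedType.Exports.
Local Open Scope classical_set_scope.
Local Open Scope ring_scope.

(** * Lebesgue measure on R^d *)

(** The function exp(a|x|) is not fixed by the averages, whereas a positive operator that fixes F
    preserves a bound by F exactly; the price is a polynomial factor, removed half a power at a
    time. T^2 rather than T is split because for s = t a splitting of T would compare T with itself,
    while T^2 compares consecutive terms r_(k+1) and r_(k+2). The power n^(-1/2) is the order of the
    total variation between a binomial law and its shift by one, and the n steps are available
    because k may decrease without end. Functions are given up to null sets, while positivity and
    locality are used at points, so an orbit is first replaced by one that satisfies (1) everywhere.
    A single radius t suffices at the end: if the pairing with D phi were nonzero, a quotient of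
    ball averages would be strictly monotone on (0, t]. For l < 1 the path ends at a zero of the
    average, so each smaller modulus occurs, and real parts between 0 and a keep the growth
    bound. *)

Section translation.
Context {R : realType}.
Local Open Scope ereal_scope.

Lemma lebesgue_measure_translation (c : R) (A : set R) : measurable A ->
  pushforward (@lebesgue_measure R) (fun x : measurableTypeR R => (x + c)%R : measurableTypeR R) A = lebesgue_measure A.
Proof.
move=> mA; apply/esym/lebesgue_measure_unique => //=.
  exact: measurable_funD.
move=> mm _ [[a b]] _ <-.
rewrite /pushforward /=.
rewrite (_ : _ @^-1` _ = `](a - c)%R, (b - c)%R]%classic); last first.
  apply/seteqP; split => x /=; rewrite !in_itv/= ltrBlDr lerBrDr//.
rewrite !lebesgue_measure_itv/= !lte_fin ltrD2r; case: ifP => // _.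
by rewrite -!EFinD; congr EFin; ring.
Qed.

Lemma ge0_integral_translation1 (c : R) (f : R -> \bar R) :
  measurable_fun [set: measurableTypeR R] f -> (forall r, 0 <= f r) ->
  \int[lebesgue_measure]_r f (r + c)%R = \int[@lebesgue_measure R]_r f r.
Proof.
move=> mf f0.
have mt : measurable_fun setT (fun x : measurableTypeR R => (x + c)%R : measurableTypeR R).
  exact: measurable_funD.
transitivity (\int[pushforward (@lebesgue_measure R) (fun x : measurableTypeR R => (x + c)%R : measurableTypeR R)]_r f r).
  by rewrite ge0_integral_pushforward.
apply: eq_measure_integral => A mA _; exact: lebesgue_measure_translation.
Qed.

Lemma rV_consD d (p q : measurableTypeR R * 'rV[R]_d) :
  (rV_cons p + rV_cons q)%R = rV_cons ((p.1 + q.1)%R, (p.2 + q.2)%R).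
Proof.
apply/rowP => i; rewrite mxE; case: (unliftP ord0 i) => [j|] ->.
  by rewrite !rV_consS/= mxE.
by rewrite !rV_cons0.
Qed.

Lemma measurable_rV_translation d (v : 'rV[R]_d) :
  measurable_fun setT (fun x : 'rV[R]_d => (x + v)%R).
Proof.
apply: measurable_fun_rV => i; under eq_fun do rewrite mxE.
by apply: measurable_funD => //; exact: measurable_coord.
Qed.

Lemma ge0_integral_translation d (v : 'rV[R]_d) (f : 'rV[R]_d -> \bar R) :
  measurable_fun setT f -> (forall x, 0 <= f x) ->
  \int[lebesgue_rV d]_x f (x + v)%R = \int[lebesgue_rV d]_x f x.
Proof.
elim: d v f => [|d IH] v f mf f0.
  by apply: eq_integral => x _; congr f; apply/rowP; case.
rewrite /=.
rewrite /lebesgue_rV_succ.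
have mcons := @measurable_rV_cons R d.
have mfv : measurable_fun setT (fun x : 'rV[R]_d.+1 => f (x + v)%R).
  exact: measurableT_comp mf (measurable_rV_translation v).
rewrite !ge0_integral_pushforward//.
rewrite !preimage_setT.
rewrite !fubini_tonelli1; [|exact: measurableT_comp mf mcons|by move=> p; exact: f0
  |exact: measurableT_comp mfv mcons|by move=> p; exact: f0].
pose v' : 'rV[R]_d := \row_j v 0%R (lift ord0 j).
have vE : v = rV_cons (v 0%R ord0, v').
  apply/rowP => i; case: (unliftP ord0 i) => [j|] ->.
    by rewrite !rV_consS/= mxE.
  by rewrite !rV_cons0.
rewrite /fubini_F/=.
transitivity (\int[@lebesgue_measure R]_x \int[lebesgue_rV d]_w
    f (rV_cons ((x + v 0%R ord0)%R, w))).
  apply: eq_integral => x _.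
  rewrite -(IH v' (fun w => f (rV_cons ((x + v 0%R ord0)%R, w))))//; last first.
    apply: (measurableT_comp (f := fun p => f (rV_cons p))).
      exact: measurableT_comp.
    exact: measurable_pair1.
  by apply: eq_integral => y _; rewrite {1}vE rV_consD.
apply: (ge0_integral_translation1 _
    (f := fun x : R => \int[lebesgue_rV d]_w f (rV_cons (x, w)))).
- apply: (measurable_fun_fubini_tonelli_F (f \o @rV_cons R d)).
    exact: (measurableT_comp mf mcons).
  by move=> p; exact: f0.
- by move=> r; exact: integral_ge0.
Qed.

End translation.

(** * The Euclidean inner product, norm and reflections *)

Section euclidean_norm.
Context {R : realType} {d : nat}.
Implicit Types (x y z : 'rV[R]_d) (r : R).

Lemma dotpC x y : dotp x y = dotp y x.
Proof. by apply: eq_bigr => i _; rewrite mulrC. Qed.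

Lemma dotpDl x y z : dotp (x + y) z = dotp x z + dotp y z.
Proof. by rewrite -big_split/=; apply: eq_bigr => i _; rewrite mxE mulrDl. Qed.

Lemma dotpZl r x y : dotp (r *: x) y = r * dotp x y.
Proof. by rewrite mulr_sumr; apply: eq_bigr => i _; rewrite mxE mulrA. Qed.

Lemma dotpNl x y : dotp (- x) y = - dotp x y.
Proof. by rewrite -scaleN1r dotpZl mulN1r. Qed.

Lemma dotpDr x y z : dotp x (y + z) = dotp x y + dotp x z.
Proof. by rewrite dotpC dotpDl !(dotpC _ x). Qed.

Lemma dotpZr r x y : dotp x (r *: y) = r * dotp x y.
Proof. by rewrite dotpC dotpZl dotpC. Qed.

Lemma dotpNr x y : dotp x (- y) = - dotp x y.
Proof. by rewrite dotpC dotpNl dotpC. Qed.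

Lemma dotpp_ge0 x : 0 <= dotp x x.
Proof. by apply: sumr_ge0 => i _; rewrite -expr2 sqr_ge0. Qed.

Lemma dotpp_eq0 x : dotp x x = 0 -> x = 0.
Proof.
move=> /eqP; rewrite psumr_eq0 => [/allP h|i _]; last by rewrite -expr2 sqr_ge0.
apply/rowP => i; have := h i (mem_index_enum _).
by rewrite mxE mulf_eq0 orbb => /eqP.
Qed.

Lemma enorm_ge0 x : 0 <= enorm x.
Proof. exact: sqrtr_ge0. Qed.

Lemma enorm_sqr x : enorm x ^+ 2 = dotp x x.
Proof. by rewrite sqr_sqrtr// dotpp_ge0. Qed.

Lemma enorm0 : enorm (0 : 'rV[R]_d) = 0.
Proof.
by rewrite /enorm (_ : dotp _ _ = 0) ?sqrtr0//; apply: big1 => i _; rewrite mxE mul0r.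
Qed.

Lemma enorm_eq0 x : enorm x = 0 -> x = 0.
Proof. by move=> x0; apply: dotpp_eq0; rewrite -enorm_sqr x0 expr0n. Qed.

Lemma enormN x : enorm (- x) = enorm x.
Proof. by rewrite /enorm dotpNl dotpNr opprK. Qed.

Lemma enormZ r x : enorm (r *: x) = `|r| * enorm x.
Proof.
by rewrite /enorm dotpZl dotpZr mulrA -expr2 sqrtrM ?sqr_ge0// sqrtr_sqr.
Qed.

Lemma dotp_le x y : dotp x y <= enorm x * enorm y.
Proof.
have [y0|y0] := eqVneq (enorm y) 0.
  have -> := enorm_eq0 y0; rewrite enorm0 mulr0 /dotp big1// => i _.
  by rewrite mxE mulr0.
have yp : 0 < enorm y by rewrite lt_def y0 enorm_ge0.
have : 0 <= dotp (enorm y ^+ 2 *: x - dotp x y *: y) (enorm y ^+ 2 *: x - dotp x y *: y).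
  exact: dotpp_ge0.
rewrite dotpDl !dotpDr !dotpNl !dotpNr !dotpZl !dotpZr (dotpC y x) -!enorm_sqr => h.
have {}h : 0 <= enorm y ^+ 2 * ((enorm x * enorm y) ^+ 2 - dotp x y ^+ 2).
  apply: le_trans h _; rewrite le_eqVlt; apply/orP; left; apply/eqP; ring.
rewrite pmulr_rge0 ?exprn_gt0// subr_ge0 in h.
have nn : 0 <= enorm x * enorm y by rewrite mulr_ge0 ?enorm_ge0.
have [d0|d0] := leP 0 (dotp x y); last by rewrite (le_trans (ltW d0)).
by rewrite -(@ler_pXn2r _ 2)// nnegrE.
Qed.

Lemma enormD x y : enorm (x + y) <= enorm x + enorm y.
Proof.
rewrite -(@ler_pXn2r _ 2)// ?nnegrE ?addr_ge0 ?enorm_ge0//.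
rewrite enorm_sqr dotpDl !dotpDr (dotpC y x) sqrrD -!enorm_sqr.
have := dotp_le x y; lra.
Qed.

Lemma enormB x y : enorm (x - y) <= enorm x + enorm y.
Proof. by rewrite -(enormN y) enormD. Qed.

Lemma norm_dotp_le x y : `|dotp x y| <= enorm x * enorm y.
Proof.
rewrite ler_norml dotp_le andbT lerNl -dotpNr (le_trans (dotp_le _ _))//.
by rewrite enormN.
Qed.

Lemma coord_le_enorm x i : `|x 0 i| <= enorm x.
Proof.
rewrite -(@ler_pXn2r _ 2)// ?nnegrE ?enorm_ge0// enorm_sqr real_normK ?num_real//.
rewrite /dotp (bigD1 i)//= expr2 lerDl.
by apply: sumr_ge0 => j _; rewrite -expr2 sqr_ge0.
Qed.

Lemma enorm_le_coord x r : 0 <= r -> (forall i, `|x 0 i| <= r) -> enorm x <= d%:R * r.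
Proof.
move=> r0 h; rewrite -(@ler_pXn2r _ 2)// ?nnegrE ?enorm_ge0 ?mulr_ge0//.
rewrite enorm_sqr exprMn; apply: (@le_trans _ _ (\sum_(j < d) r ^+ 2)).
  apply: ler_sum => j _; rewrite -expr2 -[x 0 j ^+ 2]real_normK ?num_real//.
  by rewrite ler_pXn2r// nnegrE.
rewrite sumr_const card_ord -[X in X <= _]mulr_natl ler_wpM2r ?sqr_ge0//.
by rewrite -natrX ler_nat; case: (d) => // n; rewrite leq_pmulr.
Qed.

Lemma dotp_e1 (hd : (0 < d)%N) x : dotp (e1 d) x = x 0 (Ordinal hd).
Proof.
rewrite /dotp (bigD1 (Ordinal hd))//= !mxE eqxx mul1r big1 ?addr0// => j jn.
rewrite mxE (_ : _ == _ = false) ?mul0r//; apply/negbTE; apply: contra jn => /eqP j0.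
exact/eqP/val_inj.
Qed.

Lemma enorm_e1 (hd : (0 < d)%N) : enorm (e1 d : 'rV[R]_d) = 1.
Proof. by rewrite /enorm (dotp_e1 hd) mxE eqxx sqrtr1. Qed.

(** The reflection that exchanges two unit vectors u and v. For u = v the vector w is 0 and the map
    is the identity, so this case has no separate definition. *)
Definition householder u v x := let w := u - v in
  x - (2 * dotp w x / dotp w w) *: w.

Lemma householderD u v x y :
  householder u v (x + y) = householder u v x + householder u v y.
Proof.
rewrite /householder dotpDr mulrDr mulrDl scalerDl opprD.
by rewrite addrACA.
Qed.

Lemma dotp_householder u v x y : dotp (householder u v x) (householder u v y) = dotp x y.
Proof.
rewrite /householder; move: (u - v) => w /=.
have [w0|w0] := eqVneq (dotp w w) 0.
  by rewrite (dotpp_eq0 w0) !scaler0 !subr0.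
rewrite dotpDl !dotpDr !dotpNl !dotpNr !dotpZl !dotpZr (dotpC x w).
by field.
Qed.

Lemma householderK u v : involutive (householder u v).
Proof.
move=> x; rewrite /householder; move: (u - v) => w /=.
have [w0|w0] := eqVneq (dotp w w) 0.
  by rewrite (dotpp_eq0 w0) !scaler0 !subr0.
rewrite (_ : dotp w (x - _) = - dotp w x); last first.
  by rewrite dotpDr dotpNr dotpZr; field.
by rewrite mulrN mulNr scaleNr opprK subrK.
Qed.

Lemma householder_swap u v : enorm u = 1 -> enorm v = 1 -> householder u v u = v.
Proof.
move=> u1 v1; rewrite /householder.
have [w0|w0] := eqVneq (dotp (u - v) (u - v)) 0.
  have := dotpp_eq0 w0 => /eqP; rewrite subr_eq0 => /eqP ->.
  by rewrite subrr scaler0 subr0.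
have uu : dotp u u = 1 by rewrite -enorm_sqr u1 expr1n.
have vv : dotp v v = 1 by rewrite -enorm_sqr v1 expr1n.
have -> : 2 * dotp (u - v) u = dotp (u - v) (u - v).
  rewrite !(dotpDl, dotpDr, dotpNl, dotpNr) uu vv (dotpC v u); ring.
by rewrite divff// scale1r opprB addrC subrK.
Qed.

Lemma enorm_householder u v x : enorm (householder u v x) = enorm x.
Proof. by rewrite /enorm dotp_householder. Qed.

End euclidean_norm.

(** * Measurability for the sigma-algebra of the coordinates *)

Section measurability.
Context {R : realType} {d : nat}.
Local Notation V := 'rV[R]_d.

Lemma measurable_coordT d1 (T : measurableType d1) (f : T -> V) (i : 'I_d) :
  measurable_fun setT f ->
  measurable_fun setT (fun x => f x 0 i : measurableTypeR R).
Proof. by move=> mf; exact: (measurableT_comp (measurable_coord i) mf). Qed.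

Lemma measurable_rVD d1 (T : measurableType d1) (f g : T -> V) :
  measurable_fun setT f -> measurable_fun setT g ->
  measurable_fun setT (fun x => f x + g x).
Proof.
move=> mf mg; apply: measurable_fun_rV => i; under eq_fun do rewrite mxE.
by apply: measurable_funD => //; exact: measurable_coordT.
Qed.

Lemma measurable_rVZ d1 (T : measurableType d1) (k : T -> R) (f : T -> V) :
  measurable_fun setT k -> measurable_fun setT f ->
  measurable_fun setT (fun x => k x *: f x).
Proof.
move=> mk mf; apply: measurable_fun_rV => i; under eq_fun do rewrite mxE.
by apply: measurable_funM => //; exact: measurable_coordT.
Qed.

Lemma measurable_rVN d1 (T : measurableType d1) (f : T -> V) :
  measurable_fun setT f -> measurable_fun setT (fun x => - f x).
Proof.
move=> mf; under eq_fun do rewrite -scaleN1r.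
exact: measurable_rVZ.
Qed.

Lemma measurable_rVB d1 (T : measurableType d1) (f g : T -> V) :
  measurable_fun setT f -> measurable_fun setT g ->
  measurable_fun setT (fun x => f x - g x).
Proof. by move=> mf mg; apply: measurable_rVD => //; exact: measurable_rVN. Qed.

Lemma measurable_dotp d1 (T : measurableType d1) (f g : T -> V) :
  measurable_fun setT f -> measurable_fun setT g ->
  measurable_fun setT (fun x => dotp (f x) (g x)).
Proof.
move=> mf mg; apply: measurable_sum => i.
by apply: measurable_funM => //; exact: measurable_coordT.
Qed.

Lemma measurable_sqrt : measurable_fun setT (@Num.sqrt R).
Proof. by apply: continuous_measurable_fun; exact: sqrt_continuous. Qed.

Lemma measurable_enorm d1 (T : measurableType d1) (f : T -> V) :
  measurable_fun setT f -> measurable_fun setT (fun x => enorm (f x)).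
Proof.
move=> mf; exact: (measurableT_comp measurable_sqrt (measurable_dotp mf mf)).
Qed.

Lemma measurable_eball (r : R) : measurable (eball r : set V).
Proof.
rewrite (_ : eball r = enorm @^-1` `]-oo, r[%classic); last first.
  by apply/seteqP; split => x; rewrite /= in_itv.
rewrite -[X in measurable X]setTI; apply: measurable_enorm => //.
Qed.

Lemma measurable_rV_ball (x : V) (e : R) : measurable (ball x e).
Proof.
have [e0|e0] := leP e 0.
  by rewrite (_ : ball x e = set0)//; apply/seteqP; split => // y [/=]; rewrite ltNge e0.
rewrite (_ : ball x e = \bigcap_(i in [set: 'I_d])
      ((fun y : V => y 0 i : measurableTypeR R) @^-1` (ball (x 0 i) e))).
  apply: fin_bigcap_measurable => // i _.
  by rewrite -[X in measurable X]setTI; apply: measurable_coord => //; exact: measurable_ball.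
apply/seteqP; split => y /=.
  by move=> [_ h] i _; exact: h.
by move=> h; split=> // i j; rewrite ord1; exact: h.
Qed.

(** Second countability: an open set is the union of the sup-norm balls with rational centre and
    radius that it contains. The union runs over all rational pairs; the others contribute the empty
    set. *)
Lemma open_measurable_rV (A : set V) : open A -> measurable A.
Proof.
move=> oA.
pose rv (q : 'rV[rat]_d) : V := map_mx ratr q.
rewrite (_ : A = \bigcup_(p : 'rV[rat]_d * rat)
    (if `[< ball (rv p.1) (ratr p.2) `<=` A >] then ball (rv p.1) (ratr p.2) else set0)).
  apply: countable_bigcupT_measurable => // p.
  by case: ifPn => // _; exact: measurable_rV_ball.
apply/seteqP; split => [x Ax|x [p _]]; last by case: asboolP => // h; exact: h.
have /nbhs_ballP[e /= e0 xe] := oA _ Ax.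
have /rat_in_itvoo[r] : 0 < e / 2 by rewrite divr_gt0.
rewrite in_itv/= => /andP[r0 re].
have hq i : {q : rat | ratr q \in `]x 0 i - ratr r, x 0 i + ratr r[}.
  apply/cid; apply: rat_in_itvoo; lra.
exists (\row_i sval (hq i), r) => //=.
have close i : `|x 0 i - ratr (sval (hq i))| < ratr r.
  by case: (hq i) => q /=; rewrite in_itv/= ltr_distlC => /andP[? ?]; apply/andP; split; lra.
have xb : ball (rv (\row_i sval (hq i))) (ratr r) x.
  split => // i j; rewrite !mxE ord1 /ball/= distrC; exact: close.
case: asboolP => // -[] y [_ yb]; apply: xe; split => // i j.
have := yb i j; rewrite !mxE ord1 /ball/= => h.
have := close j; rewrite -[x 0 j - _](opprB) normrN => h2.
have -> : x 0 j - y 0 j = (ratr (sval (hq j)) - y 0 j) - (ratr (sval (hq j)) - x 0 j) by ring.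
by rewrite (le_lt_trans (ler_normB _ _))//; lra.
Qed.

Lemma continuous_measurable_rV (f : V -> R) : continuous f -> measurable_fun setT f.
Proof.
move=> /continuousP cf; apply: (measurability _ (RGenOpens.measurableE R)).
move=> _ [_ [a [b ->] <-]]; rewrite setTI; apply: open_measurable_rV.
exact/cf/interval_open.
Qed.

End measurability.

(** * Linear changes of variables *)

Section linear_substitution.
Context {R : realType} {d : nat}.
Local Notation V := 'rV[R]_d.
Local Notation mu := (lebesgue_rV d).
Local Open Scope ereal_scope.

(* Uniqueness of translation-invariant measures: Tonelli applied to
   [f (U x + y) * 1_C y] compares the images of Lebesgue measure under U. *)
Lemma ge0_integral_linear (U U' : V -> V) (C : set V) (f : V -> \bar R) :
  (forall x y, U (x + y)%R = (U x + U y)%R) -> cancel U' U ->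
  measurable_fun setT U -> measurable C -> (forall x, C (- x)%R <-> C x) ->
  measurable_fun setT f -> (forall x, 0 <= f x) ->
  \int[mu]_x f (U x) * mu C = \int[mu]_x f x * mu (U @^-1` C).
Proof.
move=> UD U'K mU mC Csym mf f0.
have U0 : U 0%R = 0%R by apply: (addrI (U 0%R)); rewrite -UD !addr0.
have UN x : U (- x)%R = (- U x)%R.
  by apply/eqP; rewrite -subr_eq0 opprK -UD addNr U0.
have mfU : measurable_fun setT (fun x : V => f (U x)).
  exact: measurableT_comp mf mU.
have mUC : measurable (U @^-1` C) by rewrite -[X in measurable X]setTI; exact: mU.
have mind : measurable_fun setT (fun y : V => (\1_C y)%:E : \bar R).
  by apply/measurable_EFinP; exact: measurable_indic.
have i0 (A : set V) y : 0 <= (\1_A y)%:E :> \bar R by rewrite lee_fin.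
have mUV (v : V) : measurable_fun setT (fun x : V => (U x + v)%R).
  by apply: measurable_rVD.
transitivity (\int[mu]_y \int[mu]_x (f (U x + y)%R * (\1_C y)%:E)).
  rewrite -[in mu C](setIT C) -integral_indic// -ge0_integralZl//; last exact: integral_ge0.
  apply: eq_integral => y _.
  rewrite ge0_integralZr//; last exact: measurableT_comp mf (mUV y).
  congr (_ * _).
  rewrite -(ge0_integral_translation (U' y) mfU)//.
  by apply: eq_integral => x _; rewrite UD U'K.
have mg : measurable_fun setT (fun p : V * V => f (U p.2 + p.1)%R * (\1_C p.1)%:E).
  apply: emeasurable_funM.
    apply: (measurableT_comp mf); apply: measurable_rVD => //.
    exact: (measurableT_comp mU measurable_snd).
  exact: (measurableT_comp mind measurable_fst).
rewrite (fubini_tonelli (fun p : V * V => f (U p.2 + p.1)%R * (\1_C p.1)%:E))//; last first.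
  by move=> p; rewrite mule_ge0.
have mCs (v : V) : measurable_fun setT (fun y : V => (\1_C (y - v)%R)%:E : \bar R).
  by apply: (measurableT_comp mind); exact: measurable_rVB.
transitivity (\int[mu]_x \int[mu]_y (f y * (\1_C (y - U x)%R)%:E)).
  apply: eq_integral => x _.
  rewrite -(ge0_integral_translation (U x) (f := fun y => f y * (\1_C (y - U x)%R)%:E)).
  - by apply: eq_integral => y _; rewrite addrK addrC.
  - exact: emeasurable_funM.
  - by move=> y; rewrite mule_ge0.
rewrite (fubini_tonelli (fun p : V * V => f p.2 * (\1_C (p.2 - U p.1)%R)%:E)); last 2 first.
- apply: emeasurable_funM.
    exact: (measurableT_comp mf measurable_snd).
  apply: (measurableT_comp mind); apply: measurable_rVB => //.
  exact: (measurableT_comp mU measurable_fst).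
- by move=> p; rewrite mule_ge0.
rewrite -ge0_integralZr//.
apply: eq_integral => y _ /=.
have mCU (v : V) : measurable_fun setT (fun x : V => (\1_C (v - U x)%R)%:E : \bar R).
  by apply: (measurableT_comp mind); exact: measurable_rVB.
rewrite ge0_integralZl//; congr (_ * _).
rewrite -(ge0_integral_translation (U' y) (mCU y))//.
rewrite -[in RHS](setIT (U @^-1` C)) -integral_indic//.
apply: eq_integral => x _; congr EFin.
rewrite UD U'K opprD addrA addrAC subrr add0r !indicE.
congr (nat_of_bool _)%:R.
by apply/idP/idP; rewrite !inE/= => /Csym.
Qed.

End linear_substitution.

(** * Volumes of cubes and balls, null spheres *)

Section ball_volume.
Context {R : realType} {d : nat}.
Local Notation V := 'rV[R]_d.
Local Notation mu := (lebesgue_rV d).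

Definition cube (r : R) : set V := [set x | forall i, x 0 i \in `[(- r)%R, r]].

Lemma measurable_cube (r : R) : measurable (cube r).
Proof.
rewrite (_ : cube r = \bigcap_(i in [set: 'I_d])
    ((fun x : V => x 0 i : measurableTypeR R) @^-1` [set` `[- r, r]])); last first.
  by apply/seteqP; split => x /= h i; [move=> _; exact: h|exact: h].
apply: fin_bigcap_measurable => // i _.
by rewrite -[X in measurable X]setTI; apply: measurable_coord.
Qed.

Lemma cube_volume (r : R) : 0 <= r -> mu (cube r) = ((2 * r) ^+ d)%:E.
Proof.
move=> r0; have := @lebesgue_rV_box R d (const_mx (- r)) (const_mx r).
under eq_set do under eq_forall do rewrite !mxE.
move=> ->; last by move=> i; rewrite !mxE; lra.
under eq_bigr do rewrite !mxE.
rewrite prodr_const card_ord; congr (_ ^+ _)%:E; ring.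
Qed.

Lemma cubeN (r : R) x : cube r (- x) <-> cube r x.
Proof.
by split => h i; have := h i; rewrite !mxE !in_itv/= => /andP[? ?]; apply/andP; split; lra.
Qed.

Lemma eball_cube (r : R) : eball r `<=` cube r.
Proof.
move=> x xr i; rewrite in_itv/= -ler_norml.
exact: (le_trans (coord_le_enorm _ _) (ltW xr)).
Qed.

Lemma cube_eball (r s : R) : 0 <= r -> d%:R * r < s -> cube r `<=` eball s.
Proof.
move=> r0 rs x xr; rewrite /eball/=; apply: le_lt_trans rs.
by apply: enorm_le_coord => // i; rewrite ler_norml; have := xr i; rewrite in_itv.
Qed.

Lemma eballN (r : R) (x : V) : eball r (- x) <-> eball r x.
Proof. by rewrite /eball/= enormN. Qed.

Lemma eball_lty (r : R) : (mu (eball r) < +oo)%E.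
Proof.
have [r0|r0] := leP r 0.
  rewrite (_ : eball r = set0) ?measure0//; apply/seteqP; split => // x.
  by rewrite /eball/= ltNge (le_trans r0)// enorm_ge0.
apply: (@le_lt_trans _ _ (mu (cube r))).
  by apply: le_measure; rewrite ?inE; [exact: measurable_eball|exact: measurable_cube|exact: eball_cube].
by rewrite cube_volume ?ltW// ltry.
Qed.

Lemma eball_gt0 (r : R) : 0 < r -> (0 < mu (eball r))%E.
Proof.
move=> r0; have q0 : 0 < r / (d%:R + 1) by rewrite divr_gt0// ltr_wpDl.
apply: (@lt_le_trans _ _ (mu (cube (r / (d%:R + 1))))).
  by rewrite cube_volume ?ltW// lte_fin exprn_gt0// mulr_gt0.
apply: le_measure; rewrite ?inE; [exact: measurable_cube|exact: measurable_eball|].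
apply: cube_eball; first exact: ltW.
rewrite mulrA ltr_pdivrMr ?ltr_wpDl// mulrDr mulr1 mulrC ltrDl//.
Qed.

Lemma volume_gt0 (r : R) : 0 < r -> 0 < volume (eball r : set V).
Proof. by move=> r0; rewrite fine_gt0// eball_lty eball_gt0. Qed.

Lemma volumeE (r : R) : (volume (eball r : set V))%:E = mu (eball r).
Proof. by rewrite fineK// ge0_fin_numE// eball_lty. Qed.

Lemma integral_eball (r : R) :
  (\int[mu]_x (\1_(eball r) x)%:E = (volume (eball r : set V))%:E)%E.
Proof.
rewrite integral_indic//; last exact: measurable_eball.
by rewrite setIT volumeE.
Qed.

(** The unit ball is its own preimage, so its finite positive volume cancels in
    [ge0_integral_linear]. *)
Lemma ge0_integral_isometry (U U' : V -> V) (f : V -> \bar R) :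
  (forall x y, U (x + y) = U x + U y) -> cancel U' U ->
  measurable_fun setT U -> (forall x, enorm (U x) = enorm x) ->
  measurable_fun setT f -> (forall x, (0 <= f x)%E) ->
  (\int[mu]_x f (U x) = \int[mu]_x f x)%E.
Proof.
move=> UD U'K mU Uiso mf f0.
have := ge0_integral_linear UD U'K mU (measurable_eball 1) (@eballN 1) mf f0.
rewrite (_ : U @^-1` eball 1 = eball 1); last by apply/seteqP; split => x /=; rewrite /eball/= Uiso.
rewrite -volumeE => h.
have v0 := @volume_gt0 1 ltr01.
have := congr1 (fun z => z * ((volume (eball 1 : set V))^-1)%:E)%E h.
by rewrite -!muleA -EFinM divff ?gt_eqF// !mule1.
Qed.

Lemma ge0_integral_reflection (f : V -> \bar R) :
  measurable_fun setT f -> (forall x, (0 <= f x)%E) ->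
  (\int[mu]_x f (- x)%R = \int[mu]_x f x)%E.
Proof.
move=> mf f0; apply: (@ge0_integral_isometry -%R -%R) => //.
- exact: opprD.
- exact: opprK.
- exact: measurable_rVN.
- exact: enormN.
Qed.

(** The comparison set is a cube, because its volume and its preimage are explicit; the volume of a
    dilated ball is a consequence. *)
Lemma ge0_integral_scaling (r : R) (f : V -> \bar R) : 0 < r ->
  measurable_fun setT f -> (forall x, (0 <= f x)%E) ->
  (\int[mu]_x f (r *: x)%R = ((r ^- d)%:E * \int[mu]_x f x))%E.
Proof.
move=> r0 mf f0.
have mU : measurable_fun setT (fun x : V => r *: x) by exact: measurable_rVZ.
have UK : cancel (fun x : V => r^-1 *: x) (fun x : V => r *: x).
  by move=> x; rewrite scalerA divff ?gt_eqF// scale1r.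
have := ge0_integral_linear (scalerDr r) UK mU (measurable_cube 1) (@cubeN 1) mf f0.
rewrite (_ : _ @^-1` cube 1 = cube r^-1); last first.
  apply/seteqP; split => x /= h i; have := h i; rewrite !mxE !in_itv/= -!ler_norml normrM (gtr0_norm r0).
    by rewrite mulrC -ler_pdivlMr// mul1r.
  by move=> hi; rewrite mulrC -ler_pdivlMr// mul1r.
rewrite !cube_volume ?invr_ge0 ?(ltW r0)// mulr1 => h.
have := congr1 (fun z => z * ((2%R ^- d)%:E : \bar R))%E h.
rewrite -!muleA -!EFinM divff ?mule1 ?expf_neq0// => ->.
rewrite muleC; congr (EFin _ * _)%E.
by rewrite exprMn mulrAC divff ?expf_neq0// mul1r exprVn.
Qed.

Lemma volume_eball (r : R) : 0 < r -> volume (eball r : set V) = r ^+ d * volume (eball 1 : set V).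
Proof.
move=> r0.
have mi : measurable_fun setT (fun x : V => (\1_(eball r) x)%:E : \bar R).
  by apply/measurable_EFinP; apply: measurable_indic; exact: measurable_eball.
have := ge0_integral_scaling r0 mi (fun x => lee_tofin (ler0n _ _)).
rewrite (_ : (fun x : V => _) = (fun x => (\1_(eball 1) x)%:E)); last first.
  apply/funext => x; congr EFin; rewrite !indicE; congr (nat_of_bool _)%:R.
  by apply/idP/idP; rewrite !inE /eball/= enormZ gtr0_norm// gtr_pMr.
rewrite !integral_eball -EFinM => -[->]; rewrite mulrA divff ?mul1r// expf_neq0// gt_eqF//.
Qed.

Lemma measurable_sphere (r : R) : measurable [set x : V | enorm x = r].
Proof.
rewrite (_ : [set x | _] = enorm @^-1` [set r])//.
by rewrite -[X in measurable X]setTI; apply: measurable_enorm.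
Qed.

(** The sphere lies between B(0, r) and a slightly larger ball, and the volume of a ball is
    continuous in the radius. *)
Lemma negligible_sphere (r : R) : (0 < d)%N -> 0 < r ->
  (mu [set x | enorm x = r] = 0)%E.
Proof.
move=> d0 r0; apply/eqP; rewrite eq_le measure_ge0 andbT.
apply/lee_addgt0Pr => e e0; rewrite add0e.
have cf : continuous (fun s : R => s ^+ d * volume (eball 1 : set V)).
  by move=> s; apply: cvgM; [exact: exprn_continuous|exact: cvg_cst].
have /cvgrPdist_lt /(_ _ e0) /nbhs_ballP[k /= k0 hk] := cf r.
have rk : ball r k (r + k / 2).
  rewrite /ball/= opprD addrA subrr sub0r normrN gtr0_norm ?divr_gt0//; lra.
have := hk _ rk; rewrite distrC => /(le_lt_trans (ler_norm _)) {}hk.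
have le1 : (mu (eball r) + mu [set x | enorm x = r] <= mu (eball (r + k / 2)))%E.
  rewrite -measureU; [|exact: measurable_eball|exact: measurable_sphere|]; last first.
    by apply/seteqP; split => // x [] /=; rewrite /eball/= => /[swap] ->; rewrite ltxx.
  apply: le_measure; rewrite ?inE; [|exact: measurable_eball|].
    by apply: measurableU; [exact: measurable_eball|exact: measurable_sphere].
  move=> x [|]; rewrite /eball/= => h; last by rewrite h ltrDl divr_gt0.
  by rewrite (lt_trans h)// ltrDl divr_gt0.
move: le1; rewrite -!volumeE volume_eball// (@volume_eball (r + _)) ?addr_gt0 ?divr_gt0//.
rewrite -leeBrDl//  -EFinB => /le_trans; apply.
by rewrite lee_fin ltW.
Qed.

End ball_volume.

(** * Integrals of locally bounded functions *)

Section arbitrary_integrand.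
Context d {T : measurableType d} {R : realType}.
Variable mu : {measure set T -> \bar R}.
Local Open Scope ereal_scope.
Import HBNNSimple.

(* No measurability: nonnegative integrals are suprema over simple functions. *)
Lemma ge0_ae_le_integral_any (f g : T -> \bar R) :
  (forall x, 0 <= f x) -> (forall x, 0 <= g x) ->
  {ae mu, forall x, f x = g x} -> \int[mu]_x f x <= \int[mu]_x g x.
Proof.
move=> f0 g0 [N [mN N0 sub]].
rewrite !ge0_integralTE//; apply: ge_ereal_sup => _ /= [h hf <-].
have mCN : measurable (~` N) by exact: measurableC.
pose h' := mul_nnsfun h (indic_nnsfun R mCN).
have -> : sintegral mu h = sintegral mu h'.
  rewrite -!integralT_nnsfun; apply: ge0_ae_eq_integral => //.
  - by apply/measurable_EFinP; exact: measurable_funP.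
  - by apply/measurable_EFinP; exact: measurable_funP.
  - by move=> x _; rewrite lee_fin.
  - by move=> x _; rewrite lee_fin.
  exists N; split => // x; apply: contra_notP => Nx _ /=.
  by rewrite /mindic indicE mem_set// mulr1.
apply: ereal_sup_ubound; exists h' => // x /=.
rewrite /mindic indicE; case: (boolP (x \in ~` N)) => xN /=; last by rewrite mulr0.
rewrite mulr1; have -> : g x = f x; last exact: hf.
by move/set_mem : xN => /=; apply: contra_notP => /nesym fg; exact: sub.
Qed.

Lemma ge0_ae_eq_integral_any (f g : T -> \bar R) :
  (forall x, 0 <= f x) -> (forall x, 0 <= g x) ->
  {ae mu, forall x, f x = g x} -> \int[mu]_x f x = \int[mu]_x g x.
Proof.
move=> f0 g0 fg; apply/eqP; rewrite eq_le !ge0_ae_le_integral_any//.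
by apply: filterS fg => x.
Qed.

Lemma ae_eq_Rintegral_any (f g : T -> R) :
  {ae mu, forall x, f x = g x} -> (\int[mu]_x f x = \int[mu]_x g x)%R.
Proof.
move=> fg; rewrite /Rintegral; congr fine.
rewrite integralE [RHS]integralE; congr (_ - _); apply: ge0_ae_eq_integral_any => //.
- by apply: filterS fg => x; rewrite !funeposE => ->.
- by apply: filterS fg => x; rewrite !funenegE => ->.
Qed.

End arbitrary_integrand.

(** * Bounded integrands of bounded support *)

Section compact_support.
Context {R : realType} {d : nat}.
Local Notation V := 'rV[R]_d.
Local Notation mu := (lebesgue_rV d).
Implicit Types (f g : V -> R) (r s : R).

Definition ind r (x : V) : R := \1_(eball r) x.

Lemma indE r x : ind r x = (enorm x < r)%R%:R.
Proof.
by rewrite /ind indicE; congr (nat_of_bool _)%:R; apply/idP/idP; rewrite inE.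
Qed.

Lemma ind_ge0 r x : 0 <= ind r x. Proof. by rewrite indE. Qed.

Lemma ind_le1 r x : ind r x <= 1. Proof. by rewrite indE lern1; case: ltP. Qed.

Lemma indN r x : ind r (- x) = ind r x. Proof. by rewrite !indE enormN. Qed.

Lemma ind_le r s x : r <= s -> ind r x <= ind s x.
Proof.
rewrite !indE ler_nat => rs; case: ltP => // xr.
by rewrite (lt_le_trans xr rs).
Qed.

Lemma measurable_ind r : measurable_fun setT (ind r).
Proof. by apply: measurable_indic; exact: measurable_eball. Qed.

Lemma integrable_ind r : mu.-integrable setT (EFin \o ind r).
Proof.
apply/integrableP; split; first by apply/measurable_EFinP; exact: measurable_ind.
under eq_integral do rewrite /= ger0_norm ?ind_ge0//.
by rewrite integral_eball ltry.
Qed.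

Lemma Rintegral_ind r : \int[mu]_x ind r x = volume (eball r : set V).
Proof. by rewrite /Rintegral integral_eball. Qed.

(** One inequality encodes boundedness and bounded support. The class [locb] below is its
    counterpart: a product of a [locb] and a [bcs] function is again [bcs], hence integrable. *)
Definition bcs f := measurable_fun setT f /\
  exists M r, forall x, `|f x| <= M * ind r x.

Definition locb f := measurable_fun setT f /\
  forall r, exists M, forall x, enorm x < r -> `|f x| <= M.

Lemma bcs_integrable f : bcs f -> mu.-integrable setT (EFin \o f).
Proof.
move=> [mf [M [r fM]]].
apply: (@le_integrable _ _ _ mu _ measurableT _ (fun x => (M%:E * (ind r x)%:E)%E)).
- exact/measurable_EFinP.
- by move=> x _ /=; rewrite lee_fin (le_trans (fM x))// ler_norm.
- by apply: integrableZl => //; exact: integrable_ind.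
Qed.

Lemma bcs_locb f : bcs f -> locb f.
Proof.
move=> [mf [M [r fM]]]; split => // s; exists `|M| => x _.
apply: (le_trans (fM x)); rewrite (le_trans (ler_norm _))// normrM.
by rewrite ler_piMr// ger0_norm ?ind_ge0// ind_le1.
Qed.

Lemma bcs_mul f g : locb f -> bcs g -> bcs (fun x => f x * g x).
Proof.
move=> [mf fb] [mg [M [r gM]]]; split; first exact: measurable_funM.
have [K fK] := fb r; exists (K * M), r => x; rewrite normrM.
have := gM x; rewrite indE; case: ltP => xr /=.
  by rewrite !mulr1 => gx; rewrite ler_pM// fK.
by rewrite !mulr0 => g0; rewrite (_ : `|g x| = 0) ?mulr0//; apply/eqP; rewrite eq_le g0/=.
Qed.

Lemma bcs_ind r : bcs (ind r).
Proof.
split; first exact: measurable_ind.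
by exists 1, r => x; rewrite mul1r ger0_norm// ind_ge0.
Qed.

Lemma locb_cst (c : R) : locb (fun=> c).
Proof. by split => // r; exists `|c|. Qed.

Lemma locbD f g : locb f -> locb g -> locb (fun x => f x + g x).
Proof.
move=> [mf fb] [mg gb]; split; first exact: measurable_funD.
move=> r; have [M fM] := fb r; have [K gK] := gb r; exists (M + K) => x xr.
by rewrite (le_trans (ler_normD _ _))// lerD// ?fM ?gK.
Qed.

Lemma locbM f g : locb f -> locb g -> locb (fun x => f x * g x).
Proof.
move=> [mf fb] [mg gb]; split; first exact: measurable_funM.
move=> r; have [M fM] := fb r; have [K gK] := gb r; exists (M * K) => x xr.
by rewrite normrM ler_pM// ?fM ?gK.
Qed.

Lemma locbZ c f : locb f -> locb (fun x => c * f x).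
Proof. by move=> lf; apply: locbM => //; exact: locb_cst. Qed.

Lemma locbN f : locb f -> locb (fun x => - f x).
Proof. by move=> lf; under eq_fun do rewrite -mulN1r; exact: locbZ. Qed.

Lemma locbB f g : locb f -> locb g -> locb (fun x => f x - g x).
Proof. by move=> lf lg; apply: locbD => //; exact: locbN. Qed.

Lemma locb_shift f x : locb f -> locb (fun y => f (x - y)).
Proof.
move=> [mf fb]; split.
  by apply: (measurableT_comp mf); exact: measurable_rVB.
move=> r; have [M fM] := fb (enorm x + r); exists M => y yr.
by apply: fM; rewrite (le_lt_trans (enormB _ _))// ltrD2l.
Qed.

Lemma locb_shiftD f x : locb f -> locb (fun y => f (x + y)).
Proof.
move=> [mf fb]; split.
  by apply: (measurableT_comp mf); exact: measurable_rVD.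
move=> r; have [M fM] := fb (enorm x + r); exists M => y yr.
by apply: fM; rewrite (le_lt_trans (enormD _ _))// ltrD2l.
Qed.

Lemma Rintegral_bcsD f g : bcs f -> bcs g ->
  \int[mu]_x (f x + g x) = \int[mu]_x f x + \int[mu]_x g x.
Proof. by move=> bf bg; apply: RintegralD => //; exact: bcs_integrable. Qed.

Lemma Rintegral_bcsB f g : bcs f -> bcs g ->
  \int[mu]_x (f x - g x) = \int[mu]_x f x - \int[mu]_x g x.
Proof. by move=> bf bg; apply: RintegralB => //; exact: bcs_integrable. Qed.

Lemma Rintegral_bcsZ c f : bcs f ->
  \int[mu]_x (c * f x) = c * \int[mu]_x f x.
Proof. by move=> bf; apply: RintegralZl => //; exact: bcs_integrable. Qed.

Lemma le_Rintegral_bcs f g : bcs f -> bcs g -> (forall x, f x <= g x) ->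
  \int[mu]_x f x <= \int[mu]_x g x.
Proof. by move=> bf bg fg; apply: le_Rintegral => //; exact: bcs_integrable. Qed.

Lemma norm_Rintegral_bcs f : bcs f -> `|\int[mu]_x f x| <= \int[mu]_x `|f x|.
Proof. by move=> bf; apply: le_normr_Rintegral => //; exact: bcs_integrable. Qed.

Lemma Rintegral_bcs_le f M r : bcs f -> (forall x, `|f x| <= M * ind r x) ->
  `|\int[mu]_x f x| <= M * volume (eball r : set V).
Proof.
move=> bf fM; rewrite (le_trans (norm_Rintegral_bcs bf))//.
rewrite -Rintegral_ind -Rintegral_bcsZ; last exact: bcs_ind.
apply: le_Rintegral_bcs => //.
  case: bf => mf _; split; first exact: measurableT_comp.
  by exists M, r => x; rewrite normr_id.
by apply: (bcs_mul (f := fun=> M)); [exact: locb_cst|exact: bcs_ind].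
Qed.

Lemma bcs_eq f g : f =1 g -> bcs f -> bcs g.
Proof. by move=> /funext ->. Qed.

Lemma bcsD f g : bcs f -> bcs g -> bcs (fun x => f x + g x).
Proof.
move=> [mf [M [r fM]]] [mg [K [s gK]]]; split; first exact: measurable_funD.
exists (`|M| + `|K|), (Num.max r s) => x.
rewrite (le_trans (ler_normD _ _))// mulrDl lerD//.
  apply: (le_trans (fM x)); apply: (le_trans (ler_wpM2r (ind_ge0 _ _) (ler_norm M))).
  by rewrite ler_wpM2l// ind_le// le_max lexx.
apply: (le_trans (gK x)); apply: (le_trans (ler_wpM2r (ind_ge0 _ _) (ler_norm K))).
by rewrite ler_wpM2l// ind_le// le_max lexx orbT.
Qed.

Lemma bcsZ c f : bcs f -> bcs (fun x => c * f x).
Proof. by apply: bcs_mul; exact: locb_cst. Qed.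

Lemma bcsB f g : bcs f -> bcs g -> bcs (fun x => f x - g x).
Proof.
move=> bf bg; apply: bcsD => //; apply: bcs_eq (bcsZ (-1) bg) => x.
by rewrite mulN1r.
Qed.

Lemma bcs_locb_ind r f : locb f -> bcs (fun x => ind r x * f x).
Proof.
move=> lf; apply: bcs_eq (bcs_mul lf (bcs_ind r)) => x; exact: mulrC.
Qed.

Lemma locb_continuous f : continuous f -> locb f.
Proof.
move=> cf; split; first exact: continuous_measurable_rV.
move=> r.
have : compact (cube r : set V).
  by apply: (@rV_compact R d (fun=> [set` `[(- r)%R, r]])) => _; exact: segment_compact.
have : {within cube r, continuous f} by exact: continuous_subspaceT.
move=> /continuous_compact /[apply] /compact_bounded [M [_ hM]].
exists (M + 1) => x xr; apply: (hM (M + 1)); first by rewrite ltrDl.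
by exists x => //; exact: eball_cube.
Qed.

Lemma Rintegral_invariant (U : V -> V) :
  (forall f : V -> \bar R, measurable_fun setT f -> (forall x, (0 <= f x)%E) ->
    (\int[mu]_x f (U x) = \int[mu]_x f x)%E) ->
  forall f, measurable_fun setT f -> \int[mu]_x f (U x) = \int[mu]_x f x.
Proof.
move=> inv f mf; rewrite /Rintegral integralE [in RHS]integralE.
have mEf : measurable_fun setT (EFin \o f) by exact/measurable_EFinP.
congr (fine (_ - _)%E); rewrite -[RHS]inv//.
- by apply: eq_integral => x _; rewrite !funeposE.
- exact: measurable_funepos.
- by apply: eq_integral => x _; rewrite !funenegE.
- exact: measurable_funeneg.
Qed.

Lemma Rintegral_translation v f : measurable_fun setT f ->
  \int[mu]_x f (x + v) = \int[mu]_x f x.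
Proof.
by apply: (Rintegral_invariant (U := fun x => x + v)) => g; exact: ge0_integral_translation.
Qed.

Lemma Rintegral_reflection f : measurable_fun setT f ->
  \int[mu]_x f (- x) = \int[mu]_x f x.
Proof.
by apply: (Rintegral_invariant (U := -%R)) => g; exact: ge0_integral_reflection.
Qed.

Lemma Rintegral_subl v f : measurable_fun setT f ->
  \int[mu]_x f (v - x) = \int[mu]_x f x.
Proof.
move=> mf; rewrite -(Rintegral_translation v mf) -[RHS]Rintegral_reflection.
  by apply: eq_Rintegral => x _; rewrite addrC.
by apply: (measurableT_comp mf); exact: measurable_rVD.
Qed.

Lemma measurable_householder u v : measurable_fun setT (householder u v : V -> V).
Proof.
apply: measurable_rVB => //; apply: measurable_rVZ => //.
apply: measurable_funM => //; apply: measurable_funM => //; exact: measurable_dotp.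
Qed.

Lemma Rintegral_householder u v f : measurable_fun setT f ->
  \int[mu]_x f (householder u v x) = \int[mu]_x f x.
Proof.
apply: (Rintegral_invariant (U := householder u v)) => g.
apply: (@ge0_integral_isometry _ _ _ (householder u v)).
- exact: householderD.
- exact: householderK.
- exact: measurable_householder.
- exact: enorm_householder.
Qed.

Lemma Rintegral_scaling r f : 0 < r -> bcs f ->
  \int[mu]_x f (r *: x) = r ^- d * \int[mu]_x f x.
Proof.
move=> r0 bf; have [mf _] := bf; have mEf : measurable_fun setT (EFin \o f) by exact/measurable_EFinP.
have iF := bcs_integrable bf.
have fp : (\int[mu]_x (EFin \o f)^\+ x)%E \is a fin_num.
  by apply: integrable_fin_num => //; exact: integrable_funepos.
have fn : (\int[mu]_x (EFin \o f)^\- x)%E \is a fin_num.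
  by apply: integrable_fin_num => //; exact: integrable_funeneg.
rewrite /Rintegral integralE [in RHS]integralE.
have -> : (\int[mu]_x (fun y => (f (r *: y))%:E)^\+ x = (r ^- d)%:E * \int[mu]_x (EFin \o f)^\+ x)%E.
  rewrite -ge0_integral_scaling//; first by apply: eq_integral => x _; rewrite !funeposE.
  exact: measurable_funepos.
have -> : (\int[mu]_x (fun y => (f (r *: y))%:E)^\- x = (r ^- d)%:E * \int[mu]_x (EFin \o f)^\- x)%E.
  rewrite -ge0_integral_scaling//; first by apply: eq_integral => x _; rewrite !funenegE.
  exact: measurable_funeneg.
by rewrite fineB ?fin_numM// [in RHS](fineB fp fn) !fineM// mulrBr.
Qed.

Lemma measurable_Rintegral d1 (T : measurableType d1) (h : T * V -> R) :
  measurable_fun setT h -> measurable_fun setT (fun x => \int[mu]_y h (x, y)).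
Proof.
move=> mh; have mEh : measurable_fun setT (EFin \o h) by exact/measurable_EFinP.
rewrite /Rintegral; apply: (measurableT_comp (f := @fine R)) => //.
under eq_fun do rewrite integralE.
apply: emeasurable_funB.
  rewrite (_ : (fun _ => _) = fubini_F mu (EFin \o h)^\+%E); last first.
    by apply/funext => x; apply: eq_integral => y _; rewrite !funeposE.
  apply: measurable_fun_fubini_tonelli_F => //; exact: measurable_funepos.
rewrite (_ : (fun _ => _) = fubini_F mu (EFin \o h)^\-%E); last first.
  by apply/funext => x; apply: eq_integral => y _; rewrite !funenegE.
apply: measurable_fun_fubini_tonelli_F => //; exact: measurable_funeneg.
Qed.

Lemma fubini_bcs (h : V -> V -> R) M r s :
  measurable_fun setT (fun p : V * V => h p.1 p.2) ->
  (forall x y, `|h x y| <= M * ind r x * ind s y) ->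
  \int[mu]_x (\int[mu]_y h x y) = \int[mu]_y (\int[mu]_x h x y).
Proof.
move=> mh hM.
have mEh : measurable_fun setT (fun p : V * V => (h p.1 p.2)%:E) by exact/measurable_EFinP.
have mh1 x : measurable_fun setT (h x) := measurableT_comp mh (measurable_pair1 x).
have mh2 y : measurable_fun setT (h ^~ y) := measurableT_comp mh (measurable_pair2 y).
have ih : (mu \x mu)%E.-integrable setT (fun p : V * V => (h p.1 p.2)%:E).
  apply/integrable12ltyP => //=.
  apply: (@le_lt_trans _ _ (\int[mu]_x \int[mu]_y (`|M| * ind r x * ind s y)%:E)%E).
    apply: ge0_le_integral => //.
    - by move=> x _; exact: integral_ge0.
    - apply: (measurable_fun_fubini_tonelli_F (fun p : V * V => `|(h p.1 p.2)%:E|%E)) => //.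
      exact: measurableT_comp.
    - apply: (measurable_fun_fubini_tonelli_F (fun p : V * V => (`|M| * ind r p.1 * ind s p.2)%:E)) => //.
      apply/measurable_EFinP; apply: measurable_funM; first apply: measurable_funM => //.
        exact: (measurableT_comp (measurable_ind r) measurable_fst).
      exact: (measurableT_comp (measurable_ind s) measurable_snd).
      by move=> p; rewrite lee_fin !mulr_ge0 ?ind_ge0.
    move=> x _; apply: ge0_le_integral => //.
    - by apply/measurable_EFinP; exact: measurableT_comp (mh1 x).
    - by apply/measurable_EFinP; apply: measurable_funM => //; exact: measurable_ind.
    move=> y _; rewrite lee_fin (le_trans (hM x y))//.
    by rewrite ler_wpM2r ?ind_ge0// ler_wpM2r ?ind_ge0// ler_norm.
  have -> : (\int[mu]_x \int[mu]_y (`|M| * ind r x * ind s y)%:E)%E =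
    (\int[mu]_x ((`|M| * volume (eball s : set V))%:E * (ind r x)%:E))%E.
    apply: eq_integral => x _.
    under eq_integral do rewrite EFinM.
    rewrite ge0_integralZl//; last 3 first.
    - by apply/measurable_EFinP; exact: measurable_ind.
    - by move=> y _; rewrite lee_fin ind_ge0.
    - by rewrite lee_fin mulr_ge0 ?ind_ge0.
    by rewrite integral_eball -!EFinM; congr EFin; ring.
  rewrite ge0_integralZl//; last 3 first.
  - by apply/measurable_EFinP; exact: measurable_ind.
  - by move=> y _; rewrite lee_fin ind_ge0.
  - by rewrite lee_fin mulr_ge0// fine_ge0.
  by rewrite integral_eball -EFinM ltry.
have fin1 x : (\int[mu]_y (h x y)%:E)%E \is a fin_num.
  apply: (integrable_fin_num (D := setT)) => //; apply: (bcs_integrable (f := h x)).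
  split => //.
  by exists (M * ind r x), s => y; exact: hM.
have fin2 y : (\int[mu]_x (h x y)%:E)%E \is a fin_num.
  apply: (integrable_fin_num (D := setT)) => //; apply: (bcs_integrable (f := fun x => h x y)).
  split => //.
  by exists (M * ind s y), r => x; rewrite mulrAC; exact: hM.
rewrite /Rintegral; congr fine.
under eq_integral do rewrite fineK//.
under [in RHS]eq_integral do rewrite fineK//.
exact: (Fubini ih).
Qed.

End compact_support.

(** * Ball averages without normalisation *)

Section ball_sums.
Context {R : realType} {d : nat}.
Local Notation V := 'rV[R]_d.
Local Notation mu := (lebesgue_rV d).
Implicit Types (f g phi : V -> R) (r s t : R).

Definition bsum s f x : R := \int[mu]_y (ind s y * f (x - y)).

Lemma bsum_bcs_int s f x : locb f -> bcs (fun y => ind s y * f (x - y)).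
Proof. by move=> lf; apply: bcs_locb_ind; exact: locb_shift. Qed.

Lemma ind_norm_mul s (y : V) (c M : R) : (enorm y < s -> `|c| <= M) -> `|ind s y * c| <= M * ind s y.
Proof.
move=> h; rewrite normrM ger0_norm ?ind_ge0// mulrC.
by move: h; rewrite indE; case: ltP => _; rewrite ?mulr1 ?mulr0// => ->.
Qed.

Lemma measurable_bsum s f : measurable_fun setT f -> measurable_fun setT (bsum s f).
Proof.
move=> mf; apply: (measurable_Rintegral (h := fun p : V * V => ind s p.2 * f (p.1 - p.2))).
apply: measurable_funM.
  exact: (measurableT_comp (measurable_ind s) measurable_snd).
by apply: (measurableT_comp mf); exact: measurable_rVB.
Qed.

Lemma bsum_locb s f : locb f -> locb (bsum s f).
Proof.
move=> lf; have [mf fb] := lf; split; first exact: measurable_bsum.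
move=> r; have [M fM] := fb (r + s); exists (M * volume (eball s : set V)) => x xr.
apply: Rintegral_bcs_le; first exact: bsum_bcs_int.
move=> y; apply: ind_norm_mul => ys; apply: fM.
by rewrite (le_lt_trans (enormB _ _))// ltrD.
Qed.

Lemma bsumD s f g x : locb f -> locb g ->
  bsum s (fun y => f y + g y) x = bsum s f x + bsum s g x.
Proof.
move=> lf lg; rewrite /bsum -Rintegral_bcsD; [|exact: bsum_bcs_int..].
by apply: eq_Rintegral => y _; rewrite mulrDr.
Qed.

Lemma bsumZ s c f x : locb f -> bsum s (fun y => c * f y) x = c * bsum s f x.
Proof.
move=> lf; rewrite /bsum -Rintegral_bcsZ; last exact: bsum_bcs_int.
by apply: eq_Rintegral => y _; ring.
Qed.

Lemma bsumB s f g x : locb f -> locb g ->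
  bsum s (fun y => f y - g y) x = bsum s f x - bsum s g x.
Proof.
move=> lf lg; rewrite /bsum -Rintegral_bcsB; [|exact: bsum_bcs_int..].
by apply: eq_Rintegral => y _; rewrite mulrBr.
Qed.

Lemma eq_bsum s f g x : (forall y, enorm (x - y) < s -> f y = g y) ->
  bsum s f x = bsum s g x.
Proof.
move=> fg; apply: eq_Rintegral => y _; rewrite indE; case: ltP => ys; last by rewrite !mul0r.
by rewrite fg// subKr.
Qed.

Lemma bsum_ge0 s f x : (forall y, 0 <= f y) -> 0 <= bsum s f x.
Proof. by move=> f0; apply: Rintegral_ge0 => y _; rewrite mulr_ge0 ?ind_ge0. Qed.

Lemma bsumE s f x : measurable_fun setT f ->
  bsum s f x = \int[mu]_y (f y * ind s (x - y)).
Proof.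
move=> mf; have mi := @measurable_ind R d s.
rewrite -(Rintegral_subl x (f := fun y => f y * ind s (x - y))).
  by apply: eq_Rintegral => y _; rewrite subKr mulrC.
apply: measurable_funM => //; apply: (measurableT_comp mi); exact: measurable_rVB.
Qed.

Lemma bsum_bcs s phi : bcs phi -> bcs (bsum s phi).
Proof.
move=> bphi; have lphi := bcs_locb bphi.
have [mphi [M [r pM]]] := bphi; split; first exact: measurable_bsum.
have M0 : 0 <= `|M| by [].
exists (`|M| * volume (eball s : set V)), (r + s) => x.
rewrite (indE (r + s)); case: ltP => xr /=.
  rewrite mulr1; apply: Rintegral_bcs_le; first exact: bsum_bcs_int.
  move=> y; apply: ind_norm_mul => _; apply: (le_trans (pM _)).
  apply: (le_trans (ler_wpM2r (ind_ge0 _ _) (ler_norm M))).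
  by rewrite ler_piMr// ind_le1.
rewrite (_ : bsum s phi x = 0) ?normr0 ?mulr0//.
rewrite /bsum (_ : (fun y : V => _) = cst 0).
  by rewrite Rintegral_cst// mul0r.
apply/funext => y /=; rewrite indE; case: ltP => ys; last by rewrite mul0r.
have := pM (x - y); rewrite indE ltNge (_ : r <= _).
  by rewrite mulr0 mul1r normr_le0 => /eqP.
have -> : r = r + s - s by ring.
rewrite lerBlDr (le_trans xr)//.
by rewrite -{1}(subrK y x) (le_trans (enormD _ _))// lerD2l ltW.
Qed.

Lemma bsum_comp s t f x : locb f -> bsum s (bsum t f) x =
  \int[mu]_y \int[mu]_z (ind s y * (ind t z * f (x - y - z))).
Proof.
move=> lf; apply: eq_Rintegral => y _.
by rewrite -Rintegral_bcsZ//; exact: bsum_bcs_int.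
Qed.

Lemma bsumC s t f x : locb f -> bsum s (bsum t f) x = bsum t (bsum s f) x.
Proof.
move=> lf; rewrite (bsum_comp s t x lf) (bsum_comp t s x lf); have [mf fb] := lf.
have [M fM] := fb (enorm x + s + t).
rewrite (@fubini_bcs _ _ _ M s t).
- by apply: eq_Rintegral => y _; apply: eq_Rintegral => z _; rewrite addrAC; ring.
- apply: measurable_funM; first exact: (measurableT_comp (measurable_ind s) measurable_fst).
  apply: measurable_funM; first exact: (measurableT_comp (measurable_ind t) measurable_snd).
  by apply: (measurableT_comp mf); do 2 apply: measurable_rVB => //.
move=> y z; rewrite mulrA normrM ger0_norm ?mulr_ge0 ?ind_ge0//.
rewrite mulrC -mulrA !indE; case: ltP => ys; last by rewrite !mul0r !mulr0.
case: ltP => zt; last by rewrite !mulr0.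
rewrite !mulr1; apply: fM; rewrite (le_lt_trans (enormB _ _))// ltrD//.
by rewrite (le_lt_trans (enormB _ _))// ltrD2l.
Qed.

Lemma bsum_adjoint s f phi : locb f -> bcs phi ->
  \int[mu]_x (bsum s f x * phi x) = \int[mu]_x (f x * bsum s phi x).
Proof.
move=> lf bphi; have lphi := bcs_locb bphi; have [mf fb] := lf.
have [mphi [M [r pM]]] := bphi; have [K fK] := fb (r + s).
have mi := @measurable_ind R d s.
transitivity (\int[mu]_x \int[mu]_y (f y * ind s (x - y) * phi x)).
  apply: eq_Rintegral => x _; rewrite bsumE//.
  rewrite -RintegralZr//.
  apply: (bcs_integrable (f := fun y => f y * ind s (x - y))).
  apply: (bcs_mul lf); split.
    by apply: (measurableT_comp mi); exact: measurable_rVB.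
  exists 1, (enorm x + s) => y; rewrite mul1r ger0_norm ?ind_ge0// !indE ler_nat.
  case: ltP => // xys; rewrite (_ : enorm y < _)//.
  have -> : y = x - (x - y) by rewrite subKr.
  by rewrite (le_lt_trans (enormB _ _))// ltrD2l.
rewrite (@fubini_bcs _ _ _ (`|K| * `|M|) r (r + s)).
- apply: eq_Rintegral => y _; rewrite bsumE//.
  rewrite -Rintegral_bcsZ; last first.
    apply: bcs_eq (bcs_mul (f := fun x => ind s (y - x)) _ bphi) => [x|]; first exact: mulrC.
    by apply: (locb_shift (f := ind s)); exact/bcs_locb/bcs_ind.
  apply: eq_Rintegral => x _; rewrite -(indN s (y - x)) opprB; ring.
- apply: measurable_funM; last exact: (measurableT_comp mphi measurable_fst).
  apply: measurable_funM; first exact: (measurableT_comp mf measurable_snd).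
  by apply: (measurableT_comp mi); exact: measurable_rVB.
move=> x y; rewrite !normrM (ger0_norm (ind_ge0 _ _)).
have [xr|xr] := ltP (enorm x) r; last first.
  have := pM x; rewrite indE ltNge xr /= mulr0 normr_le0 => /eqP ->.
  by rewrite normr0 !mulr0 !mulr_ge0 ?ind_ge0.
have px : `|phi x| <= `|M|.
  by rewrite (le_trans (pM x))// indE xr mulr1 ler_norm.
rewrite (indE r) xr mulr1 mulrAC.
rewrite (indE s); case: ltP => xys; last by rewrite mulr0 !mulr_ge0 ?ind_ge0.
rewrite (indE (r + s)) (_ : enorm y < _) ?mulr1 ?ler_pM//.
  apply: le_trans (ler_norm _); apply: fK.
  have -> : y = x - (x - y) by rewrite subKr.
  by rewrite (le_lt_trans (enormB _ _))// ltrD.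
have -> : y = x - (x - y) by rewrite subKr.
by rewrite (le_lt_trans (enormB _ _))// ltrD.
Qed.

(** The balls of radius t around 0 and around w both contain the ball of radius t / 2 centred at w /
    2. *)
Lemma ball_overlap t w : enorm w < t ->
  volume (eball (t / 2) : set V) <= \int[mu]_y (ind t y * ind t (w - y)).
Proof.
move=> wt; have mi := @measurable_ind R d.
rewrite -Rintegral_ind -(Rintegral_translation (- (2^-1 *: w)) (mi _)).
have hw : enorm (2^-1 *: w) < t / 2.
  by rewrite enormZ ger0_norm// mulrC ltr_pM2r.
apply: le_Rintegral_bcs.
- split; first by apply: (measurableT_comp (mi _)); exact: measurable_rVD.
  exists 1, t => y; rewrite mul1r ger0_norm ?ind_ge0// !indE ler_nat; case: ltP => // yt.
  rewrite (_ : enorm y < t)//; have -> : y = (y - 2^-1 *: w) + 2^-1 *: w by rewrite subrK.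
  rewrite (le_lt_trans (enormD _ _))//; lra.
- by apply: bcs_locb_ind; apply: (locb_shift (f := ind t)); exact/bcs_locb/bcs_ind.
move=> y; rewrite !indE; case: ltP => yt; last by rewrite mulr_ge0.
have yt' : enorm y < t.
  rewrite -(subrK (2^-1 *: w) y) (le_lt_trans (enormD _ _))//.
  by apply: lt_le_trans (ltrD yt hw) _; rewrite -splitr.
have wyt : enorm (w - y) < t.
  have -> : w - y = 2^-1 *: w - (y - 2^-1 *: w).
    have {1}-> : w = 2^-1 *: w + 2^-1 *: w.
      by rewrite -scalerDl -[X in X + _]div1r -[X in _ + X]div1r -splitr scale1r.
    by rewrite opprB [in RHS]addrC [in RHS]addrAC addrC addrA.
  rewrite (le_lt_trans (enormB _ _))//.
  by apply: lt_le_trans (ltrD hw yt) _; rewrite -splitr.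
by rewrite yt' wyt mulr1.
Qed.

(** The kernel of [bsum t] applied twice is the overlap volume of two balls of radius t. On B(0, t),
    hence on B(0, s), it is at least the volume of a ball of radius t / 2. *)
Lemma bsum2_ge s t f x : s <= t -> locb f -> (forall y, 0 <= f y) ->
  volume (eball (t / 2) : set V) * bsum s f x <= bsum t (bsum t f) x.
Proof.
move=> st lf f0; have [mf fb] := lf; have [M fM] := fb (enorm x + (t + t)).
have mi := @measurable_ind R d.
have lind w : locb (fun y : V => ind t (w - y)).
  by apply: (locb_shift (f := ind t)); exact/bcs_locb/bcs_ind.
have -> : bsum t (bsum t f) x =
    \int[mu]_w ((\int[mu]_y (ind t y * ind t (w - y))) * f (x - w)).
  transitivity (\int[mu]_y \int[mu]_w (ind t y * ind t (w - y) * f (x - w))).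
    rewrite (bsum_comp t t x lf); apply: eq_Rintegral => y _.
    rewrite -(Rintegral_translation y (f := fun w => ind t y * ind t (w - y) * f (x - w))).
      by apply: eq_Rintegral => z _; rewrite addrK opprD addrA addrAC mulrA.
    apply: measurable_funM; last by apply: (measurableT_comp mf); exact: measurable_rVB.
    by apply: measurable_funM => //; apply: (measurableT_comp (mi t)); exact: measurable_rVB.
  rewrite (@fubini_bcs _ _ _ M t (t + t)).
  - apply: eq_Rintegral => w _; rewrite -RintegralZr//.
    apply: (bcs_integrable (f := fun y => ind t y * ind t (w - y))).
    by apply: bcs_locb_ind; exact: lind.
  - apply: measurable_funM; last first.
      by apply: (measurableT_comp mf); exact: measurable_rVB.
    apply: measurable_funM; first exact: (measurableT_comp (mi t) measurable_fst).
    by apply: (measurableT_comp (mi t)); exact: measurable_rVB.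
  move=> y w; rewrite normrM ger0_norm ?mulr_ge0 ?ind_ge0//.
  rewrite !indE; have [yt|yt] := ltP (enorm y) t; last by rewrite !mul0r !mulr0 mul0r.
  have [wyt|wyt] := ltP (enorm (w - y)) t; last first.
    rewrite mulr0 mul0r mulr1 mulr_ge0//.
    by apply: le_trans (fM 0 _); rewrite // enorm0; rewrite ltr_wpDl ?enorm_ge0// (le_lt_trans (enorm_ge0 y))// ltr_wpDr// (le_trans (enorm_ge0 y)) ?ltW.
  have wt : enorm w < t + t.
    have -> : w = (w - y) + y by rewrite subrK.
    by rewrite (le_lt_trans (enormD _ _))// ltrD.
  by rewrite wt !mulr1 mul1r; apply: fM; rewrite (le_lt_trans (enormB _ _))// ltrD2l.
rewrite /bsum -Rintegral_bcsZ; last exact: bsum_bcs_int.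
apply: le_Rintegral_bcs.
- by apply: bcsZ; exact: bsum_bcs_int.
- have bb : bcs (bsum t (ind t : V -> R)) by apply: bsum_bcs; exact: bcs_ind.
  apply: bcs_eq (bcs_mul (locb_shift x lf) bb) => w /=.
  by rewrite mulrC.
move=> w; rewrite mulrA ler_wpM2r//.
rewrite {1}indE; case: ltP => ws; last first.
  by rewrite mulr0 Rintegral_ge0// => y _; rewrite mulr_ge0 ?ind_ge0.
by rewrite mulr1; apply: ball_overlap; rewrite (lt_le_trans ws).
Qed.

End ball_sums.

(** * Positive eigenfunctions of ball averages *)

Section dominating_function.
Context {R : realType} {d : nat} (hd : (0 < d)%N) (a : R) (ha : 0 < a).
Local Notation V := 'rV[R]_d.
Local Notation mu := (lebesgue_rV d).
Implicit Types (f g : V -> R) (r s t : R) (x y z : V).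

Definition expdot (om x : V) : R := expR (a * dotp om x).

Lemma measurable_expdot d1 (T : measurableType d1) (f g : T -> V) :
  measurable_fun setT f -> measurable_fun setT g ->
  measurable_fun setT (fun w => expdot (f w) (g w)).
Proof.
move=> mf mg; apply: measurableT_comp; first exact: measurable_expR.
by apply: measurable_funM => //; exact: measurable_dotp.
Qed.

Lemma expdot_le om x : enorm om <= 1 -> expdot om x <= expR (a * enorm x).
Proof.
move=> om1; rewrite ler_expR ler_pM2l// (le_trans (dotp_le _ _))//.
by rewrite ler_piMl// enorm_ge0.
Qed.

Lemma expdotB om x y : expdot om (x - y) = expdot om x * expdot om (- y).
Proof. by rewrite /expdot -expRD dotpDr mulrDr. Qed.

Lemma locb_expdot om : enorm om <= 1 -> locb (expdot om).
Proof.
move=> om1; split; first by apply: (measurable_expdot (f := cst om)).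
move=> r; exists (expR (a * r)) => x xr; rewrite ger0_norm ?expR_ge0//.
by rewrite (le_trans (expdot_le _ om1))// ler_expR ler_pM2l// ltW.
Qed.

(** The eigenvalue of [bsum s] on every exp(a om.x) with |om| = 1. Divided by the volume of the ball
    it is psi_(ia)(s e_1). *)
Definition kappa s : R := bsum s (expdot (e1 d)) 0.

(* The ball is invariant under isometries, so [expdot om] is an eigenfunction
   with the same eigenvalue for every unit vector om. *)
Lemma bsum_expdot s om x : enorm om = 1 ->
  bsum s (expdot om) x = kappa s * expdot om x.
Proof.
move=> om1; have lom : locb (expdot om) by apply: locb_expdot; rewrite om1.
have le1 : locb (expdot (e1 d : V)) by apply: locb_expdot; rewrite (enorm_e1 hd).
have bom := bsum_bcs_int s 0 lom.
have -> : bsum s (expdot om) x = bsum s (expdot om) 0 * expdot om x.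
  rewrite mulrC -(Rintegral_bcsZ _ bom).
  by apply: eq_Rintegral => y _; rewrite expdotB sub0r; ring.
suff -> : bsum s (expdot om) 0 = kappa s by [].
rewrite {1}/bsum -(Rintegral_householder om (e1 d) bom.1).
apply: eq_Rintegral => y _; rewrite !indE enorm_householder; congr (_ * _).
rewrite /expdot !sub0r; congr (expR (_ * _)); rewrite !dotpNr; congr (- _).
have He : householder om (e1 d) (e1 d) = om.
  by rewrite -{2}(householder_swap om1 (enorm_e1 hd)) householderK.
by rewrite -{1}He dotp_householder.
Qed.

Lemma kappa_gt0 s : 0 < s -> 0 < kappa s.
Proof.
move=> s0; have le1 : locb (expdot (e1 d : V)) by apply: locb_expdot; rewrite (enorm_e1 hd).
apply: (@lt_le_trans _ _ (expR (- (a * s)) * volume (eball s : set V))).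
  by rewrite mulr_gt0 ?expR_gt0 ?volume_gt0.
rewrite -Rintegral_ind -Rintegral_bcsZ; last exact: bcs_ind.
apply: le_Rintegral_bcs.
- by apply: bcsZ; exact: bcs_ind.
- exact: bsum_bcs_int.
move=> y; rewrite mulrC indE; case: ltP => ys; last by rewrite !mul0r.
rewrite !mul1r ler_expR sub0r dotpNr mulrN lerN2 ler_pM2l//.
by rewrite (le_trans (dotp_le _ _))// (enorm_e1 hd) mul1r ltW.
Qed.

(** The value at 0 is a default that makes [dir z] a unit vector for every z. *)
Definition dir z : V := if enorm z == 0 then e1 d else (enorm z)^-1 *: z.

Lemma enorm_dir z : enorm (dir z) = 1.
Proof.
rewrite /dir; case: eqP => [_|/eqP z0]; first exact: enorm_e1.
by rewrite enormZ ger0_norm ?invr_ge0 ?enorm_ge0// mulVf.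
Qed.

Lemma measurable_dir : measurable_fun setT dir.
Proof.
have mn : measurable_fun setT (enorm : V -> R) by exact: measurable_enorm.
apply: measurable_fun_ifT => //; first exact: measurable_fun_eqr.
apply: measurable_rVZ => //.
rewrite (_ : (fun _ => _) = (@powR R ^~ (- 1)) \o enorm).
  by apply: measurableT_comp => //; exact: measurable_powR.
by apply/funext => z /=; rewrite powRN powRr1// enorm_ge0.
Qed.

(** The function F. Up to a constant it is the integral of exp(a om.x) over the unit sphere:
    integrating a function of the direction over the unit ball replaces surface measure. *)
Definition sphsum x : R := \int[mu]_z (ind 1 z * expdot (dir z) x).

Lemma sphsum_bcs x : bcs (fun z => ind 1 z * expdot (dir z) x).
Proof.
apply: bcs_locb_ind; split.
  by apply: measurable_expdot => //; exact: measurable_dir.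
move=> r; exists (expR (a * enorm x)) => z _; rewrite ger0_norm ?expR_ge0//.
by rewrite expdot_le// enorm_dir.
Qed.

Lemma sphsum_ge0 x : 0 <= sphsum x.
Proof. by apply: Rintegral_ge0 => z _; rewrite mulr_ge0 ?ind_ge0 ?expR_ge0. Qed.

Lemma sphsum_le x : sphsum x <= volume (eball 1 : set V) * expR (a * enorm x).
Proof.
apply: le_trans (ler_norm _) _; rewrite mulrC.
apply: Rintegral_bcs_le; first exact: sphsum_bcs.
move=> z; apply: ind_norm_mul => _; rewrite ger0_norm ?expR_ge0//.
by rewrite expdot_le// enorm_dir.
Qed.

Lemma locb_sphsum : locb sphsum.
Proof.
split.
  apply: (measurable_Rintegral (h := fun p : V * V => ind 1 p.2 * expdot (dir p.2) p.1)).
  apply: measurable_funM.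
    exact: (measurableT_comp (measurable_ind 1) measurable_snd).
  apply: measurable_expdot => //; exact: (measurableT_comp measurable_dir measurable_snd).
move=> r; exists (volume (eball 1 : set V) * expR (a * r)) => x xr.
rewrite ger0_norm ?sphsum_ge0// (le_trans (sphsum_le x))//.
by rewrite ler_pM2l ?volume_gt0// ler_expR ler_pM2l// ltW.
Qed.

Lemma bsum_sphsum s x : bsum s sphsum x = kappa s * sphsum x.
Proof.
rewrite /bsum.
transitivity (\int[mu]_y \int[mu]_z (ind s y * (ind 1 z * expdot (dir z) (x - y)))).
  apply: eq_Rintegral => y _; rewrite -Rintegral_bcsZ//; exact: sphsum_bcs.
rewrite (@fubini_bcs _ _ _ (expR (a * (enorm x + s))) s 1).
- rewrite /sphsum -Rintegral_bcsZ; last exact: sphsum_bcs.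
  apply: eq_Rintegral => z _.
  have lz : locb (expdot (dir z)) by apply: locb_expdot; rewrite enorm_dir.
  transitivity (ind 1 z * bsum s (expdot (dir z)) x).
    rewrite /bsum -Rintegral_bcsZ; last exact: bsum_bcs_int.
    by apply: eq_Rintegral => y _; ring.
  rewrite bsum_expdot ?enorm_dir//; ring.
- apply: measurable_funM; first exact: (measurableT_comp (measurable_ind s) measurable_fst).
  apply: measurable_funM; first exact: (measurableT_comp (measurable_ind 1) measurable_snd).
  apply: measurable_expdot; first exact: (measurableT_comp measurable_dir measurable_snd).
  by apply: measurable_rVB.
move=> y z; rewrite mulrA normrM ger0_norm ?mulr_ge0 ?ind_ge0//.
rewrite ger0_norm ?expR_ge0// mulrC -mulrA.
rewrite (indE s); case: ltP => ys; last by rewrite !mul0r !mulr0.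
rewrite !mul1r ler_wpM2r ?ind_ge0//.
rewrite (le_trans (expdot_le _ _)) ?enorm_dir// ler_expR ler_pM2l//.
by rewrite (le_trans (enormB _ _))// lerD2l ltW.
Qed.

(** Directions within a distance of order 1 / (1 + |x|) of x / |x| contribute at least exp(a (|x| -
    1)), and the points z with such directions fill a volume of order at least (1 + |x|)^(-d). *)
Lemma expR_le_sphsum : exists2 C : R, 0 < C &
  forall x, expR (a * enorm x) <= C * (1 + enorm x) ^+ d * sphsum x.
Proof.
have v0 := @volume_gt0 R d 1 ltr01.
exists (expR a * 4 ^+ d / volume (eball 1 : set V)).
  by rewrite divr_gt0 ?mulr_gt0 ?expR_gt0 ?exprn_gt0.
move=> x; have nx0 := enorm_ge0 x.
have x1 : 0 < 1 + enorm x by rewrite ltr_pwDl.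
(* The points z are taken in the ball of radius D around u / 2, with u the direction of x. It lies
   in the unit ball as D <= 1/4, and 4 D (1 + |x|) = 1 keeps the loss in the exponent at most a. *)
set D := (4 * (1 + enorm x))^-1.
have D0 : 0 < D by rewrite invr_gt0 mulr_gt0.
have D4 : D <= 4^-1 by rewrite lef_pV2 ?posrE ?mulr_gt0// ler_peMr// lerDl.
have Dx : 4 * D * (1 + enorm x) = 1.
  by rewrite /D; field; rewrite gt_eqF.
suff key : expR (a * (enorm x - 1)) * (D ^+ d * volume (eball 1 : set V)) <= sphsum x.
  have -> : expR a * 4 ^+ d / volume (eball 1 : set V) * (1 + enorm x) ^+ d * sphsum x =
     (expR a / (D ^+ d * volume (eball 1 : set V))) * sphsum x.
    rewrite /D exprVn exprMn; field.
    by rewrite !expf_neq0 ?gt_eqF//.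
  apply: le_trans (ler_wpM2l _ key); last first.
    by rewrite divr_ge0 ?expR_ge0// mulr_ge0 ?exprn_ge0 ?ltW.
  have W0 : D ^+ d * volume (eball 1 : set V) != 0 by rewrite mulf_neq0 ?expf_neq0 ?gt_eqF.
  move: W0; move: (D ^+ d * _) => W W0.
  have -> : expR a / W * (expR (a * (enorm x - 1)) * W) =
    expR a * expR (a * (enorm x - 1)) by field.
  by rewrite -expRD ler_expR; lra.
pose u : V := if enorm x == 0 then 0 else (enorm x)^-1 *: x.
have ux : dotp u x = enorm x.
  rewrite /u; case: eqP => [->|/eqP x0]; first by rewrite /dotp big1// => i _; rewrite mxE mul0r.
  by rewrite dotpZl -enorm_sqr expr2 mulrA mulVf// mul1r.
have u1 : enorm u <= 1.
  rewrite /u; case: eqP => [_|/eqP x0]; first by rewrite enorm0.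
  by rewrite enormZ ger0_norm ?invr_ge0// mulVf.
have mi := @measurable_ind R d.
rewrite -volume_eball// -Rintegral_ind -(Rintegral_translation (- (2^-1 *: u)) (mi _)).
have bi : bcs (fun z : V => ind D (z - 2^-1 *: u)).
  split; first by apply: (measurableT_comp (mi _)); exact: measurable_rVD.
  exists 1, 1 => z; rewrite mul1r ger0_norm ?ind_ge0// !indE ler_nat; case: ltP => // zD.
  rewrite (_ : enorm z < 1)// -(subrK (2^-1 *: u) z).
  rewrite (le_lt_trans (enormD _ _))// enormZ ger0_norm//; lra.
rewrite -Rintegral_bcsZ//; apply: le_Rintegral_bcs; [exact: bcsZ|exact: sphsum_bcs|].
move=> z; rewrite mulrC (indE D); case: ltP => zD; last first.
  by rewrite mul0r mulr_ge0 ?ind_ge0 ?expR_ge0.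
have zE : z = 2^-1 *: u + (z - 2^-1 *: u) by rewrite addrC subrK.
have nz : enorm z < 2^-1 + D.
  rewrite zE (le_lt_trans (enormD _ _))// enormZ ger0_norm//; lra.
rewrite indE (_ : enorm z < 1) ?mul1r; last by rewrite (lt_le_trans nz)//; lra.
rewrite ler_expR ler_pM2l//.
have zx : enorm x * (2^-1 - D) <= dotp z x.
  rewrite zE dotpDl dotpZl ux.
  have := norm_dotp_le (z - 2^-1 *: u) x; rewrite ler_norml => /andP[h _].
  have := ler_wpM2r nx0 (ltW zD); lra.
rewrite /dir; case: eqP => [z0|/eqP z0].
  have := zx; rewrite (enorm_eq0 z0) {1}/dotp big1 => [|i _]; last by rewrite mxE mul0r.
  move=> hx; have x0 : enorm x = 0 by apply/eqP; rewrite eq_le nx0 andbT; nra.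
  by rewrite (enorm_eq0 x0) enorm0 dotpC /dotp big1 ?sub0r ?lerN10// => i _; rewrite mxE mul0r.
have zp : 0 < enorm z by rewrite lt_def z0 enorm_ge0.
rewrite dotpZl mulrC ler_pdivlMr//.
apply: le_trans zx; have [xl|xg] := leP (enorm x) 1.
  rewrite (@le_trans _ _ 0)//; first by rewrite mulr_le0_ge0// ?subr_le0 ?enorm_ge0.
  by rewrite mulr_ge0//; lra.
(* With z.x >= |x| (1/2 - D) and |z| < 1/2 + D what remains is 2 D |x| <= 1/2 + D, which follows
   from 4 D (1 + |x|) = 1. *)
apply: (@le_trans _ _ ((enorm x - 1) * (2^-1 + D))).
  by rewrite ler_pM2l ?subr_gt0// ltW.
nra.
Qed.

End dominating_function.

(** * Decay of differences *)

Section binomial_weights.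
Context {R : realType}.
Variable (c : R).
Hypotheses (c0 : 0 < c) (c1 : c < 1).

Definition bw (n j : nat) : R := 'C(n, j)%:R * c ^+ j * (1 - c) ^+ (n - j).

Lemma bw_ge0 n j : 0 <= bw n j.
Proof. by rewrite !mulr_ge0// exprn_ge0 ?ltW// subr_gt0. Qed.

Lemma sum_bw n : \sum_(j < n.+1) bw n j = 1.
Proof.
rewrite -[RHS](expr1n _ n) -[X in X ^+ n](subrK c 1) exprDn.
by apply: eq_bigr => j _; rewrite /bw -mulr_natl; ring.
Qed.

Lemma bw_succl n j : (j <= n)%N ->
  bw n.+1 j.+1 * j.+1%:R / (n.+1%:R * c) = bw n j.
Proof.
move=> jn; have n0 : n.+1%:R != 0 :> R by rewrite pnatr_eq0.
have h : 'C(n.+1, j.+1)%:R * j.+1%:R = n.+1%:R * 'C(n, j)%:R :> R.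
  by rewrite -!natrM; congr _%:R; rewrite mulnC -mul_bin_diag.
have c' : c != 0 by rewrite gt_eqF.
rewrite /bw subSS exprS; move: (n.+1%:R : R) n0 h => N n0 h.
have -> : 'C(n.+1, j.+1)%:R * (c * c ^+ j) * (1 - c) ^+ (n - j) * j.+1%:R / (N * c) =
   ('C(n.+1, j.+1)%:R * j.+1%:R) * c ^+ j * (1 - c) ^+ (n - j) / N by field; rewrite c' n0.
by rewrite h; field.
Qed.

Lemma bw_succr n j : (j <= n)%N ->
  bw n.+1 j * (n.+1 - j)%:R / (n.+1%:R * (1 - c)) = bw n j.
Proof.
move=> jn; have n0 : n.+1%:R != 0 :> R by rewrite pnatr_eq0.
have h : 'C(n.+1, j)%:R * (n.+1 - j)%:R = n.+1%:R * 'C(n, j)%:R :> R.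
  by rewrite -!natrM; congr _%:R; rewrite mulnC -mul_bin_down.
have c' : 1 - c != 0 by rewrite subr_eq0 gt_eqF.
rewrite /bw (subSn jn) exprS -(subSn jn); move: (n.+1%:R : R) n0 h => N n0 h.
have -> : 'C(n.+1, j)%:R * c ^+ j * ((1 - c) * (1 - c) ^+ (n - j)) * (n.+1 - j)%:R / (N * (1 - c)) =
   ('C(n.+1, j)%:R * (n.+1 - j)%:R) * c ^+ j * (1 - c) ^+ (n - j) / N by field; rewrite c' n0.
by rewrite h; field.
Qed.

(* Summation by parts for the binomial law. *)
Lemma bw_parts n (A : nat -> R) :
  \sum_(j < n.+1) bw n j * (A j.+1 - A j) =
  (\sum_(j < n.+2) bw n.+1 j * (j%:R - n.+1%:R * c) * A j) / (n.+1%:R * c * (1 - c)).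
Proof.
have n0 : n.+1%:R != 0 :> R by rewrite pnatr_eq0.
have c' : c != 0 by rewrite gt_eqF.
have c'' : 1 - c != 0 by rewrite subr_eq0 gt_eqF.
have -> : (\sum_(j < n.+2) bw n.+1 j * (j%:R - n.+1%:R * c) * A j) / (n.+1%:R * c * (1 - c)) =
  \sum_(j < n.+2) bw n.+1 j * j%:R / (n.+1%:R * c) * A j -
  \sum_(j < n.+2) bw n.+1 j * (n.+1 - j)%:R / (n.+1%:R * (1 - c)) * A j.
  rewrite mulr_suml -sumrB; apply: eq_bigr => j _.
  rewrite natrB; last by rewrite -ltnS.
  by move: (n.+1%:R : R) n0 => N n0; field; rewrite c' c'' n0.
rewrite [X in _ = X - _]big_ord_recl/= mulr0 !mul0r add0r.
rewrite [X in _ = _ - X]big_ord_recr/= subnn mulr0 !mul0r addr0.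
rewrite -sumrB; apply: eq_bigr => j _.
have jn : (j <= n)%N by rewrite -ltnS.
by rewrite (bw_succl jn) (bw_succr jn) mulrBr.
Qed.

Lemma bw_variance n :
  \sum_(j < n.+2) bw n.+1 j * (j%:R - n.+1%:R * c) ^+ 2 = n.+1%:R * c * (1 - c).
Proof.
have := bw_parts n (fun j => j%:R - n.+1%:R * c).
under eq_bigr => j _.
  rewrite (_ : _ - _ = 1) ?mulr1; last by rewrite -natr1; ring.
  over.
rewrite sum_bw => /(congr1 (fun z => z * (n.+1%:R * c * (1 - c)))).
rewrite mul1r divfK; last first.
  by rewrite !mulf_neq0 ?pnatr_eq0 ?subr_eq0 ?gt_eqF.
by move=> ->; apply: eq_bigr => j _; rewrite -mulrA expr2.
Qed.

(** Cauchy-Schwarz in the form |u| <= u^2 / (2 s) + s / 2, with s the standard deviation. *)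
Lemma bw_deviation n :
  \sum_(j < n.+2) bw n.+1 j * `|j%:R - n.+1%:R * c| <= Num.sqrt (n.+1%:R * c * (1 - c)).
Proof.
have v0 : 0 < n.+1%:R * c * (1 - c) by rewrite !mulr_gt0// subr_gt0.
set s := Num.sqrt _; have s0 : 0 < s by rewrite sqrtr_gt0.
have ss : s * s = n.+1%:R * c * (1 - c) by rewrite -expr2 sqr_sqrtr// ltW.
apply: (@le_trans _ _ (\sum_(j < n.+2) (bw n.+1 j * (j%:R - n.+1%:R * c) ^+ 2 / (2 * s) + bw n.+1 j * (s / 2)))).
  apply: ler_sum => j _; rewrite -mulrA -mulrDr ler_wpM2l ?bw_ge0//.
  rewrite -[X in X / _]real_normK ?num_real//; move: (`|_|) => u.
  rewrite -subr_ge0 (_ : _ - u = (u - s) ^+ 2 / (2 * s)); last by field; rewrite gt_eqF.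
  by rewrite divr_ge0 ?sqr_ge0// mulr_ge0// ltW.
rewrite big_split/= -mulr_suml bw_variance -mulr_suml sum_bw mul1r -ss.
by rewrite le_eqVlt; apply/orP; left; apply/eqP; field; rewrite gt_eqF.
Qed.

(** [q k i l] stands for the value of S_s^i Q^l r_k at a point, and the hypothesis for r_(k+2) = c
    S_s r_k + (1 - c) Q r_k. *)
Variable q : int -> nat -> nat -> R.
Hypothesis qE : forall k i l, q (k + 2) i l = c * q k i.+1 l + (1 - c) * q k i l.+1.

(** The binomial theorem for two commuting operators; commutation is built into the double index. *)
Lemma array_expand n k i l :
  q (k + 2 * n%:Z) i l = \sum_(j < n.+1) bw n j * q k (i + j)%N (l + (n - j))%N.
Proof.
elim: n i l => [|n IH] i l.
  by rewrite mulr0 addr0 big_ord1 /bw bin0 !expr0 !mul1r !addn0.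
have -> : k + 2 * n.+1%:Z = (k + 2 * n%:Z) + 2 by rewrite -natr1; ring.
rewrite qE !IH !mulr_sumr.
have n0 : n.+1%:R != 0 :> R by rewrite pnatr_eq0.
have c' : c != 0 by rewrite gt_eqF.
have c'' : 1 - c != 0 by rewrite subr_eq0 gt_eqF.
transitivity (\sum_(j < n.+2) bw n.+1 j * j%:R / n.+1%:R * q k (i + j)%N (l + (n.+1 - j))%N +
  \sum_(j < n.+2) bw n.+1 j * (n.+1 - j)%:R / n.+1%:R * q k (i + j)%N (l + (n.+1 - j))%N).
  rewrite [X in _ = X + _]big_ord_recl/= mulr0 !mul0r add0r; congr (_ + _).
    apply: eq_bigr => j _; have jn : (j <= n)%N by rewrite -ltnS.
    rewrite /bump add1n.
    rewrite -(bw_succl jn) addSnnS subSS.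
    by move: (n.+1%:R : R) n0 => N n0; field; rewrite c' n0.
  rewrite [RHS]big_ord_recr/= subnn mulr0 !mul0r addr0.
  apply: eq_bigr => j _; have jn : (j <= n)%N by rewrite -ltnS.
  rewrite -(bw_succr jn) addSnnS -(subSn jn).
  by move: (n.+1%:R : R) n0 => N n0; field; rewrite c'' n0.
rewrite -big_split/=; apply: eq_bigr => j _.
rewrite natrB; last by rewrite -ltnS.
by move: (n.+1%:R : R) n0 => N n0; field.
Qed.

(** Both terms expand along the antidiagonal i + l = n + 1 of [q k], and their difference is a
    binomial mean of consecutive differences on it. By [bw_parts] it becomes a mean against the
    deviation, of order sqrt(n), divided by the variance, of order n. *)
Lemma array_decay n k (M : R) :
  (forall j, (j <= n.+1)%N -> `|q k j (n.+1 - j)| <= M) ->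
  `|q (k + 2 * n%:Z) 1 0 - q (k + 2 * n%:Z) 0 1| <= M / Num.sqrt (n.+1%:R * c * (1 - c)).
Proof.
move=> qM; have v0 : 0 < n.+1%:R * c * (1 - c) by rewrite !mulr_gt0// subr_gt0.
rewrite !array_expand -sumrB.
under eq_bigr => j _.
  rewrite add1n !add0n add1n -mulrBr.
  over.
rewrite (_ : \sum_(_ < _) _ = \sum_(j < n.+1) bw n j * (q k j.+1 (n.+1 - j.+1)%N - q k j (n.+1 - j)%N)); last first.
  by apply: eq_bigr => j _; rewrite subSS subSn// -ltnS.
rewrite (bw_parts n (fun j => q k j (n.+1 - j)%N)).
set s := Num.sqrt _; have s0 : 0 < s by rewrite sqrtr_gt0.
have -> : n.+1%:R * c * (1 - c) = s * s by rewrite -expr2 sqr_sqrtr// ltW.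
rewrite normrM normfV (ger0_norm (ltW (mulr_gt0 s0 s0))).
rewrite ler_pdivrMr ?mulr_gt0// mulrA divfK ?gt_eqF//.
apply: (@le_trans _ _ (\sum_(j < n.+2) bw n.+1 j * `|j%:R - n.+1%:R * c| * M)).
  apply: (le_trans (ler_norm_sum _ _ _)); apply: ler_sum => j _.
  rewrite normrM [X in X * _]normrM (ger0_norm (bw_ge0 _ _)).
  apply: ler_wpM2l; first exact: mulr_ge0 (bw_ge0 _ _) (normr_ge0 _).
  by apply: qM; rewrite -ltnS.
have M0 : 0 <= M by apply: le_trans (qM 0%N _).
by rewrite -mulr_suml mulrC ler_wpM2l// bw_deviation.
Qed.

End binomial_weights.

(** * Positive local operators that fix F *)

Section positive_operators.
Context {R : realType} {d : nat} (hd : (0 < d)%N) (a : R) (ha : 0 < a).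
Local Notation V := 'rV[R]_d.
Local Notation F := (@sphsum R d a).
Local Notation kap := (@kappa R d a).
Implicit Types (f g : V -> R) (P Q : (V -> R) -> V -> R) (w : R -> R).

(** Positivity and the fixed point F preserve bounds by multiples of F; the range rho limits how far
    the argument of a growing weight can move. *)
Record good_op (rho : R) P : Prop := GoodOp {
  good_locb : forall f, locb f -> locb (P f) ;
  good_lin : forall c f g x, locb f -> locb g ->
    P (fun y => f y + c * g y) x = P f x + c * P g x ;
  good_local : forall f g x, (forall y, enorm (x - y) < rho -> f y = g y) -> P f x = P g x ;
  good_ge0 : forall f x, locb f -> (forall y, 0 <= f y) -> 0 <= P f x ;
  good_fix : forall x, P F x = F x }.

Definition dominated w f := forall x, `|f x| <= w (enorm x) * F x.

Lemma good_opZ rho P c f x : good_op rho P -> locb f ->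
  P (fun y => c * f y) x = c * P f x.
Proof.
move=> gP lf; have l0 := @locb_cst R d 0.
have P0 : P (fun=> 0) x = 0.
  have := good_lin gP 1 x l0 l0; rewrite (_ : (fun y : V => _) = (fun=> 0)).
    by rewrite mul1r => h; lra.
  by apply/funext => y; rewrite mulr0 addr0.
have := good_lin gP c x l0 lf; rewrite P0 add0r => <-.
by congr (P _ x); apply/funext => y; rewrite add0r.
Qed.

(** Positivity is applied to K F + f and K F - f, where K is the weight at |x| + rho. Only the
    points within rho of x matter, and there the monotone weight is at most K. *)
Lemma good_dominated rho P w f : 0 <= rho -> good_op rho P ->
  {homo w : x y / x <= y} -> locb f -> dominated w f -> dominated (fun r => w (r + rho)) (P f).
Proof.
move=> rho0 gP wm lf fw x; set K := w _; have lF := locb_sphsum hd ha.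
have pos (e : R) : `|e| = 1 -> 0 <= K * F x + e * P f x.
  move=> e1.
  have {1}<- : P F x = F x by exact: good_fix gP _.
  rewrite -(good_opZ _ _ gP)// -(good_lin gP)//; last exact: locbZ.
  (* The cut-off makes the function nonnegative everywhere, as [good_ge0] demands, and locality
     hides it from the value at x. *)
  pose h y := ind rho (x - y) * (K * F y + e * f y).
  have li : locb (fun y : V => ind rho (x - y)).
    by apply: (locb_shift (f := ind rho)); exact/bcs_locb/bcs_ind.
  have <- : P h x = P (fun y => K * F y + e * f y) x.
    by apply: (good_local gP) => y yr; rewrite /h indE yr mul1r.
  apply: (good_ge0 gP).
    by apply: locbM => //; apply: locbD; exact: locbZ.
  move=> y; rewrite /h indE; case: ltP => yr; last by rewrite mul0r.
  rewrite mul1r; have h1 : `|e * f y| <= K * F y.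
    rewrite normrM e1 mul1r; apply: (le_trans (fw y)).
    rewrite ler_wpM2r ?sphsum_ge0//; apply: wm.
    have -> : y = x - (x - y) by rewrite subKr.
    by rewrite (le_trans (enormB _ _))// lerD2l ltW.
  by move: h1; rewrite ler_norml => /andP[h1 _]; lra.
have := pos 1 (normr1 _); have := pos (-1) (normrN1 _).
rewrite mul1r mulN1r ler_norml => h1 h2; apply/andP; split; lra.
Qed.

Lemma good_opS rho rho' P : rho <= rho' -> good_op rho P -> good_op rho' P.
Proof.
move=> rr [h1 h2 h3 h4 h5]; split => // f g x fg; apply: h3 => y yr; apply: fg.
exact: lt_le_trans yr rr.
Qed.

Definition nbsum s f x : R := (kap s)^-1 * bsum s f x.

Lemma nbsum_good s : 0 < s -> good_op s (nbsum s).
Proof.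
move=> s0; have k0 := kappa_gt0 hd ha s0; split.
- by move=> f lf; apply: locbZ; exact: bsum_locb.
- move=> c f g x lf lg; rewrite /nbsum bsumD//; last exact: locbZ.
  by rewrite bsumZ// mulrDr mulrCA.
- by move=> f g x fg; congr (_ * _); exact: eq_bsum.
- by move=> f x lf f0; rewrite mulr_ge0 ?bsum_ge0// invr_ge0 ltW.
- by move=> x; rewrite /nbsum bsum_sphsum// mulrA mulVf ?mul1r// gt_eqF.
Qed.

Lemma nbsumC s s' f x : 0 < s -> 0 < s' -> locb f ->
  nbsum s (nbsum s' f) x = nbsum s' (nbsum s f) x.
Proof.
move=> s0 s0' lf; have l1 := bsum_locb s lf; have l2 := bsum_locb s' lf.
rewrite /nbsum (bsumZ s _ x l2) (bsumZ s' _ x l1) (bsumC s s' x lf).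
exact: mulrCA.
Qed.

Variable t : R.
Hypothesis t0 : 0 < t.

Lemma nbsum2_ge s : 0 < s <= t -> exists2 c : R, 0 < c < 1 &
  forall f x, locb f -> (forall y, 0 <= f y) -> c * nbsum s f x <= nbsum t (nbsum t f) x.
Proof.
move=> /andP[s0 st]; have ks := kappa_gt0 hd ha s0; have kt := kappa_gt0 hd ha t0.
have v0 : 0 < volume (eball (t / 2) : set V) by rewrite volume_gt0// divr_gt0.
pose c0 := kap s / kap t / kap t * volume (eball (t / 2) : set V).
have c00 : 0 < c0 by rewrite mulr_gt0// !divr_gt0.
(* c0 is the constant of [bsum2_ge] after normalisation; the minimum with 1/2 leaves the
   complementary operator a weight 1 - c > 0. *)
exists (Num.min c0 2^-1).
  by rewrite lt_min c00 invr_gt0 ltr0n/= gt_min invf_lt1// ltr1n orbT.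
move=> f x lf f0.
apply: (@le_trans _ _ (c0 * nbsum s f x)).
  rewrite ler_wpM2r ?ge_min ?lexx//.
  by apply: (good_ge0 (nbsum_good s0)).
rewrite /nbsum bsumZ; last exact: bsum_locb.
have := bsum2_ge x st lf f0.
rewrite -(@ler_pM2l _ ((kap t)^-1 * (kap t)^-1)) ?mulr_gt0 ?invr_gt0//.
rewrite [X in _ -> _ <= X]mulrA; apply: le_trans.
rewrite le_eqVlt; apply/orP; left; apply/eqP; rewrite /c0; field.
by rewrite !gt_eqF.
Qed.

(** The operator Q, obtained by solving T^2 = c S_s + (1 - c) Q; its positivity is the inequality
    that determines c. *)
Definition compl_op c s f x : R := (nbsum t (nbsum t f) x - c * nbsum s f x) / (1 - c).

Lemma compl_op_good s c : 0 < s <= t -> 0 < c < 1 ->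
  (forall f x, locb f -> (forall y, 0 <= f y) -> c * nbsum s f x <= nbsum t (nbsum t f) x) ->
  good_op (t + t) (compl_op c s).
Proof.
move=> /andP[s0 st] /andP[c0 c1] h.
have gs := nbsum_good s0; have gt := nbsum_good t0.
have c1' : 0 < 1 - c by rewrite subr_gt0.
have gl f : locb f -> locb (nbsum t f) by apply: good_locb gt _.
split.
- move=> f lf; rewrite /compl_op; under eq_fun do rewrite mulrC; apply: locbZ; apply: locbB.
    by do 2 apply: (good_locb gt).
  by apply: locbZ; apply: (good_locb gs).
- move=> e f g x lf lg; rewrite /compl_op (good_lin gs)//.
  have -> : nbsum t (nbsum t (fun y => f y + e * g y)) x =
    nbsum t (nbsum t f) x + e * nbsum t (nbsum t g) x.
    rewrite -(good_lin gt)//; try exact: gl.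
    by congr (nbsum t _ x); apply/funext => y; rewrite (good_lin gt).
  move: (nbsum t (nbsum t f) x) (nbsum t (nbsum t g) x) (nbsum s f x) (nbsum s g x).
  by move=> u1 u2 u3 u4; ring.
- move=> f g x fg; rewrite /compl_op.
  have -> : nbsum t (nbsum t f) x = nbsum t (nbsum t g) x.
    apply: (good_local gt) => y yx; apply: (good_local gt) => z zy; apply: fg.
    by rewrite -(subrK y x) -addrA (le_lt_trans (enormD _ _))// ltrD.
  have -> // : nbsum s f x = nbsum s g x.
  apply: (good_local gs) => y ys; apply: fg; rewrite (lt_le_trans ys)//.
  by rewrite (le_trans st)// lerDl ltW.
- move=> f x lf f0; rewrite divr_ge0// ?(ltW c1')// subr_ge0; exact: h.
- move=> x; rewrite /compl_op (good_fix gs).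
  have -> : nbsum t F = F by apply/funext => y; exact: (good_fix gt).
  rewrite (good_fix gt); move: (F x) => u; field.
  by rewrite gt_eqF.
Qed.

Lemma nbsum_compl s c f x : 0 < s -> locb f ->
  nbsum s (compl_op c s f) x = compl_op c s (nbsum s f) x.
Proof.
move=> s0 lf; have gs := nbsum_good s0; have gt := nbsum_good t0.
have l1 : locb (nbsum t (nbsum t f)) by do 2 apply: (good_locb gt).
have l2 : locb (nbsum s f) by apply: (good_locb gs).
transitivity (nbsum s (fun y => (1 - c)^-1 * (nbsum t (nbsum t f) y + (- c) * nbsum s f y)) x).
  congr (nbsum s _ x); apply/funext => y; rewrite /compl_op.
  by rewrite mulrC mulNr.
rewrite (good_opZ _ _ gs); last by apply: locbD => //; exact: locbZ.
rewrite (good_lin gs)// /compl_op nbsumC//; last exact: (good_locb gt).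
have -> : nbsum s (nbsum t f) = nbsum t (nbsum s f) by apply/funext => y; rewrite nbsumC.
by rewrite mulrC mulNr.
Qed.

Lemma iter_commute P Q f n : (forall g, locb g -> locb (Q g)) -> locb f ->
  (forall g x, locb g -> P (Q g) x = Q (P g) x) ->
  iter n Q (P f) = P (iter n Q f) /\ locb (iter n Q f).
Proof.
move=> lQ lf PQ; elim: n => //= n [IH l]; split; last exact: lQ.
by rewrite IH; apply/funext => x; rewrite PQ.
Qed.

Definition orbit_seq (r : int -> V -> R) := (forall k, locb (r k)) /\
  forall k x, nbsum t (r k) x = r (k + 1) x.

Lemma orbit_decay (r : int -> V -> R) s w : 0 < s <= t -> {homo w : x y / x <= y} ->
  orbit_seq r -> (forall k, dominated w (r k)) ->
  exists2 c : R, 0 < c <= 1 & forall k x n,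
  `|nbsum s (r k) x - r (k + 2) x| <= w (enorm x + n.+1%:R * (t + t)) * F x / Num.sqrt (n.+1%:R * c).
Proof.
move=> st wm [lr rT] rw; have /andP[s0 st'] := st.
have [c c01 cP] := nbsum2_ge st; have /andP[c0 c1] := c01.
have gs := nbsum_good s0; have gQ := compl_op_good st c01 cP.
set Q := compl_op c s in gQ *; set P := nbsum s in gs *.
have c1' : 0 < 1 - c by rewrite subr_gt0.
have r2 k x : r (k + 2) x = c * P (r k) x + (1 - c) * Q (r k) x.
  have e (u v : R) : u = c * v + (1 - c) * ((u - c * v) / (1 - c)).
    by field; rewrite gt_eqF.
  have -> : Q (r k) x = (r (k + 2) x - c * P (r k) x) / (1 - c).
    rewrite /Q /compl_op -/P; congr ((_ - _) / _).
    have -> : nbsum t (r k) = r (k + 1) by apply/funext => y; exact: rT.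
    by rewrite rT -addrA.
  exact: e.
have lit i l f : locb f -> locb (iter i P (iter l Q f)).
  move=> lf; have lQ : locb (iter l Q f).
    by elim: l => //= l IH; exact: (good_locb gQ).
  by elim: i => //= i IH; exact: (good_locb gs).
have ilin i l f g e e' : locb f -> locb g ->
    iter i P (iter l Q (fun y => e * f y + e' * g y)) =
    (fun x => e * iter i P (iter l Q f) x + e' * iter i P (iter l Q g) x).
  move=> lf lg.
  have iQ : iter l Q (fun y => e * f y + e' * g y) = (fun x => e * iter l Q f x + e' * iter l Q g x).
    elim: l => //= l ->; apply/funext => x.
    have l1 := lit 0 l _ lf; have l2 := lit 0 l _ lg.
    by rewrite (good_lin gQ)// ?(good_opZ _ _ gQ)//; exact: locbZ.
  rewrite iQ; elim: i => //= i ->; apply/funext => x.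
  have l1 := lit i l _ lf; have l2 := lit i l _ lg.
  by rewrite (good_lin gs)// ?(good_opZ _ _ gs)//; exact: locbZ.
have QC f : locb f -> forall l, iter l Q (P f) = P (iter l Q f).
  move=> lf l; apply: (iter_commute (P := P) (Q := Q) _ _ lf _).1 => [g|g y] lg.
    exact: (good_locb gQ).
  by rewrite /P /Q nbsum_compl.
have bnd k x i l : `|iter i P (iter l Q (r k)) x| <= w (enorm x + (i + l)%:R * (t + t)) * F x.
  have bQ : dominated (fun z => w (z + l%:R * (t + t))) (iter l Q (r k)).
    elim: l => [|l IH]; first by move=> y; rewrite mul0r addr0; exact: rw.
    have := good_dominated (rho := t + t) _ gQ _ (lit 0%N l _ (lr k)) IH.
    move=> /(_ _ _) h y; rewrite (le_trans (h _ _ y))//.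
    - by rewrite addr_ge0 ?ltW.
    - by move=> u v uv; apply: wm; rewrite lerD2r.
    by rewrite -natr1 (_ : _ + _ + _ = enorm y + (l%:R + 1) * (t + t))//; ring.
  elim: i x => [|i IH] x; first by rewrite add0n; exact: bQ.
  (* S_s has range s <= 2 t, so it may be given the range 2 t of Q; then i + l applications move the
     argument of the weight by (i + l) 2 t. *)
  have gs' : good_op (t + t) P.
    by apply: good_opS gs; rewrite (le_trans st')// lerDl ltW.
  have := good_dominated (rho := t + t) (w := fun z => w (z + (i + l)%:R * (t + t))) _ gs' _ (lit i l _ (lr k)) IH.
  move=> /(_ _ _) h; rewrite (le_trans (h _ _ x))//.
  - by rewrite addr_ge0 ?ltW.
  - by move=> u v uv; apply: wm; rewrite lerD2r.
  by rewrite addSn -natr1 (_ : _ + _ + _ = enorm x + ((i + l)%:R + 1) * (t + t))//; ring.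
(* The variance of the binomial law per trial. *)
exists (c * (1 - c)).
  by rewrite mulr_gt0//=; nra.
move=> k x n.
pose q (k : int) i l := iter i P (iter l Q (r k)) x.
have qE k' i l : q (k' + 2) i l = c * q k' i.+1 l + (1 - c) * q k' i l.+1.
  rewrite /q; have -> : r (k' + 2) = (fun y => c * P (r k') y + (1 - c) * Q (r k') y).
    by apply/funext => y; exact: r2.
  rewrite ilin; [|exact: (good_locb gs)|exact: (good_locb gQ)].
  by rewrite QC// -iterSr -[in X in _ + X]iterSr.
(* The expansion starts n double steps earlier, at r_(k-2n), which obeys the same bound as r_k. *)
have := @array_decay _ _ c0 c1 _ qE n (k - 2 * n%:Z) (w (enorm x + n.+1%:R * (t + t)) * F x).
rewrite subrK -(mulrA n.+1%:R c) => h.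
have -> : P (r k) x - r (k + 2) x = (1 - c) * (q k 1%N 0%N - q k 0%N 1%N).
  by rewrite r2 /q /=; move: (P (r k) x) (Q (r k) x) => u v; ring.
rewrite normrM (ger0_norm (ltW c1')).
apply: (@le_trans _ _ (1 * `|q k 1%N 0%N - q k 0%N 1%N|)).
  by rewrite ler_wpM2r// gerBl ltW.
rewrite mul1r; apply: h => j jn; have := bnd (k - 2 * n%:Z) x j (n.+1 - j)%N.
by rewrite subnKC.
Qed.

End positive_operators.

Section archimedean_bounds.
Context {R : realType}.

Lemma archi_le0 (u K : R) : (forall n : nat, u * n%:R <= K) -> u <= 0.
Proof.
move=> h; rewrite leNgt; apply/negP => u0.
have K0 : 0 <= K by apply: le_trans (h 0%N); rewrite mulr0.
have := h (Num.truncn (K / u)).+1; rewrite leNgt => /negP; apply.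
by rewrite mulrC -ltr_pdivrMr// truncnS_gt.
Qed.

(** u k - u (k + n) is n times the common difference, and a bound independent of n forces this
    difference to be 0. *)
Lemma bounded_arith (u : int -> R) M : (forall k, `|u k| <= M) ->
  (forall k, u (k + 1) - u (k + 2) = u k - u (k + 1)) ->
  forall k, u (k + 1) = u k.
Proof.
move=> uM uE k.
have S (n : nat) : k + n.+1%:Z = k + n%:Z + 1 by rewrite -addn1 PoszD addrA.
have c (n : nat) : u (k + n%:Z) - u (k + n%:Z + 1) = u k - u (k + 1).
  elim: n => [|n IH]; first by rewrite addr0.
  rewrite -IH S -[RHS]uE; congr (_ - u _); exact: esym (addrA _ 1 1).
have s (n : nat) : u k - u (k + n%:Z) = n%:R * (u k - u (k + 1)).
  elim: n => [|n IH]; first by rewrite addr0 subrr mul0r.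
  rewrite -natr1 mulrDl mul1r -IH -(c n) S.
  by move: (u _) (u _) (u _) => p q r; ring.
have h (e : R) : `|e| = 1 -> e * (u k - u (k + 1)) <= 0.
  move=> e1; apply: (@archi_le0 _ (2 * M)) => n.
  rewrite -mulrA (mulrC _ n%:R) -s; apply: (le_trans (ler_norm _)).
  rewrite normrM e1 mul1r (le_trans (ler_normB _ _))//.
  by have := uM k; have := uM (k + n%:Z); lra.
have := h 1 (normr1 _); have := h (-1) (normrN1 _); lra.
Qed.

End archimedean_bounds.

(** * Reduction of growth along orbits *)

Section orbits.
Context {R : realType} {d : nat} (hd : (0 < d)%N) (a : R) (ha : 0 < a).
Context (t : R) (t0 : 0 < t).
Local Notation V := 'rV[R]_d.
Local Notation F := (@sphsum R d a).
Local Notation T := (nbsum a t : (V -> R) -> V -> R).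
Implicit Types (r : int -> V -> R).

(** [m] counts half powers of 1 + rho, the gain of one reduction step, so the growth can carry an
    induction on natural numbers. *)
Definition tempered_by (C : R) m := fun rho : R => C * Num.sqrt (1 + rho) ^+ m.

Lemma tempered_by_homo C m : 0 <= C -> {homo tempered_by C m : x y / x <= y}.
Proof.
move=> C0 x y xy; rewrite /tempered_by ler_wpM2l//.
by rewrite lerXn2r ?nnegrE ?sqrtr_ge0// ler_wsqrtr// lerD2l.
Qed.

Definition tempered m r :=
  exists2 C : R, 0 <= C & forall k, dominated a (tempered_by C m) (r k).

Lemma tempered_step s r m : 0 < s <= t -> orbit_seq a t r -> tempered m.+1 r ->
  tempered m (fun k x => nbsum a s (r k) x - r (k + 2) x).
Proof.
move=> st orb [C C0 rC].
have [c /andP[c0 c1] h] := orbit_decay hd ha t0 st (tempered_by_homo m.+1 C0) orb rC.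
have D0 : 0 < Num.sqrt (c / 2) by rewrite sqrtr_gt0 divr_gt0.
have rho0 : 0 < 1 + (t + t) by rewrite !addr_gt0.
exists (C * Num.sqrt (1 + (t + t)) ^+ m.+1 / Num.sqrt (c / 2)).
  by rewrite divr_ge0 ?mulr_ge0 ?exprn_ge0 ?sqrtr_ge0.
move=> k x; have x0 := enorm_ge0 x; have x1 : 0 < 1 + enorm x by rewrite ltr_pwDl.
(* With n of the size of |x| the shift by (n + 1) 2 t costs only a constant factor in the weight,
   while sqrt(n + 1) in the denominator is comparable to sqrt(1 + |x|). *)
set n := Num.truncn (enorm x).
have nx : n%:R <= enorm x by rewrite truncn_le.
have xn : enorm x < n.+1%:R by exact: truncnS_gt.
have n1 : 1 <= n.+1%:R :> R by rewrite ler1n.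
have n1' : n.+1%:R <= enorm x + 1 by rewrite -natr1 lerD2r.
apply: (le_trans (h k x n)).
have F0 := sphsum_ge0 a x.
rewrite mulrAC ler_wpM2r// /tempered_by.
set S := Num.sqrt (1 + enorm x); have S0 : 0 < S by rewrite sqrtr_gt0.
have e1 : Num.sqrt (1 + (enorm x + n.+1%:R * (t + t))) <= S * Num.sqrt (1 + (t + t)).
  rewrite -sqrtrM ?(ltW x1)// ler_wsqrtr//.
  have : n.+1%:R * (t + t) <= (enorm x + 1) * (t + t) by rewrite ler_wpM2r// addr_ge0 ?ltW.
  lra.
have e2 : S * Num.sqrt (c / 2) <= Num.sqrt (n.+1%:R * c).
  rewrite -sqrtrM ?(ltW x1)// ler_wsqrtr//.
  have : (1 + enorm x) * c <= (2 * n.+1%:R) * c by rewrite ler_wpM2r ?ltW//; lra.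
  lra.
have e3 : 0 < S * Num.sqrt (c / 2) by rewrite mulr_gt0.
apply: (@le_trans _ _ (C * (S * Num.sqrt (1 + (t + t))) ^+ m.+1 / (S * Num.sqrt (c / 2)))).
  apply: ler_pM.
  - by rewrite mulr_ge0 ?exprn_ge0 ?sqrtr_ge0.
  - by rewrite invr_ge0 sqrtr_ge0.
  - rewrite ler_wpM2l// lerXn2r ?nnegrE ?sqrtr_ge0// mulr_ge0 ?sqrtr_ge0 ?ltW//.
  - by rewrite lef_pV2 ?posrE// (lt_le_trans e3).
rewrite exprMn exprS le_eqVlt; apply/orP; left; apply/eqP.
move: (Num.sqrt (1 + (t + t)) ^+ m.+1) => u; move: (S ^+ m) => v; field.
by rewrite !gt_eqF.
Qed.

(** The weight is constant here, so at fixed x the bound of [orbit_decay] tends to 0 as n grows.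
    Squaring removes the root before the Archimedean argument. *)
Lemma tempered_zero s r k x : 0 < s <= t -> orbit_seq a t r -> tempered 0 r ->
  nbsum a s (r k) x = r (k + 2) x.
Proof.
move=> st orb [C C0 rC].
have [c /andP[c0 c1] h] := orbit_decay hd ha t0 st (tempered_by_homo 0 C0) orb rC.
apply/eqP; rewrite -subr_eq0 -normr_eq0 -sqrf_eq0 eq_le sqr_ge0 andbT; move: (h k x) => {}h.
move: (nbsum a s (r k) x - r (k + 2) x) h => v h.
apply: (@archi_le0 _ _ ((C * F x) ^+ 2 / c)) => n.
have n0 : 0 < n.+1%:R * c by rewrite mulr_gt0.
have := h n; rewrite /tempered_by expr0 mulr1 ler_pdivlMr ?sqrtr_gt0// => {}h.
have : (`|v| * Num.sqrt (n.+1%:R * c)) ^+ 2 <= (C * F x) ^+ 2.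
  by rewrite lerXn2r// nnegrE ?mulr_ge0 ?sqrtr_ge0 ?sphsum_ge0.
rewrite exprMn sqr_sqrtr ?(ltW n0)// mulrA -ler_pdivlMr//; apply: le_trans.
by rewrite ler_wpM2l// ler_nat.
Qed.

Lemma orbit_seq_step s r : 0 < s -> orbit_seq a t r ->
  orbit_seq a t (fun k x => nbsum a s (r k) x - r (k + 2) x).
Proof.
move=> s0 [lr rT].
have gs := nbsum_good hd ha s0; have gt := nbsum_good hd ha t0; split.
  by move=> k; apply: locbB => //; exact: (good_locb gs).
move=> k x; have l1 : locb (nbsum a s (r k)) by exact: (good_locb gs).
have -> : T (fun y => nbsum a s (r k) y - r (k + 2) y) x =
   T (fun y => nbsum a s (r k) y + (- 1) * r (k + 2) y) x.
  by congr (nbsum a t _ x); apply/funext => y; rewrite mulN1r.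
rewrite (good_lin gt)// nbsumC//.
have -> : nbsum a t (r k) = r (k + 1) by apply/funext => y; exact: rT.
by rewrite rT mulN1r addrAC.
Qed.

(** Induction on the growth with s = t: the differences r_(k+1) - r_(k+2) form an orbit of smaller
    growth, hence do not depend on k. At each x the progression r_k is bounded because one constant
    serves all k, so it is constant. *)
Lemma orbit_fixed m r : orbit_seq a t r -> tempered m r ->
  forall k x, r (k + 1) x = r k x.
Proof.
have tt : 0 < t <= t by rewrite t0 lexx.
elim: m r => [|m IH] r orb tr k x.
  have := tempered_zero (k - 1) x tt orb tr; have [_ ->] := orb.
  by rewrite subrK => ->; rewrite -addrA.
have [C _ h] := tr.
apply: (@bounded_arith _ (fun k => r k x) (tempered_by C m.+1 (enorm x) * F x)).
  by move=> k'; exact: h.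
move=> k'; have := IH _ (orbit_seq_step t0 orb) (tempered_step tt orb tr) (k' - 1) x.
have [_ rT] := orb; rewrite !rT.
have -> : k' - 1 + 1 + 1 = k' + 1 by ring.
have -> : k' - 1 + 1 + 2 = k' + 2 by ring.
have -> : k' - 1 + 1 = k' by ring.
by have -> : k' - 1 + 2 = k' + 1 by ring.
Qed.

Lemma fixed_step s f m C : 0 < s <= t -> 0 <= C -> locb f -> (forall x, T f x = f x) ->
  dominated a (tempered_by C m.+1) f ->
  let g := fun x => nbsum a s f x - f x in
  [/\ locb g, forall x, T g x = g x &
    exists2 C', 0 <= C' & dominated a (tempered_by C' m) g].
Proof.
move=> st C0 lf Tf fC g; have /andP[s0 _] := st.
have orb : orbit_seq a t (fun=> f) by split.
have [lg Tg] := orbit_seq_step s0 orb.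
split; [exact: lg 0|exact: Tg 0|].
have [|C' C'0 h] := tempered_step (m := m) st orb; first by exists C.
by exists C' => //; exact: h 0.
Qed.

Lemma fixed_zero s f C x : 0 < s <= t -> 0 <= C -> locb f -> (forall x, T f x = f x) ->
  dominated a (tempered_by C 0) f -> nbsum a s f x = f x.
Proof.
move=> st C0 lf Tf fC; have orb : orbit_seq a t (fun=> f) by split.
by apply: (tempered_zero 0 x st orb); exists C.
Qed.

(** The factor (1 + |x|)^d of [expR_le_sphsum] amounts to 2 d half powers. *)
Lemma exp_tempered M r : 0 <= M -> (forall k x, `|r k x| <= M * expR (a * enorm x)) ->
  tempered (2 * d) r.
Proof.
move=> M0 rM; have [C C0 h] := expR_le_sphsum hd ha.
exists (M * C) => [|k x]; first by rewrite mulr_ge0// ltW.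
rewrite (le_trans (rM k x))// /tempered_by exprM sqr_sqrtr ?addr_ge0 ?enorm_ge0//.
by rewrite -!mulrA ler_wpM2l// mulrA.
Qed.

Lemma orbit_vanish (l M : R) r : 1 < l -> 0 <= M -> (forall k, locb (r k)) ->
  (forall k x, T (r k) x = l * r (k + 1) x) ->
  (forall k x, `|r k x| <= M * expR (a * enorm x)) -> forall k x, r k x = 0.
Proof.
move=> l1 M0 lr rT rM; have l0 : 0 < l by rewrite (lt_trans _ l1).
have [C C0 hC] := expR_le_sphsum hd ha.
(* With l = exp(2 e t), n averages raise the weight exp(e u) by the factor exp(e n t), while
   division by l^n gains exp(2 e n t). *)
have [e [e0 lE]] : exists e, 0 < e /\ l = expR (e * t) * expR (e * t).
  exists (ln l / (2 * t)); rewrite divr_gt0 ?ln_gt0 ?mulr_gt0//; split=> //.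
  by rewrite -expRD -[LHS]lnK ?posrE//; congr expR; field; rewrite gt_eqF.
have [K [K1 Ke]] : exists K, 1 <= K /\ d%:R <= K * e.
  exists (Num.max 1 (d%:R / e)); split; first by rewrite le_max lexx.
  by rewrite -ler_pdivrMr// le_max lexx orbT.
have poly (u : R) : 0 <= u -> (1 + u) ^+ d <= K ^+ d * expR (e * u).
  move=> u0; have dn : d%:R != 0 :> R by rewrite pnatr_eq0 -lt0n.
  have -> : expR (e * u) = expR (e * u / d%:R) ^+ d.
    by rewrite -expRM_natl; congr expR; field.
  rewrite -exprMn lerXn2r ?nnegrE ?addr_ge0 ?mulr_ge0 ?expR_ge0 ?(le_trans _ K1)//.
  apply: (@le_trans _ _ (K * (1 + e * u / d%:R))); last first.
    by rewrite ler_wpM2l ?(le_trans _ K1)// expR_ge1Dx.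
  have h : u * d%:R <= u * (K * e) by rewrite ler_wpM2l.
  have dp : 0 < d%:R :> R by rewrite ltr0n.
  by rewrite mulrDr mulr1 lerD// mulrA ler_pdivlMr//; lra.
(* The polynomial factor is replaced by an exponential, for which a shift is a factor, so the
   induction on n closes with an equality. *)
pose w n (u : R) := M * C * K ^+ d * (expR (e * (u + n%:R * t)) / l ^+ n).
have wh n : {homo w n : x y / x <= y}.
  move=> x y xy; rewrite /w ler_wpM2l ?mulr_ge0 ?exprn_ge0 ?(le_trans _ K1) ?(ltW C0)//.
  by rewrite ler_wpM2r ?invr_ge0 ?exprn_ge0 ?(ltW l0)// ler_expR ler_wpM2l ?(ltW e0)// lerD2r.
have rw n : forall k, dominated a (w n) (r k).
  elim: n => [|n IH] k x.
    rewrite (le_trans (rM k x))// /w mul0r addr0 expr0 divr1 -!mulrA ler_wpM2l//.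
    rewrite (le_trans (hC x))// -!mulrA ler_wpM2l ?(ltW C0)// mulrA.
    by rewrite ler_wpM2r ?sphsum_ge0// poly// enorm_ge0.
  have := good_dominated hd ha (ltW t0) (nbsum_good hd ha t0) (wh n) (lr (k - 1)) (IH _) x.
  rewrite rT subrK normrM gtr0_norm// -ler_pdivlMl//; move/le_trans; apply.
  rewrite mulrA ler_wpM2r ?sphsum_ge0// /w le_eqVlt; apply/orP; left; apply/eqP.
  have -> : enorm x + t + n%:R * t = enorm x + n.+1%:R * t by rewrite -natr1; ring.
  rewrite exprS; move: (expR _) (M * C * _) => p q; field.
  by rewrite expf_neq0 gt_eqF.
move=> k x; apply/eqP; rewrite -normr_le0.
have et0 : 0 < e * t by rewrite mulr_gt0.
rewrite -(pmulr_lle0 _ et0).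
apply: (@archi_le0 _ _ (M * C * K ^+ d * expR (e * enorm x) * F x)) => n.
have E0 : 0 < expR (e * t) ^+ n by rewrite exprn_gt0 ?expR_gt0.
have : `|r k x| * expR (e * t) ^+ n <= M * C * K ^+ d * expR (e * enorm x) * F x.
  rewrite -ler_pdivlMr//; apply: (le_trans (rw n k x)).
  rewrite /w lE exprMn mulrDr expRD (mulrCA e) expRM_natl le_eqVlt; apply/orP; left; apply/eqP.
  move: E0; move: (expR (e * t) ^+ n) (M * C * _) (expR _) => p q u p0; field.
  by rewrite gt_eqF.
apply: le_trans; rewrite -mulrA ler_wpM2l// -expRM_natl.
by rewrite (le_trans _ (expR_ge1Dx _))// mulrC lerDr.
Qed.

End orbits.

(** * The Darboux equation *)

Section one_variable_derivatives.
Context {R : realType}.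

Lemma is_derive_estimate (f K : R -> R) (s L e : R) : 0 < e ->
  (forall h, h != 0 -> `|h| < e -> `|f (s + h) - f s - h * L| <= `|h| * K h) ->
  K h @[h --> 0] --> 0 -> is_derive s 1 f L.
Proof.
move=> e0 fK K0.
suff h : h^-1 *: ((f \o shift s) (h *: 1) - f s) @[h --> 0^'] --> L.
  by split; [apply/cvg_ex; exists L|exact: cvg_lim].
apply/cvgrPdist_le => /= eps eps0.
have /cvgrPdist_le /(_ _ eps0) K1 : K h @[h --> 0^'] --> 0.
  by apply: cvg_within_filter.
near=> h.
have h0 : h != 0 by near: h; exact: nbhs_dnbhs_neq.
have he : `|h| < e.
  near: h; apply: dnbhs0_lt; exact: e0.
have := fK h h0 he; rewrite [h%:A]mulr1 (addrC h) => fh.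
have -> : L - h^-1 *: (f (s + h) - f s) = - (h^-1 * (f (s + h) - f s - h * L)).
  by rewrite /GRing.scale/=; field.
rewrite normrN normrM normfV ler_pdivrMl ?normr_gt0//.
apply: (le_trans fh); rewrite ler_wpM2l// (le_trans (ler_norm _))//.
have : `|0 - K h| <= eps by near: h; exact: K1.
by rewrite sub0r normrN.
Unshelve. all: by end_near. Qed.

End one_variable_derivatives.

Section directional_derivatives.
Context {R : realType} {d : nat}.
Local Notation V := 'rV[R]_d.
Implicit Types (G : V -> R) (v y : V).

Lemma is_derive_line G v y (h g : R) : is_derive (y + h *: v) v G g ->
  is_derive h (1 : R) (fun h => G (y + h *: v)) g.
Proof.
have E : (fun k : R => k^-1 *: (((fun h => G (y + h *: v)) \o shift h) (k *: 1) - G (y + h *: v))) =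
   (fun k : R => k^-1 *: ((G \o shift (y + h *: v)) (k *: v) - G (y + h *: v))).
  apply/funext => k /=; congr (_ *: (G _ - _)).
  by rewrite [k *: 1]mulr1 scalerDl addrCA.
by move=> [dG DG]; split; rewrite /derivable /derive E.
Qed.

Lemma line_is_derive G v y (g : R) :
  is_derive (0 : R) 1 (fun h => G (y + h *: v)) g -> is_derive y v G g.
Proof.
have E : (fun k : R => k^-1 *: (((fun h => G (y + h *: v)) \o shift 0) (k *: 1) - G (y + (0 : R) *: v))) =
   (fun k : R => k^-1 *: ((G \o shift y) (k *: v) - G y)).
  apply/funext => k /=; congr (_ *: (G _ - G _)); last by rewrite scale0r addr0.
  by rewrite [k *: 1]mulr1 addr0 addrC.
by move=> [dG DG]; split; [move: dG|move: DG]; rewrite /derivable /derive E.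
Qed.

Lemma line_mvt G (G' : V -> R) v y (h : R) : 0 < h ->
  (forall z, is_derive z v G (G' z)) ->
  exists2 c, 0 < c < h & G (y + h *: v) - G y = G' (y + c *: v) * h.
Proof.
move=> h0 dG.
have D x : is_derive x (1 : R) (fun h => G (y + h *: v)) (G' (y + x *: v)).
  by apply: is_derive_line; exact: dG.
have cf : {within `[0, h], continuous (fun h => G (y + h *: v))}.
  by apply: derivable_within_continuous => x _; have [] := D x.
have [c] := MVT h0 (fun x _ => D x) cf.
by rewrite in_itv/= scale0r addr0 subr0 => c0 E; exists c.
Qed.

End directional_derivatives.

(** * Ball integrals as functions of the radius *)

Section ball_moments.
Context {R : realType} {d : nat} (hd : (0 < d)%N).
Local Notation V := 'rV[R]_d.
Local Notation mu := (lebesgue_rV d).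
Implicit Types (G : V -> R) (s : R).

Definition mom0 G s : R := \int[mu]_y (ind s y * G y).

(** The weight vanishes on the sphere |y| = s, so the derivative in s has no surface term: it is
    [2 * s * mom0 G s]. Spherical means are thereby replaced by integrals over balls. *)
Definition mom1 G s : R := \int[mu]_y (ind s y * ((s ^+ 2 - enorm y ^+ 2) * G y)).

Lemma locb_weight s G : locb G -> locb (fun y : V => (s ^+ 2 - enorm y ^+ 2) * G y).
Proof.
move=> lG; apply: locbM => //; apply: locbB; first exact: locb_cst.
split.
  by apply: measurable_funX; apply: measurable_enorm.
move=> r; exists (r ^+ 2) => x xr; rewrite ger0_norm ?sqr_ge0//.
by rewrite lerXn2r ?nnegrE ?enorm_ge0 ?(ltW xr)// (le_trans (enorm_ge0 x)) ?ltW.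
Qed.

Lemma mom0_bcs G s : locb G -> bcs (fun y => ind s y * G y).
Proof. exact: bcs_locb_ind. Qed.

Lemma mom1_bcs G s : locb G -> bcs (fun y => ind s y * ((s ^+ 2 - enorm y ^+ 2) * G y)).
Proof. by move=> lG; apply: bcs_locb_ind; exact: locb_weight. Qed.

(** Where both indicators are 1 the error is exactly [h ^+ 2]; an error of order h occurs only on
    the thin shell where they differ. *)
Lemma ind_diff_bound (s h q : R) (b b' : bool) : 0 < s -> 0 < s + h -> `|h| < 1 -> 0 <= q ->
  b = (q < s) -> b' = (q < s + h) ->
  `|b'%:R * ((s + h) ^+ 2 - q ^+ 2) - b%:R * (s ^+ 2 - q ^+ 2) - h * (2 * s * b%:R)|
   <= h ^+ 2 + 4 * (s + 1) * `|h| * `|b'%:R - b%:R|.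
Proof.
move=> s0 sh0 h1 q0 -> ->.
have hh : 0 <= h ^+ 2 by rewrite sqr_ge0.
case: (ltP q (s + h)) => qsh; case: (ltP q s) => qs; rewrite ?mul1r ?mul0r ?mulr1 ?mulr0 ?subr0 ?sub0r ?subrr ?normr0 ?mulr0 ?addr0.
- rewrite (_ : _ - _ = h ^+ 2); last by ring.
  by rewrite ger0_norm.
- have h0 : 0 <= h by lra.
  have p : 0 <= (s + h) ^+ 2 - q ^+ 2 by nra.
  by rewrite normr1 mulr1 (ger0_norm h0) (ger0_norm p); nra.
- have h0 : h <= 0 by lra.
  rewrite normrN normr1 mulr1 (ler0_norm h0).
  rewrite ler_norml; apply/andP; split; nra.
- by rewrite ?normr0 hh.
Qed.

Lemma measurable_ind_diff s s' : bcs (fun y : V => `|ind s y - ind s' y|).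
Proof.
have [m [M [r h]]] := bcsB (@bcs_ind R d s) (bcs_ind s').
split; first exact: measurableT_comp.
by exists M, r => x; rewrite normr_id.
Qed.

Lemma Rintegral_ind_diff s s' : 0 < s -> 0 < s' ->
  \int[mu]_y `|ind s y - ind s' y| = `|s ^+ d - s' ^+ d| * volume (eball 1 : set V).
Proof.
wlog ss : s s' / s' <= s => [hw s0 s0'|s0 s0'].
  have [ss|ss] := leP s' s; first exact: hw.
  rewrite distrC -hw//; last exact: ltW.
  by apply: eq_Rintegral => y _; rewrite distrC.
have sd : s' ^+ d <= s ^+ d by apply: lerXn2r ss; rewrite nnegrE ltW.
rewrite ger0_norm ?subr_ge0// mulrBl -!volume_eball// -!Rintegral_ind -Rintegral_bcsB; try exact: bcs_ind.
by apply: eq_Rintegral => y _; rewrite ger0_norm// subr_ge0 ind_le.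
Qed.

Lemma is_derive_mom1 G s : locb G -> 0 < s -> is_derive s 1 (mom1 G) (2 * s * mom0 G s).
Proof.
move=> lG s0; have [M GM] := lG.2 (s + 1).
have V0 := @volume_gt0 R d 1 ltr01.
pose C1 := `|M| * volume (eball (s + 1) : set V).
pose C2 := `|M| * (4 * (s + 1)) * volume (eball 1 : set V).
(* Relative to h the error is of order |h| plus the volume of the shell. The minimum of 1 and s
   keeps s + h positive and below s + 1, where G is bounded. *)
apply: (@is_derive_estimate _ _ (fun h => `|h| * C1 + `|(s + h) ^+ d - s ^+ d| * C2) _ _ (Num.min 1 s)).
- by rewrite lt_min ltr01.
- move=> h h0; rewrite lt_min => /andP[h1 hs].
  have sh0 : 0 < s + h by move: hs; rewrite ltr_norml => /andP[? _]; lra.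
  pose D y := ind (s + h) y * (((s + h) ^+ 2 - enorm y ^+ 2) * G y) -
     ind s y * ((s ^+ 2 - enorm y ^+ 2) * G y) - h * (2 * s) * (ind s y * G y).
  have bD : bcs D by apply: bcsB; [apply: bcsB; exact: mom1_bcs|apply: bcsZ; exact: mom0_bcs].
  have -> : mom1 G (s + h) - mom1 G s - h * (2 * s * mom0 G s) = \int[mu]_y D y.
    rewrite mulrA -Rintegral_bcsZ; last exact: mom0_bcs.
    rewrite -!Rintegral_bcsB//; try exact: mom1_bcs.
      by apply: bcsB; exact: mom1_bcs.
    by apply: bcsZ; exact: mom0_bcs.
  pose B (y : V) : R := `|M| * h ^+ 2 * ind (s + 1) y + `|M| * (4 * (s + 1)) * `|h| * `|ind (s + h) y - ind s y|.
  have bB : bcs B by apply: bcsD; apply: bcsZ; [exact: bcs_ind|exact: measurable_ind_diff].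
  apply: (@le_trans _ _ (\int[mu]_y B y)).
    apply: (le_trans (norm_Rintegral_bcs bD)); apply: le_Rintegral_bcs => //.
      case: bD => mD [K [r hD]]; split; first exact: measurableT_comp.
      by exists K, r => y; rewrite normr_id.
    move=> y; have [ys|ys] := ltP (enorm y) (s + 1); last first.
      rewrite /D /B !indE !(ltNge (enorm y)).
      have -> : s + h <= enorm y by apply: le_trans ys; rewrite lerD2l (le_trans (ler_norm _))// ltW.
      have -> : s <= enorm y by apply: le_trans ys; rewrite lerDl.
      by rewrite ys /= !(mul0r, mulr0, subr0, subrr, normr0, addr0).
    have -> : D y = (ind (s + h) y * ((s + h) ^+ 2 - enorm y ^+ 2) -
       ind s y * (s ^+ 2 - enorm y ^+ 2) - h * (2 * s * ind s y)) * G y by rewrite /D; ring.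
    rewrite normrM mulrC /B.
    apply: (@le_trans _ _ (`|M| * (h ^+ 2 + 4 * (s + 1) * `|h| * `|ind (s + h) y - ind s y|))).
      apply: ler_pM => //; first by rewrite (le_trans (GM _ ys))// ler_norm.
      by rewrite !indE; apply: ind_diff_bound => //; exact: enorm_ge0.
    by rewrite (indE (s + 1)) ys mulr1 le_eqVlt; apply/orP; left; apply/eqP; ring.
  rewrite Rintegral_bcsD; [|apply: bcsZ; exact: bcs_ind|apply: bcsZ; exact: measurable_ind_diff].
  rewrite !Rintegral_bcsZ; [|exact: measurable_ind_diff|exact: bcs_ind].
  rewrite Rintegral_ind Rintegral_ind_diff// /C1 /C2 -(real_normK (num_real h)).
  by rewrite le_eqVlt; apply/orP; left; apply/eqP; ring.
have c1 : (fun h : R => `|h| * C1 + `|(s + h) ^+ d - s ^+ d| * C2) @ 0 -->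
    `|0 : R| * C1 + `|(s + 0) ^+ d - s ^+ d| * C2.
  apply: cvgD; apply: cvgM; [exact: norm_continuous|exact: cvg_cst| |exact: cvg_cst].
  apply: (@continuous_comp _ _ _ (fun h : R => (s + h) ^+ d - s ^+ d) (fun x : R => `|x|)); last exact: norm_continuous.
  apply: cvgB; last exact: cvg_cst.
  apply: (@continuous_comp _ _ _ (fun h : R => s + h) (fun x => x ^+ d)); last exact: exprn_continuous.
  by apply: cvgD; [exact: cvg_cst|exact: cvg_id].
by move: c1; rewrite normr0 addr0 subrr normr0 !mul0r addr0.
Qed.

End ball_moments.

(** * Integration by parts on balls *)

Section integration_by_parts.
Context {R : realType} {d : nat} (hd : (0 < d)%N).
Local Notation V := 'rV[R]_d.
Local Notation mu := (lebesgue_rV d).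
Implicit Types (G : V -> R) (s : R) (j : 'I_d).

Lemma Rintegral_dominated_cvg (f_ : nat -> V -> R) (f : V -> R) (M r : R) :
  (forall n, measurable_fun setT (f_ n)) -> measurable_fun setT f ->
  {ae mu, forall x, f_ ^~ x @ \oo --> f x} ->
  (forall n x, `|f_ n x| <= M * ind r x) ->
  \int[mu]_x f_ n x @[n --> \oo] --> \int[mu]_x f x.
Proof.
move=> mf_ mf ff fM.
have [||||| intf _ c] := @dominated_convergence _ _ _ mu setT measurableT
    (fun n x => (f_ n x)%:E) (fun x => (f x)%:E) (fun x => (M * ind r x)%:E).
- by move=> n; exact/measurable_EFinP.
- exact/measurable_EFinP.
- apply: filterS ff => x fx _; apply: cvg_EFin => //; exact: nearW.
- by under eq_fun do rewrite EFinM; apply: integrableZl => //; exact: integrable_ind.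
- by apply: aeW => x n _; rewrite /= lee_fin.
apply: fine_cvg; rewrite fineK//; exact: integrable_fin_num intf.
Qed.

Lemma dotp_delta (y : V) j : dotp y (delta_mx 0 j) = y 0 j.
Proof.
rewrite /dotp (bigD1 j)//= mxE !eqxx mulr1 big1 ?addr0// => i ij.
by rewrite mxE (negbTE ij) andbF mulr0.
Qed.

Lemma enorm_delta_sqr (y : V) (h : R) j :
  enorm (y + h *: delta_mx 0 j) ^+ 2 = enorm y ^+ 2 + 2 * h * y 0 j + h ^+ 2.
Proof.
rewrite !enorm_sqr dotpDl !dotpDr !dotpZl !dotpZr (dotpC _ y) !dotp_delta mxE !eqxx/=.
by ring.
Qed.

Lemma enorm_delta j : enorm (delta_mx 0 j : V) = 1.
Proof. by rewrite /enorm dotp_delta mxE !eqxx sqrtr1. Qed.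

(** As a positive part the weight is Lipschitz in |y|^2 across the sphere too, which bounds its
    difference quotients uniformly. *)
Lemma ind_weightE s (y : V) : 0 <= s ->
  ind s y * (s ^+ 2 - enorm y ^+ 2) = Num.max 0 (s ^+ 2 - enorm y ^+ 2).
Proof.
move=> s0; rewrite indE; case: ltP => ys.
  by rewrite mul1r; apply/esym/max_idPr; rewrite subr_ge0 lerXn2r ?nnegrE ?enorm_ge0 ?(ltW ys).
by rewrite mul0r; apply/esym/max_idPl; rewrite subr_le0 lerXn2r ?nnegrE ?enorm_ge0.
Qed.

Lemma max0_lipschitz (p q : R) : `|Num.max 0 p - Num.max 0 q| <= `|p - q|.
Proof.
have h1 := ler_norm (p - q); have h2 := ler_norm (q - p); rewrite distrC in h2.
by case: (leP 0 p) => ?; case: (leP 0 q) => ?; rewrite ler_norml; apply/andP; split; lra.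
Qed.

(* Translation invariance makes the integral of every difference quotient of
   [(s^2 - |y|^2)_+ G] vanish. *)
Lemma mom1_by_parts G (G' : V -> R) j s : 0 < s -> continuous G -> continuous G' ->
  (forall z, is_derive z (delta_mx 0 j) G (G' z)) ->
  mom1 G' s = 2 * mom0 (fun y => y 0 j * G y) s.
Proof.
move=> s0 cG cG' dG.
have lG := locb_continuous cG; have lG' := locb_continuous cG'.
have lc : locb (fun y : V => y 0 j) by apply: locb_continuous => y; exact: coord_continuous.
have lcG := locbM lc lG.
have [M0 GM0] := lG.2 (s + 3); have [M1 GM1] := lG'.2 (s + 3).
have M00 : 0 <= M0.
  by apply: le_trans (GM0 0 _); rewrite // enorm0 addr_gt0.
have M10 : 0 <= M1.
  by apply: le_trans (GM1 0 _); rewrite // enorm0 addr_gt0.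
set e : V := delta_mx 0 j in dG.
pose h (y : V) := ind s y * ((s ^+ 2 - enorm y ^+ 2) * G y).
have bh : bcs h by exact: mom1_bcs.
pose f (y : V) := ind s y * ((s ^+ 2 - enorm y ^+ 2) * G' y) - 2 * (ind s y * (y 0 j * G y)).
have bf : bcs f by apply: bcsB; [exact: mom1_bcs|apply: bcsZ; exact: mom0_bcs].
suff f0 : \int[mu]_y f y = 0.
  apply/eqP; rewrite -subr_eq0 -Rintegral_bcsZ; last exact: mom0_bcs.
  rewrite -Rintegral_bcsB; [|exact: mom1_bcs|by apply: bcsZ; exact: mom0_bcs].
  by apply/eqP.
pose eps (n : nat) : R := n.+1%:R^-1.
have eps0 n : 0 < eps n by rewrite invr_gt0.
have eps1 n : eps n <= 1 by rewrite invf_le1// ler1n.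
have ceps : eps n @[n --> \oo] --> 0.
  by apply/cvgrPdist_lt => k k0; near=> n; rewrite sub0r normrN ger0_norm ?ltW//;
     near: n; exact: near_infty_natSinv_lt (PosNum k0).
pose f_ n (y : V) := (eps n)^-1 * (h (y + eps n *: e) - h y).
have mhe n : measurable_fun setT (fun y : V => h (y + eps n *: e)).
  by apply: (measurableT_comp bh.1); exact: measurable_rVD.
have intf_ n : \int[mu]_y f_ n y = 0.
  have bhe : bcs (fun y : V => h (y + eps n *: e)).
    split => //; have [_ [M [r hM]]] := bh; exists `|M|, (r + eps n) => y.
    apply: (le_trans (hM _)); apply: (le_trans (ler_wpM2r (ind_ge0 _ _) (ler_norm _))).
    rewrite ler_wpM2l// !indE ler_nat; case: ltP => // yr.
    rewrite (_ : enorm y < _)// -[y](addrK (eps n *: e)).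
    rewrite (le_lt_trans (enormB _ _))// ltr_leD// enormZ enorm_delta mulr1.
    by rewrite gtr0_norm.
  rewrite /f_ Rintegral_bcsZ; last exact: bcsB.
  by rewrite Rintegral_bcsB// Rintegral_translation ?subrr ?mulr0//; exact: bh.1.
have fl : \int[mu]_y f_ n y @[n --> \oo] --> \int[mu]_y f y.
  (* The first summand bounds the quotient of the weight, with |y_j| < s + 2 and a step of at most
     1, times |G|. The second bounds the weight by s^2 and the quotient of G by the mean value
     theorem. *)
  apply: (@Rintegral_dominated_cvg _ _ ((2 * (s + 2) + 1) * M0 + s ^+ 2 * M1) (s + 2)).
  - move=> n; apply: measurable_funM => //; apply: measurable_funB => //; exact: bh.1.
  - exact: bf.1.
  (* The weight has a kink on the sphere, so convergence is shown off this null set. *)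
  - exists [set y | enorm y = s]; split; [exact: measurable_sphere|exact: negligible_sphere|].
    move=> y /= ny; apply: contrapT => /eqP ys; apply: ny.
    have [ys'|ys'] := ltP (enorm y) s.
      pose k (x : R) := (s ^+ 2 - (enorm y ^+ 2 + 2 * x * y 0 j + x ^+ 2)) * G (y + x *: e).
      have dk : is_derive (0 : R) (1 : R) k (f y).
        have dGl : is_derive (0 : R) (1 : R) (fun x : R => G (y + x *: e)) (G' (y + (0 : R) *: e)).
          by apply: is_derive_line; exact: dG.
        have dp : is_derive (0 : R) (1 : R) (fun x : R => s ^+ 2 - (enorm y ^+ 2 + 2 * x * y 0 j + x ^+ 2)) (- 2 * y 0 j).
          apply: is_derive_eq; rewrite /GRing.scale/= !mulr1 !mulr0 !addr0; ring.
        apply: is_derive_eq.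
        rewrite scale0r addr0 /f indE ys' !mul1r /GRing.scale/= expr0n/= !mulr0 !mul0r !addr0; ring.
      have [g [gE cg g0]] := (is_derive1_caratheodory k 0 (f y)).1 dk.
      rewrite -g0.
      have cge : g (eps n) @[n --> \oo] --> g 0 by exact: (cvg_comp eps g ceps cg).
      apply: cvg_trans cge; apply: near_eq_cvg; near=> n.
      have sm : enorm (y + eps n *: e) < s.
        rewrite (le_lt_trans (enormD _ _))// enormZ enorm_delta mulr1 gtr0_norm//.
        have : eps n < s - enorm y.
          near: n; apply: (@near_infty_natSinv_lt R (PosNum _)); by rewrite subr_gt0.
        by lra.
      have := gE (eps n); rewrite subr0 => gk.
      apply: (mulIf (lt0r_neq0 (eps0 n))); rewrite -gk /f_ mulrAC mulVf ?gt_eqF// mul1r.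
      rewrite /h !indE sm ys' !mul1r /k enorm_delta_sqr scale0r addr0; ring.
    have {ys ys'}ys : s < enorm y by rewrite lt_def ys.
    have -> : f y = 0 by rewrite /f indE (ltNge _ s) (ltW ys)/= !mul0r mulr0 subr0.
    apply: cvg_near_cst; near=> n.
    have sm : s < enorm (y + eps n *: e).
      have : eps n < enorm y - s.
        near: n; apply: (@near_infty_natSinv_lt R (PosNum _)); by rewrite subr_gt0.
      have := enormB (y + eps n *: e) (eps n *: e).
      rewrite addrK [X in _ <= _ + X]enormZ enorm_delta mulr1 gtr0_norm//; lra.
    by rewrite /f_ /h !indE (ltNge _ s) (ltW sm) (ltNge _ s) (ltW ys) /= !mul0r subrr mulr0.
  move=> n y; rewrite indE; case: ltP => ys; last first.
    have sm : s < enorm (y + eps n *: e).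
      have := enormB (y + eps n *: e) (eps n *: e).
      rewrite addrK [X in _ <= _ + X]enormZ enorm_delta mulr1 gtr0_norm//.
      have := eps1 n; lra.
    rewrite /f_ /h !indE (ltNge _ s) (ltW sm) (ltNge _ s) (_ : s <= enorm y) /= ?mul0r ?subrr ?mulr0 ?normr0//.
    by rewrite (le_trans _ ys)// lerDl.
  have yj : `|y 0 j| <= s + 2 by rewrite (le_trans (coord_le_enorm _ _)) ?ltW.
  have bnd (c : R) : 0 <= c <= eps n -> enorm (y + c *: e) < s + 3.
    move=> /andP[c0 c1]; rewrite (le_lt_trans (enormD _ _))// enormZ enorm_delta mulr1 ger0_norm//.
    have := eps1 n; lra.
  rewrite mulr1 /f_ normrM normfV (gtr0_norm (eps0 n)) mulrC ler_pdivrMr//.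
  have -> : h (y + eps n *: e) - h y =
      (ind s (y + eps n *: e) * (s ^+ 2 - enorm (y + eps n *: e) ^+ 2) - ind s y * (s ^+ 2 - enorm y ^+ 2)) * G (y + eps n *: e) +
      ind s y * (s ^+ 2 - enorm y ^+ 2) * (G (y + eps n *: e) - G y) by rewrite /h; ring.
  rewrite !ind_weightE ?(ltW s0)// (le_trans (ler_normD _ _))// [leRHS]mulrDl lerD//.
    rewrite normrM mulrAC ler_pM//; last by apply: GM0; apply: bnd; rewrite lexx ltW.
    apply: (le_trans (max0_lipschitz _ _)); rewrite enorm_delta_sqr.
    rewrite (_ : _ - _ = - (eps n * (2 * y 0 j + eps n))); last by ring.
    rewrite normrN normrM (gtr0_norm (eps0 n)) mulrC ler_wpM2r ?(ltW (eps0 n))//.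
    rewrite (le_trans (ler_normD _ _))// lerD//; last by rewrite gtr0_norm.
    by rewrite normrM ger0_norm// ler_wpM2l.
  have [c /andP[c0 c1] ->] := line_mvt y (eps0 n) dG.
  rewrite normrM normrM (gtr0_norm (eps0 n)) mulrA ler_wpM2r ?(ltW (eps0 n))//.
  apply: ler_pM => //; last by apply: GM1; apply: bnd; rewrite !ltW.
  rewrite ger0_norm ?le_max ?lexx// ge_max sqr_ge0/= gerBl sqr_ge0//.
have : (fun n => \int[mu]_y f_ n y) @ \oo --> (0 : R).
  by under eq_fun do rewrite intf_; exact: cvg_cst.
by move=> h0; exact: (cvg_unique _ fl h0).
Unshelve. all: by end_near. Qed.

End integration_by_parts.

Section positivity_from_zero.
Context {R : realType}.

(** Z increases strictly, so a negative value would bound it away from 0 further left. Behaviour at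
    0 is expressed through small s > 0, because the functions in use are quotients that degenerate
    at 0. *)
Lemma pos_from_zero (Z Z' : R -> R) (t : R) :
  (forall s, 0 < s <= t -> is_derive s (1 : R) Z (Z' s)) ->
  (forall s, 0 < s <= t -> 0 < Z' s) ->
  (forall e, 0 < e -> forall k, 0 < k -> exists2 s, 0 < s < k & `|Z s| <= e) ->
  forall s, 0 < s <= t -> 0 < Z s.
Proof.
move=> dZ Z'0 Z0.
have incr x y : 0 < x -> x < y -> y <= t -> Z x < Z y.
  move=> x0 xy yt.
  have D z : z \in `]x, y[ -> is_derive z (1 : R) Z (Z' z).
    rewrite in_itv/= => /andP[xz zy]; apply: dZ.
    by rewrite (lt_trans x0 xz) (le_trans (ltW zy) yt).
  have cZ : {within `[x, y], continuous Z}.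
    apply: derivable_within_continuous => z; rewrite in_itv/= => /andP[xz zy].
    by have [] := dZ z; rewrite // (lt_le_trans x0 xz) (le_trans zy yt).
  have [z] := MVT xy D cZ; rewrite in_itv/= => /andP[xz zy] E.
  rewrite -subr_gt0 E mulr_gt0 ?subr_gt0// Z'0//.
  by rewrite (lt_trans x0 xz) (le_trans (ltW zy) yt).
move=> s /andP[s0 st]; have s20 : 0 < s / 2 by rewrite divr_gt0.
have s2s : s / 2 < s by lra.
apply: le_lt_trans (incr _ _ s20 s2s st); rewrite leNgt; apply/negP => neg.
have [|x /andP[x0 xs]] := Z0 (- Z (s / 2) / 2) _ _ s20; first by lra.
have := incr _ _ x0 xs (le_trans (ltW s2s) st).
by rewrite ler_norml => + /andP[+ _]; lra.
Qed.

End positivity_from_zero.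

(** * The Darboux equation in integrated form *)

Section darboux.
Context {R : realType} {d : nat} (hd : (0 < d)%N).
Local Notation V := 'rV[R]_d.
Local Notation mu := (lebesgue_rV d).
Implicit Types (f g phi : V -> R) (s : R).

Lemma bcs0 : bcs (fun _ : V => 0 : R).
Proof. by apply: bcs_eq (bcsZ 0 (@bcs_ind R d 0)) => x; rewrite mul0r. Qed.

Lemma bcs_sum (I : Type) (r : seq I) (F : I -> V -> R) :
  (forall i, bcs (F i)) -> bcs (fun y => \sum_(i <- r) F i y).
Proof.
move=> bF; elim: r => [|i r IH].
  by under eq_fun do rewrite big_nil; exact: bcs0.
by under eq_fun do rewrite big_cons; exact: bcsD.
Qed.

Lemma Rintegral_bcs_sum (I : Type) (r : seq I) (F : I -> V -> R) :
  (forall i, bcs (F i)) ->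
  \int[mu]_y (\sum_(i <- r) F i y) = \sum_(i <- r) \int[mu]_y F i y.
Proof.
move=> bF; elim: r => [|i r IH].
  under eq_Rintegral do rewrite big_nil.
  by rewrite big_nil Rintegral_cst// mul0r.
under eq_Rintegral do rewrite big_cons.
by rewrite big_cons Rintegral_bcsD ?IH//; exact: bcs_sum.
Qed.

Lemma continuous_sum_rV (I : Type) (r : seq I) (F : I -> V -> R) :
  (forall i, continuous (F i)) -> continuous (fun y => \sum_(i <- r) F i y).
Proof.
move=> cF; elim: r => [|i r IH].
  have -> : (fun y : V => \sum_(i <- [::]) F i y) = cst 0 by apply/funext => y; rewrite big_nil.
  exact: cst_continuous.
have -> : (fun y : V => \sum_(j <- i :: r) F j y) = (fun y => F i y + \sum_(j <- r) F j y).
  by apply/funext => y; rewrite big_cons.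
by move=> x; exact: (cvgD (cF i x) (IH x)).
Qed.

Lemma continuousM_rV f g : continuous f -> continuous g -> continuous (fun y => f y * g y).
Proof. by move=> cf cg x; exact: (cvgM (cf x) (cg x)). Qed.

Definition c2 phi (phi1 phi2 : 'I_d -> V -> R) :=
  [/\ continuous phi, forall j, continuous (phi1 j), forall j, continuous (phi2 j),
      forall j y, is_derive y (delta_mx 0 j) phi (phi1 j y) &
      forall j y, is_derive y (delta_mx 0 j) (phi1 j) (phi2 j y)].

Lemma is_derive_coord (y : V) (i j : 'I_d) :
  is_derive y (delta_mx 0 j) (fun x : V => x 0 i) (i == j)%:R.
Proof.
apply: line_is_derive.
have -> : (fun h : R => (y + h *: delta_mx 0 j) 0 i) = (fun h : R => y 0 i + h * (i == j)%:R).
  by apply/funext => h; rewrite !mxE eqxx.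
by apply: is_derive_eq; rewrite /GRing.scale/= mul0r !add0r mul1r mulr1.
Qed.

Lemma is_derive_coordM (y : V) j (f : V -> R) (f' : R) :
  is_derive y (delta_mx 0 j) f f' ->
  is_derive y (delta_mx 0 j) (fun x : V => x 0 j * f x) (f y + y 0 j * f').
Proof.
move=> df; have dc := is_derive_coord y j j.
by apply: is_derive_eq; rewrite /GRing.scale/= eqxx mulr1 addrC.
Qed.

Section one_function.
Variables (phi : V -> R) (phi1 phi2 : 'I_d -> V -> R).
Hypothesis hphi : c2 phi phi1 phi2.

Definition lap (y : V) := \sum_j phi2 j y.

Lemma continuous_lap : continuous lap.
Proof. by have [_ _ c _ _] := hphi; exact: continuous_sum_rV. Qed.

Let euler (y : V) := \sum_j y 0 j * phi1 j y.

Let continuous_euler : continuous euler.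
Proof.
have [_ c _ _ _] := hphi; apply: continuous_sum_rV => j.
by apply: continuousM_rV => // y; exact: coord_continuous.
Qed.

Let mom0_euler s : 0 < s -> 2 * mom0 euler s = mom1 lap s.
Proof.
move=> s0; have [c0 c1 c2' d1 d2] := hphi.
transitivity (\sum_j 2 * mom0 (fun y => y 0 j * phi1 j y) s).
  rewrite -mulr_sumr; congr (_ * _); rewrite -Rintegral_bcs_sum; last first.
    move=> j; apply: mom0_bcs; apply: locb_continuous.
    by apply: continuousM_rV => // y; exact: coord_continuous.
  by apply: eq_Rintegral => y _; rewrite mulr_sumr.
transitivity (\sum_j mom1 (phi2 j) s).
  by apply: eq_bigr => j _; rewrite -(mom1_by_parts hd s0 (c1 j) (c2' j) (d2 j)).
rewrite -Rintegral_bcs_sum; last by move=> j; apply: mom1_bcs; exact: locb_continuous.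
by apply: eq_Rintegral => y _; rewrite -!mulr_sumr.
Qed.

(** Integration by parts of y_j phi, summed over j, combined with |y|^2 = s^2 - (s^2 - |y|^2). *)
Let mom0_mom1 s : 0 < s ->
  2 * s ^+ 2 * mom0 phi s = (d%:R + 2) * mom1 phi s + mom1 euler s.
Proof.
move=> s0; have [c0 c1 c2' d1 d2] := hphi.
have cc j : continuous (fun y : V => y 0 j * phi y).
  by apply: continuousM_rV => // y; exact: coord_continuous.
have cp j : continuous (fun y : V => phi y + y 0 j * phi1 j y).
  move=> y; apply: (cvgD (c0 y)).
  have ccj : continuous (fun y : V => y 0 j) by move=> z; exact: coord_continuous.
  exact: (cvgM (ccj y) (c1 j y)).
have lphi := locb_continuous c0.
have e1 : d%:R * mom1 phi s + mom1 euler s = \sum_j mom1 (fun y : V => phi y + y 0 j * phi1 j y) s.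
  rewrite -Rintegral_bcs_sum; last by move=> j; apply: mom1_bcs; exact: locb_continuous.
  rewrite -Rintegral_bcsZ; last exact: mom1_bcs.
  rewrite -Rintegral_bcsD; last 2 first.
  - by apply: bcsZ; exact: mom1_bcs.
  - by apply: mom1_bcs; exact: locb_continuous.
  apply: eq_Rintegral => y _; rewrite -!mulr_sumr big_split/= sumr_const card_ord.
  by rewrite -/(euler y) -[phi y *+ d]mulr_natl; ring.
have e2 : \sum_j mom1 (fun y : V => phi y + y 0 j * phi1 j y) s =
    2 * mom0 (fun y => enorm y ^+ 2 * phi y) s.
  transitivity (\sum_j 2 * mom0 (fun y => y 0 j * (y 0 j * phi y)) s).
    apply: eq_bigr => j _; apply: (mom1_by_parts hd s0 (cc j) (cp j)) => z.
    exact: is_derive_coordM.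
  rewrite -mulr_sumr; congr (_ * _); rewrite -Rintegral_bcs_sum; last first.
    move=> j; apply: mom0_bcs; apply: locb_continuous.
    by apply: continuousM_rV => // y; exact: coord_continuous.
  apply: eq_Rintegral => y _; rewrite -mulr_sumr; congr (_ * _).
  by rewrite enorm_sqr /dotp mulr_suml; apply: eq_bigr => j _; rewrite mulrA.
have e3 : mom1 phi s = s ^+ 2 * mom0 phi s - mom0 (fun y => enorm y ^+ 2 * phi y) s.
  have le : locb (fun y : V => enorm y ^+ 2 * phi y).
    have := locbB (locbZ (s ^+ 2) lphi) (locb_weight s lphi).
    by under eq_fun do rewrite mulrBl subKr.
  rewrite -Rintegral_bcsZ; last exact: mom0_bcs.
  rewrite -Rintegral_bcsB; last 2 first.
  - by apply: bcsZ; exact: mom0_bcs.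
  - exact: mom0_bcs.
  by apply: eq_Rintegral => y _; ring.
move: e1 e2 e3; move: (mom1 phi s) (mom1 euler s) (mom0 phi s) (\sum_j _) (mom0 _ s).
by move=> p q u v w; lra.
Qed.

(* The Darboux equation for spherical means, integrated once. *)
Lemma is_derive_mom0 s : 0 < s ->
  is_derive s (1 : R) (mom0 phi) (d%:R / s * mom0 phi s + mom1 lap s / (2 * s)).
Proof.
move=> s0; have [c0 c1 c2' d1 d2] := hphi.
have lphi := locb_continuous c0; have leu := locb_continuous continuous_euler.
(* [mom0_mom1] solved for [mom0 phi]: on the right there are only [mom1] terms, whose derivatives
   are known, so no surface integral appears. *)
pose g (x : R) := ((d%:R + 2) * mom1 phi x + mom1 euler x) * (2 * x ^+ 2)^-1.
have sn : 2 * s ^+ 2 != 0 by rewrite mulf_neq0// expf_neq0// gt_eqF.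
have dm1 := is_derive_mom1 lphi s0; have dm2 := is_derive_mom1 leu s0.
have dq : is_derive s (1 : R) (fun x : R => 2 * x ^+ 2) (4 * s).
  by apply: is_derive_eq; rewrite /GRing.scale/= !mulr1; ring.
have dg : is_derive s (1 : R) g (d%:R / s * mom0 phi s + mom1 lap s / (2 * s)).
  have dv := @is_deriveV _ (fun x : R => 2 * x ^+ 2) _ _ _ sn dq.
  apply: is_derive_eq; rewrite /GRing.scale/= -mom0_euler//.
  have e : mom1 euler s = 2 * s ^+ 2 * mom0 phi s - (d%:R + 2) * mom1 phi s.
    by rewrite mom0_mom1// [X in _ = X - _]addrC addrK.
  rewrite e; move: (mom0 phi s) (mom0 euler s) (mom1 phi s) => u v w.
  by field; rewrite gt_eqF.
apply: near_eq_is_derive dg; near=> x.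
have x0 : 0 < x by near: x; exact: lt_nbhsr.
rewrite /g -mom0_mom1// mulrAC mulfV ?mul1r// mulf_neq0// expf_neq0// gt_eqF//.
Unshelve. all: by end_near. Qed.

End one_function.

End darboux.

Section coordinate_functions.
Context {R : realType} {d : nat}.
Local Notation V := 'rV[R]_d.
Implicit Type i : 'I_d.

Lemma derivable_continuous (h h' : R -> R) :
  (forall x, is_derive x (1 : R) h (h' x)) -> continuous h.
Proof.
move=> dh x; apply/differentiable_continuous/derivable1_diffP.
by have [] := dh x.
Qed.

Lemma continuous_coordT i (h : R -> R) : continuous h -> continuous (fun y : V => h (y 0 i)).
Proof.
move=> ch y; apply: (@continuous_comp _ _ _ (fun y : V => y 0 i) h); last exact: ch.
exact: coord_continuous.
Qed.

Lemma is_derive_coordT i (h : R -> R) (h' : R) (y : V) j :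
  is_derive (y 0 i) (1 : R) h h' ->
  is_derive y (delta_mx 0 j) (fun y : V => h (y 0 i)) ((i == j)%:R * h').
Proof.
move=> dh; apply: line_is_derive.
have -> : (fun x : R => h ((y + x *: delta_mx 0 j) 0 i)) =
    h \o (fun x : R => y 0 i + x * (i == j)%:R).
  by apply/funext => x; rewrite /= !mxE eqxx.
have dl : is_derive (0 : R) (1 : R) (fun x : R => y 0 i + x * (i == j)%:R) (i == j)%:R.
  by apply: is_derive_eq; rewrite /GRing.scale/= mul0r !add0r mul1r mulr1.
have dh2 : is_derive ((fun x : R => y 0 i + x * (i == j)%:R) 0) (1 : R) h h' by rewrite mul0r addr0.
rewrite mulrC; exact: is_derive1_comp.
Qed.

End coordinate_functions.

Section functions_of_one_coordinate.
Context {R : realType} {d : nat} (hd : (0 < d)%N).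
Local Notation V := 'rV[R]_d.
Let i0 : 'I_d := Ordinal hd.
Variables g g1 g2 : R -> R.
Hypothesis dg : forall x, is_derive x (1 : R) g (g1 x).
Hypothesis dg1 : forall x, is_derive x (1 : R) g1 (g2 x).
Hypothesis cg2 : continuous g2.

Lemma c2_coord : c2 (fun y : V => g (y 0 i0))
  (fun j y => (i0 == j)%:R * g1 (y 0 i0)) (fun j y => (i0 == j)%:R * g2 (y 0 i0)).
Proof.
have cc (h : R -> R) (c : R) : continuous h -> continuous (fun y : V => c * h (y 0 i0)).
  by move=> ch; apply: continuousM_rV; [exact: cst_continuous|exact: continuous_coordT].
split.
- by apply: continuous_coordT; exact: derivable_continuous dg.
- by move=> j; apply: cc; exact: derivable_continuous dg1.
- by move=> j; exact: cc.
- by move=> j y; exact: is_derive_coordT.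
- move=> j y; have dh := is_derive_coordT j (dg1 (y 0 i0)).
  apply: is_derive_eq; rewrite /GRing.scale/=.
  by case: (i0 == j); rewrite ?mul1r ?mul0r.
Qed.

Lemma lap_coord (y : V) :
  lap (fun j (y : V) => (i0 == j)%:R * g2 (y 0 i0)) y = g2 (y 0 i0).
Proof.
rewrite /lap (bigD1 i0)// eqxx mul1r big1 => [|j ji]; first exact: addr0.
by rewrite eq_sym (negbTE ji) mul0r.
Qed.

End functions_of_one_coordinate.

Lemma is_derive_power {R : realType} n (s : R) : s != 0 ->
  is_derive s (1 : R) (fun x : R => x ^+ n) (n%:R * s ^+ n / s).
Proof.
move=> s0; case: n => [|n].
  by rewrite !mul0r; under eq_fun do rewrite expr0; exact: is_derive_cst.
have -> : (fun x : R => x ^+ n.+1) = (id : R -> R) ^+ n.+1 by apply/funext => x; rewrite exprfctE.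
have h := is_deriveX n (is_derive_id s (1 : R)).
apply: is_derive_eq; rewrite /GRing.scale/= mulr1 exprS.
by field.
Qed.

(** * The Darboux equation with a source *)

Section rigidity.
Context {R : realType} {d : nat} (hd : (0 < d)%N) (a : R) (ha : 0 < a).
Local Notation V := 'rV[R]_d.
Local Notation mu := (lebesgue_rV d).
Let i0 : 'I_d := Ordinal hd.

Definition exp2 (j : 'I_d) (y : V) : R := (i0 == j)%:R * (a ^+ 2 * expR (a * y 0 i0)).

Lemma expdot_e1E : expdot a (e1 d : V) = (fun y => expR (a * y 0 i0)).
Proof. by apply/funext => y; rewrite /expdot (dotp_e1 hd). Qed.

Lemma c2_expdot : c2 (expdot a (e1 d : V))
  (fun j y => (i0 == j)%:R * (a * expR (a * y 0 i0))) exp2.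
Proof.
rewrite expdot_e1E; apply: (@c2_coord R d hd (fun x => expR (a * x)) (fun x => a * expR (a * x))
   (fun x => a ^+ 2 * expR (a * x))).
- move=> x; apply: is_derive_eq; rewrite /GRing.scale/= mulr1; ring.
- move=> x; apply: is_derive_eq; rewrite /GRing.scale/= mulr1; ring.
- move=> x; apply/differentiable_continuous/derivable1_diffP; exact: ex_derive.
Qed.

Lemma lap_expdot y : lap exp2 y = a ^+ 2 * expdot a (e1 d) y.
Proof. by rewrite expdot_e1E (lap_coord hd (fun x => a ^+ 2 * expR (a * x))). Qed.

Lemma mom0Z (c : R) (f : V -> R) s : locb f -> mom0 (fun y => c * f y) s = c * mom0 f s.
Proof.
move=> lf; rewrite -Rintegral_bcsZ; last exact: mom0_bcs.
by apply: eq_Rintegral => y _; rewrite mulrCA.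
Qed.

Lemma mom1Z (c : R) (f : V -> R) s : locb f -> mom1 (fun y => c * f y) s = c * mom1 f s.
Proof.
move=> lf; rewrite -Rintegral_bcsZ; last exact: mom1_bcs.
apply: eq_Rintegral => y _; ring.
Qed.

Lemma mom0D (f g : V -> R) s : locb f -> locb g ->
  mom0 (fun y => f y + g y) s = mom0 f s + mom0 g s.
Proof.
move=> lf lg; rewrite -Rintegral_bcsD; [|exact: mom0_bcs..].
by apply: eq_Rintegral => y _; rewrite mulrDr.
Qed.

Lemma mom0_le (f : V -> R) s M : locb f -> (forall y, enorm y < s -> `|f y| <= M) ->
  `|mom0 f s| <= M * volume (eball s : set V).
Proof.
move=> lf fM; apply: Rintegral_bcs_le; first exact: mom0_bcs.
by move=> y; apply: ind_norm_mul; exact: fM.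
Qed.

Lemma mom1_le (f : V -> R) s M : 0 <= s -> locb f -> (forall y, enorm y < s -> `|f y| <= M) ->
  `|mom1 f s| <= s ^+ 2 * M * volume (eball s : set V).
Proof.
move=> s0 lf fM; apply: Rintegral_bcs_le; first exact: mom1_bcs.
move=> y; apply: ind_norm_mul => ys; rewrite normrM ler_pM//; last exact: fM.
rewrite ger0_norm ?subr_ge0 ?gerBl ?sqr_ge0// lerXn2r ?nnegrE ?enorm_ge0//.
exact: ltW.
Qed.

Lemma mom0_expdot_ge s : 0 < s ->
  expR (- (a * s)) * volume (eball s : set V) <= mom0 (expdot a (e1 d)) s.
Proof.
move=> s0; have le1 : locb (expdot a (e1 d : V)).
  by apply: (locb_expdot ha); rewrite (enorm_e1 hd).
rewrite -Rintegral_ind -Rintegral_bcsZ; last exact: bcs_ind.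
apply: le_Rintegral_bcs; [apply: bcsZ; exact: bcs_ind|exact: mom0_bcs|].
move=> y; rewrite mulrC indE; case: ltP => ys; last by rewrite !mul0r.
rewrite !mul1r ler_expR -mulrN ler_pM2l// lerNl -dotpNr.
by rewrite (le_trans (dotp_le _ _))// (enorm_e1 hd) mul1r enormN ltW.
Qed.

Lemma continuous_near0 (f : V -> R) : continuous f -> forall e, 0 < e ->
  exists2 k, 0 < k & forall y, enorm y < k -> `|f y - f 0| <= e.
Proof.
move=> cf e e0; have /cvgrPdist_le /(_ _ e0) /nbhs_ballP[k /= k0 hk] := cf 0.
exists k => // y yk; rewrite distrC; apply: hk; split => // i j; rewrite ord1.
rewrite /ball/= mxE sub0r normrN; apply: le_lt_trans yk.
exact: coord_le_enorm.
Qed.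

(** Let u and e be the ball integrals of phi and of E = exp(a y_1). For c > 0 the source makes a
    rescaled Wronskian of u and e increase from 0, so u / e increases strictly from phi(0) = 0 and
    cannot vanish at t. *)
Let darboux_pos (phi : V -> R) phi1 phi2 (t c : R) : 0 < t ->
  c2 phi phi1 phi2 -> phi 0 = 0 -> mom0 phi t = 0 ->
  (forall s, 0 < s <= t ->
    mom0 (fun y => lap phi2 y - a ^+ 2 * phi y) s = c * mom0 (expdot a (e1 d)) s) ->
  ~ 0 < c.
Proof.
move=> t0 cphi phi0 phit hc c0.
have V0 := @volume_gt0 R d 1 ltr01.
have cE := c2_expdot; set E := expdot a (e1 d) in cE hc *.
have lphi : locb phi by apply: locb_continuous; case: cphi.
have lE : locb E by apply: locb_continuous; case: cE.
have clap := continuous_lap cphi; have llap := locb_continuous clap.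
have lapE (s : R) : mom1 (lap exp2) s = a ^+ 2 * mom1 E s.
  by rewrite -mom1Z//; apply: eq_Rintegral => y _; rewrite lap_expdot.
have lapE0 (s : R) : mom0 (lap exp2) s = a ^+ 2 * mom0 E s.
  by rewrite -mom0Z//; apply: eq_Rintegral => y _; rewrite lap_expdot.
have E0 (s : R) : 0 < s -> 0 < mom0 E s.
  move=> s0; apply: lt_le_trans (mom0_expdot_ge s0).
  by rewrite mulr_gt0 ?expR_gt0// volume_gt0.
have dp (s : R) : 0 < s -> is_derive s (1 : R) (mom0 phi) (d%:R / s * mom0 phi s + mom1 (lap phi2) s / (2 * s)).
  exact: (is_derive_mom0 hd cphi).
have dE (s : R) : 0 < s -> is_derive s (1 : R) (mom0 E) (d%:R / s * mom0 E s + mom1 (lap exp2) s / (2 * s)).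
  exact: (is_derive_mom0 hd cE).
have dlp (s : R) : 0 < s -> is_derive s (1 : R) (mom1 (lap phi2)) (2 * s * mom0 (lap phi2) s).
  exact: is_derive_mom1.
have dlE (s : R) : 0 < s -> is_derive s (1 : R) (mom1 (lap exp2)) (2 * s * mom0 (lap exp2) s).
  move=> s0; apply: is_derive_mom1 => //; apply: locb_continuous; exact: continuous_lap cE.
have hlap (s : R) : 0 < s <= t -> mom0 (lap phi2) s = a ^+ 2 * mom0 phi s + c * mom0 E s.
  move=> st; rewrite -(hc s st) -mom0Z// -mom0D//.
  - by apply: eq_Rintegral => y _; rewrite addrC subrK.
  - exact: locbZ.
  - by apply: locbB => //; exact: locbZ.
have sn (s : R) : 0 < s -> s ^+ d != 0 by move=> s0; rewrite expf_neq0// gt_eqF.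
(* This is 2 s^(1-d) times the Wronskian u' e - u e'. The power of s absorbs the terms in d / s, so
   that only the source remains in the derivative. *)
pose Z (s : R) := (mom1 (lap phi2) s * mom0 E s - mom0 phi s * mom1 (lap exp2) s) * (s ^+ d)^-1.
have dZ (s : R) : 0 < s <= t -> is_derive s (1 : R) Z (2 * s * c * (mom0 E s) ^+ 2 * (s ^+ d)^-1).
  move=> st; have /andP[s0 _] := st.
  have := dp s s0; have := dE s s0; have := dlp s s0; have := dlE s s0.
  rewrite (hlap s st) (lapE0 s) (lapE s) => h1 h2 h3 h4.
  have dX : is_derive s (1 : R) (fun x : R => x ^+ d) (d%:R * s ^+ d / s).
    by apply: is_derive_power; rewrite gt_eqF.
  have dV := @is_deriveV _ (fun x : R => x ^+ d) _ _ _ (sn s s0) dX.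
  apply: is_derive_eq; rewrite /GRing.scale/= (lapE s).
  move: (sn s s0); move: (s ^+ d) (mom0 phi s) (mom0 E s) (mom1 (lap phi2) s) (mom1 E s) (d%:R : R).
  by move=> sd u v w z D sd0; field; rewrite sd0 gt_eqF.
have [M1 HM1] := llap.2 1; have [M2 HM2] := lphi.2 1; have [M3 HM3] := lE.2 1.
have Zpos (s : R) : 0 < s <= t -> 0 < Z s.
  move: s; apply: (pos_from_zero dZ).
    move=> s /andP[s0 _]; rewrite mulr_gt0 ?invr_gt0 ?exprn_gt0//.
    by rewrite mulr_gt0 ?exprn_gt0 ?E0// !mulr_gt0.
  move=> e e0 k k0.
  (* Both products in Z are at most a constant times s^2 s^(2d); after division by s^d the sum is
     below s K for s < 1. The added 1 makes K positive. *)
  pose K := (`|M1| * `|M3| + `|M2| * (a ^+ 2 * `|M3|)) * volume (eball 1 : set V) ^+ 2 + 1.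
  have K0 : 0 < K.
    by rewrite ltr_pwDr// mulr_ge0 ?exprn_ge0 ?(ltW V0)// addr_ge0// !mulr_ge0// ?exprn_ge0 ?(ltW ha).
  have [s [s0 sk s1 se]] : exists s, [/\ 0 < s, s < k, s < 1 & s * K <= e].
    exists (Num.min (k / 2) (Num.min 2^-1 (e / K))); split.
    - by rewrite !lt_min; apply/and3P; split; [exact: divr_gt0|rewrite invr_gt0|exact: divr_gt0].
    - by rewrite gt_min; apply/orP; left; lra.
    - by rewrite !gt_min; apply/orP; right; apply/orP; left; lra.
    - by rewrite -ler_pdivlMr// !ge_min lexx !orbT.
  exists s; first by rewrite s0 sk.
  have vs : volume (eball s : set V) = s ^+ d * volume (eball 1 : set V) by exact: volume_eball.
  have b1 : `|mom1 (lap phi2) s| <= s ^+ 2 * `|M1| * volume (eball s : set V).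
    apply: mom1_le => //; first exact: ltW.
    by move=> y ys; rewrite (le_trans (HM1 y (lt_trans ys s1)))// ler_norm.
  have b2 : `|mom0 phi s| <= `|M2| * volume (eball s : set V).
    by apply: mom0_le => // y ys; rewrite (le_trans (HM2 y (lt_trans ys s1)))// ler_norm.
  have b3 : `|mom0 E s| <= `|M3| * volume (eball s : set V).
    by apply: mom0_le => // y ys; rewrite (le_trans (HM3 y (lt_trans ys s1)))// ler_norm.
  have b4 : `|mom1 (lap exp2) s| <= a ^+ 2 * (s ^+ 2 * `|M3| * volume (eball s : set V)).
    rewrite lapE normrM ger0_norm ?exprn_ge0 ?(ltW ha)// ler_wpM2l ?exprn_ge0 ?(ltW ha)//.
    apply: mom1_le => //; first exact: ltW.
    by move=> y ys; rewrite (le_trans (HM3 y (lt_trans ys s1)))// ler_norm.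
  rewrite /Z normrM normfV (ger0_norm (exprn_ge0 d (ltW s0))) ler_pdivrMr ?exprn_gt0//.
  apply: (@le_trans _ _ (s * K * s ^+ d)); last by rewrite ler_wpM2r ?exprn_ge0 ?(ltW s0).
  apply: (le_trans (ler_normB _ _)); rewrite !normrM.
  apply: (le_trans (lerD (ler_pM _ _ b1 b3) (ler_pM _ _ b2 b4))) => //; rewrite vs.
  have s0' := ltW s0; have sd0 : 0 <= s ^+ d by exact: exprn_ge0.
  have sd1 : s ^+ d <= 1 by rewrite exprn_ile1// ltW.
  set v := volume _ in V0 K K0 se *; have v0 := ltW V0.
  set X := (`|M1| * `|M3| + `|M2| * (a ^+ 2 * `|M3|)) * v ^+ 2.
  have X0 : 0 <= X.
    by rewrite mulr_ge0 ?exprn_ge0// addr_ge0// !mulr_ge0// ?exprn_ge0 ?(ltW ha).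
  have -> : s ^+ 2 * `|M1| * (s ^+ d * v) * (`|M3| * (s ^+ d * v)) +
     `|M2| * (s ^+ d * v) * (a ^+ 2 * (s ^+ 2 * `|M3| * (s ^+ d * v))) = (s * (s * s ^+ d * X)) * s ^+ d.
    by rewrite /X; ring.
  rewrite ler_wpM2r// ler_wpM2l// /K -/X.
  apply: (@le_trans _ _ (1 * X)); last by rewrite mul1r lerDl.
  by rewrite ler_wpM2r// mulr_ile1// ltW.
pose v (s : R) := mom0 phi s * (mom0 E s)^-1.
have dv (s : R) : 0 < s <= t -> is_derive s (1 : R) v (Z s * s ^+ d / (2 * s * (mom0 E s) ^+ 2)).
  move=> st; have /andP[s0 _] := st.
  have h1 := dp s s0; have h2 := dE s s0.
  have En : mom0 E s != 0 by rewrite gt_eqF// E0.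
  have dV := @is_deriveV _ (mom0 E) _ _ _ En h2.
  apply: is_derive_eq; rewrite /GRing.scale/= /Z mulfVK ?sn//.
  move: En; move: (mom0 phi s) (mom0 E s) (mom1 _ s) (mom1 _ s) (d%:R : R).
  by move=> u w x y D w0; field; rewrite w0 gt_eqF.
have vt : 0 < v t.
  apply: (pos_from_zero dv) => [s /andP[s0 st]||]; last by rewrite t0 lexx.
    apply: divr_gt0.
      by apply: mulr_gt0; [apply: Zpos; rewrite s0|exact: exprn_gt0].
    by apply: mulr_gt0; [exact: mulr_gt0|rewrite exprn_gt0// E0].
  move=> e e0 k k0.
  (* For s < 1 the integral of E over the ball is at least exp(-a) times the volume, so u / e is at
     most e as soon as |phi| <= e exp(-a) on the ball, e now being the given bound. *)
  have ea : 0 < e * expR (- a) by rewrite mulr_gt0 ?expR_gt0.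
  have cc : continuous phi by case: cphi.
  have [k' k'0 hk'] := continuous_near0 cc ea.
  have [s [s0 sk s1 sk']] : exists s, [/\ 0 < s, s < k, s < 1 & s < k'].
    exists (Num.min (k / 2) (Num.min 2^-1 (k' / 2))); split.
    - by rewrite !lt_min; apply/and3P; split; [exact: divr_gt0|rewrite invr_gt0|exact: divr_gt0].
    - by rewrite gt_min; apply/orP; left; lra.
    - by rewrite !gt_min; apply/orP; right; apply/orP; left; lra.
    - by rewrite !gt_min; apply/orP; right; apply/orP; right; lra.
  exists s; first by rewrite s0 sk.
  have b : `|mom0 phi s| <= e * expR (- a) * volume (eball s : set V).
    apply: mom0_le => // y ys; have := hk' y (lt_trans ys sk').
    by rewrite phi0 subr0.
  rewrite /v normrM normfV (gtr0_norm (E0 s s0)) ler_pdivrMr ?E0//.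
  apply: (le_trans b); rewrite -mulrA ler_wpM2l ?(ltW e0)//.
  apply: le_trans (mom0_expdot_ge s0); rewrite ler_wpM2r ?(ltW (volume_gt0 s0))//.
  by rewrite ler_expR lerN2 ger_pMr// ltW.
by move: vt; rewrite /v phit mul0r ltxx.
Qed.

Lemma c2Z (k : R) (phi : V -> R) phi1 phi2 : c2 phi phi1 phi2 ->
  c2 (fun y => k * phi y) (fun j y => k * phi1 j y) (fun j y => k * phi2 j y).
Proof.
move=> [h1 h2 h3 h4 h5].
have cc (f : V -> R) : continuous f -> continuous (fun y => k * f y).
  by move=> cf; apply: continuousM_rV => //; exact: cst_continuous.
split; [exact: cc|by move=> j; exact: cc|by move=> j; exact: cc| |] => j y.
- by have h := h4 j y; exact: is_deriveZ.
- by have h := h5 j y; exact: is_deriveZ.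
Qed.

Lemma c2D (phi : V -> R) phi1 phi2 (psi : V -> R) psi1 psi2 :
  c2 phi phi1 phi2 -> c2 psi psi1 psi2 ->
  c2 (fun y => phi y + psi y) (fun j y => phi1 j y + psi1 j y) (fun j y => phi2 j y + psi2 j y).
Proof.
move=> [h1 h2 h3 h4 h5] [k1 k2 k3 k4 k5]; split.
- by move=> y; exact: (cvgD (h1 y) (k1 y)).
- by move=> j y; exact: (cvgD (h2 j y) (k2 j y)).
- by move=> j y; exact: (cvgD (h3 j y) (k3 j y)).
- by move=> j y; have h := h4 j y; have k := k4 j y; exact: is_deriveD.
- by move=> j y; have h := h5 j y; have k := k5 j y; exact: is_deriveD.
Qed.

(** Subtracting phi(0) E makes the value at 0 and, by the mean value relation at t, the integral
    over B(0, t) vanish. The source is unchanged because E solves the homogeneous equation. Both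
    signs of the difference are then excluded. *)
Lemma darboux_rigid (phi : V -> R) phi1 phi2 (t c : R) : 0 < t ->
  c2 phi phi1 phi2 ->
  mom0 phi t = phi 0 * mom0 (expdot a (e1 d)) t ->
  (forall s, 0 < s <= t ->
    mom0 (fun y => lap phi2 y - a ^+ 2 * phi y) s = c * mom0 (expdot a (e1 d)) s) ->
  c = 0.
Proof.
move=> t0 cphi phit hc.
have lphi : locb phi by apply: locb_continuous; case: cphi.
have cE := c2_expdot; have lE : locb (expdot a (e1 d : V)) by apply: locb_continuous; case: cE.
have llap := locb_continuous (continuous_lap cphi).
have key (e : R) : ~ 0 < e * c.
  have cpsi := c2D (c2Z e cphi) (c2Z (- (e * phi 0)) cE).
  apply: (darboux_pos t0 cpsi).
  - by rewrite /expdot [dotp _ _]big1 ?mulr0 ?expR0 ?mulr1 ?subrr// => i _; rewrite !mxE mulr0.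
  - rewrite mom0D ?mom0Z//; [|exact: locbZ..]; rewrite phit; ring.
  - move=> s st; rewrite -mulrA -hc// -mom0Z; last by apply: locbB => //; exact: locbZ.
    apply: eq_Rintegral => y _; congr (_ * _); rewrite /lap big_split/= -!mulr_sumr.
    by rewrite -/(lap phi2 y) -/(lap exp2 y) lap_expdot; ring.
apply/eqP; rewrite eq_le !leNgt; apply/andP; split; apply/negP => h.
- by apply: (key 1); rewrite mul1r.
- by apply: (key (- 1)); rewrite mulN1r oppr_gt0.
Qed.

End rigidity.

(** * Pairing with test functions *)

Section smooth_functions.
Context {R : realType} {d : nat} (hd : (0 < d)%N).
Local Notation V := 'rV[R]_d.
Local Notation mu := (lebesgue_rV d).
Implicit Types (f g phi : V -> R).

Lemma smooth_partial phi j : smooth phi -> smooth (partial j phi).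
Proof. by move=> sphi s; have := sphi (rcons s j); rewrite foldr_rcons. Qed.

Lemma smooth_continuous phi : smooth phi -> continuous phi.
Proof. by move=> /(_ [::])[]. Qed.

Lemma smooth_is_derive phi j x : smooth phi -> is_derive x (delta_mx 0 j) phi (partial j phi x).
Proof. by move=> /(_ [::])[_ h]; apply: derivableP; exact: h. Qed.

Definition supported_in (rho : R) phi := forall x, rho < enorm x -> phi x = 0.

Lemma enorm_continuous : continuous (enorm : V -> R).
Proof.
have -> : (enorm : V -> R) = @Num.sqrt R \o (fun x : V => dotp x x) by [].
move=> x; apply: continuous_comp; last exact: sqrt_continuous.
apply: continuous_sum_rV => // i; apply: continuousM_rV => y; exact: coord_continuous.
Qed.

Lemma supported_partial rho phi j : supported_in rho phi -> supported_in rho (partial j phi).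
Proof.
move=> sp x xr; rewrite /partial.
have [_ ->] // : is_derive x (delta_mx 0 j) phi 0.
apply: near_eq_is_derive (is_derive_cst (0 : R) x (delta_mx 0 j)).
have : \forall y \near x, rho < enorm y.
  exact: (@enorm_continuous x _ (lt_nbhsr xr)).
by apply: filterS => y yr; rewrite sp.
Qed.

Lemma supported_bcs rho phi : continuous phi -> supported_in rho phi -> bcs phi.
Proof.
move=> cphi sp; have [m b] := locb_continuous cphi; split => //.
have [M hM] := b (rho + 1); exists M, (rho + 1) => x; rewrite indE.
case: ltP => xr /=; first by rewrite mulr1 hM.
by rewrite mulr0 sp ?normr0// (lt_le_trans _ xr)// ltrDl.
Qed.

Lemma test_bcs phi rho : smooth phi -> supported_in rho phi -> bcs phi.
Proof. by move=> /smooth_continuous; exact: supported_bcs. Qed.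

(** Locally bounded partials make f locally Lipschitz: x is joined to a nearby point by moving one
    coordinate at a time. This gives continuity of [corr], whose partials are correlations again. *)
Lemma continuous_of_partials f (f1 : 'I_d -> V -> R) :
  (forall j x, is_derive x (delta_mx 0 j) f (f1 j x)) -> (forall j, locb (f1 j)) ->
  continuous f.
Proof.
move=> df lf1 x.
have [M hM] : exists M, forall j z, enorm z < enorm x + 3 -> `|f1 j z| <= M.
  have /choice[K hK] j := (lf1 j).2 (enorm x + 3).
  exists (\sum_j `|K j|) => j z zr; rewrite (le_trans (hK j z zr))//.
  by rewrite (le_trans (ler_norm _))// (bigD1 j)//= lerDl sumr_ge0.
have M0 : 0 <= M.
  by apply: le_trans (hM (Ordinal hd) x _); rewrite ?normr_ge0// ltrDl.
have step z (h : R) j : enorm z < enorm x + 1 -> `|h| < 1 ->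
    `|f (z + h *: delta_mx 0 j) - f z| <= M * `|h|.
  move=> zr h1.
  have main z' (h' : R) : enorm z' < enorm x + 3 - h' -> 0 < h' ->
      `|f (z' + h' *: delta_mx 0 j) - f z'| <= M * h'.
    move=> zr' h0; have [c /andP[c0 c1] ->] := line_mvt z' h0 (df j).
    rewrite normrM (gtr0_norm h0) ler_wpM2r ?(ltW h0)// hM//.
    by rewrite (le_lt_trans (enormD _ _))// enormZ enorm_delta mulr1 gtr0_norm//; lra.
  have [h0|h0|->] := ltgtP h 0.
  - rewrite (ltr0_norm h0) distrC.
    have := main (z + h *: delta_mx 0 j) (- h); rewrite scaleNr addrK.
    apply; last by rewrite oppr_gt0.
    rewrite opprK (le_lt_trans (enormD _ _))// enormZ enorm_delta mulr1 (ltr0_norm h0).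
    by have := h1; rewrite (ltr0_norm h0); lra.
  - by rewrite (gtr0_norm h0) main//; have := h1; rewrite (gtr0_norm h0); lra.
  - by rewrite scale0r addr0 subrr normr0 mulr0.
have path (l : seq 'I_d) (y : V) : \sum_(j <- l) `|y 0 j| < 1 ->
    `|f (x + \sum_(j <- l) y 0 j *: delta_mx 0 j) - f x| <= M * \sum_(j <- l) `|y 0 j|.
  elim: l => [|j l IH]; first by rewrite !big_nil addr0 subrr normr0 mulr0.
  rewrite !big_cons => yl; have yl' : \sum_(j <- l) `|y 0 j| < 1.
    by rewrite (le_lt_trans _ yl)// lerDr.
  set z := x + \sum_(j <- l) y 0 j *: delta_mx 0 j.
  have -> : x + (y 0 j *: delta_mx 0 j + \sum_(j <- l) y 0 j *: delta_mx 0 j) =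
     z + y 0 j *: delta_mx 0 j by rewrite /z addrCA addrC.
  have zr : enorm z < enorm x + 1.
    rewrite (le_lt_trans (enormD _ _))// ltrD2l (le_lt_trans _ yl')//.
    elim: (l) => [|k l' IHl]; first by rewrite !big_nil enorm0.
    rewrite !big_cons (le_trans (enormD _ _))// lerD// enormZ.
    by rewrite enorm_delta mulr1.
  have -> : f (z + y 0 j *: delta_mx 0 j) - f x = (f (z + y 0 j *: delta_mx 0 j) - f z) + (f z - f x).
    by rewrite addrA subrK.
  rewrite (le_trans (ler_normD _ _))// mulrDr lerD//; last exact: IH.
  by apply: step => //; rewrite (le_lt_trans _ yl)// lerDl sumr_ge0.
suff near e : 0 < e -> \forall z \near x, `|f x - f z| <= e by apply/(@cvgrPdist_le _ _ _ (nbhs x) (nbhs_filter x)).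
move=> e0.
pose k := Num.min 1 (e / (M + 1)) / (d%:R + 1).
have d1 : 0 < d%:R + 1 :> R by rewrite ltr_wpDl.
have M1 : 0 < M + 1 by rewrite ltr_wpDl.
have k0 : 0 < k by rewrite divr_gt0// lt_min ltr01 divr_gt0.
have dk : d%:R * k < Num.min 1 (e / (M + 1)).
  rewrite mulrC -mulrA gtr_pMr ?lt_min ?ltr01 ?divr_gt0//.
  by rewrite mulrC ltr_pdivrMr// mul1r ltrDl.
have /andP[dk1 dke] : (d%:R * k < 1) && (d%:R * k < e / (M + 1)) by rewrite -lt_min.
apply/nbhs_ballP; exists k => //= z [_ xz].
have zE : z = x + \sum_(j <- index_enum 'I_d) (z - x) 0 j *: delta_mx 0 j.
  have := row_sum_delta (z - x) => /= <-; by rewrite addrC subrK.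
have sk : \sum_(j <- index_enum 'I_d) `|(z - x) 0 j| <= d%:R * k.
  apply: (@le_trans _ _ (\sum_(j < d) k)); last by rewrite sumr_const card_ord mulr_natl.
  apply: ler_sum => j _; have := xz 0 j; rewrite /ball/= !mxE distrC; exact: ltW.
rewrite distrC {1}zE; apply: (le_trans (path _ _ (le_lt_trans sk dk1))).
apply: (@le_trans _ _ ((M + 1) * (d%:R * k))).
  by rewrite ler_pM ?sumr_ge0// lerDl.
by rewrite mulrC -ler_pdivlMr// ltW.
Qed.

(** f is merely measurable; its correlation with a test function inherits all derivatives from
    phi. *)
Definition corr f phi (y : V) : R := \int[mu]_x (f x * phi (x + y)).

Lemma corr_bcs f phi y : locb f -> bcs phi -> bcs (fun x => f x * phi (x + y)).
Proof.
move=> lf [mphi [M [r pM]]]; apply: (bcs_mul lf); split.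
  by apply: (measurableT_comp mphi); exact: measurable_rVD.
exists `|M|, (r + enorm y) => x; apply: (le_trans (pM _)).
apply: (le_trans (ler_wpM2r (ind_ge0 _ _) (ler_norm M))); rewrite ler_wpM2l// !indE ler_nat.
case: ltP => // xr; rewrite (_ : enorm x < _)// -[x](addrK y).
by rewrite (le_lt_trans (enormB _ _))// ltrD2r.
Qed.

Lemma corr_locb f phi : locb f -> bcs phi -> locb (corr f phi).
Proof.
move=> lf bphi; have [mf fb] := lf; have [mphi [M [r pM]]] := bphi; split.
  apply: (measurable_Rintegral (h := fun p : V * V => f p.2 * phi (p.2 + p.1))).
  apply: measurable_funM; first exact: (measurableT_comp mf measurable_snd).
  by apply: (measurableT_comp mphi); exact: measurable_rVD.
move=> s; have [K fK] := fb (r + s).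
exists (`|K| * `|M| * volume (eball (r + s) : set V)) => y ys.
apply: Rintegral_bcs_le; first exact: corr_bcs.
move=> x; rewrite normrM.
have h : `|phi (x + y)| <= `|M| * ind (r + s) x.
  apply: (le_trans (pM _)); apply: (le_trans (ler_wpM2r (ind_ge0 _ _) (ler_norm M))).
  rewrite ler_wpM2l// !indE ler_nat; case: ltP => // xr.
  rewrite (_ : enorm x < _)// -[x](addrK y).
  by rewrite (le_lt_trans (enormB _ _))// ltrD.
have [xr|xr] := ltP (enorm x) (r + s).
  rewrite -mulrA ler_pM//; by rewrite (le_trans (fK _ xr))// ler_norm.
move: h; rewrite indE ltNge xr mulr0 normr_le0 => /eqP ->.
by rewrite normr0 !mulr0.
Qed.

Lemma is_derive_corr f phi rho j y : locb f -> smooth phi -> supported_in rho phi ->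
  is_derive y (delta_mx 0 j) (corr f phi) (corr f (partial j phi) y).
Proof.
move=> lf sphi supp; set e : V := delta_mx 0 j.
have bphi := test_bcs sphi supp.
have sp1 := smooth_partial j sphi; have supp1 := supported_partial j supp.
have bphi1 := test_bcs sp1 supp1.
apply: line_is_derive.
pose h (x : R) (z : V) := f z * phi (z + (y + x *: e)).
have dh (x : R) (z : V) : is_derive x (1 : R) (fun x => h x z) (f z * partial j phi (z + (y + x *: e))).
  have dl : is_derive x (1 : R) (fun x : R => phi ((z + y) + x *: e)) (partial j phi ((z + y) + x *: e)).
    by apply: is_derive_line; exact: smooth_is_derive.
  rewrite /h; under eq_fun do rewrite addrA.
  by rewrite addrA; exact: is_deriveZ.
have [m1 [M1 [r1 hM1]]] := bphi1.
have [K hK] := lf.2 (r1 + enorm y + 1).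
pose G (z : V) := `|K| * `|M1| * ind (r1 + enorm y + 1) z.
have ih (x : R) : [set` `]-1, 1[] x -> mu.-integrable setT (EFin \o h x).
  by move=> _; apply: (bcs_integrable (f := h x)); exact: corr_bcs.
have dh1 (x : R) (z : V) : [set` `]-1, 1[] x -> setT z -> derivable (h ^~ z) x 1.
  by move=> _ _; have [] := dh x z.
have G0 z : 0 <= G z by rewrite !mulr_ge0 ?ind_ge0.
have iG : mu.-integrable setT (EFin \o G).
  by apply: (bcs_integrable (f := G)); apply: bcsZ; exact: bcs_ind.
have Gub (x : R) (z : V) : [set` `]-1, 1[] x -> setT z -> `|partial1of2 h x z| <= G z.
  rewrite /= in_itv/= => x1 _; rewrite partial1of2E; have [_ ->] := dh x z.
  have x1' : `|x| < 1 by rewrite ltr_norml.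
  rewrite normrM /G.
  have b1 : `|partial j phi (z + (y + x *: e))| <= `|M1| * ind (r1 + enorm y + 1) z.
    apply: (le_trans (hM1 _)); apply: (le_trans (ler_wpM2r (ind_ge0 _ _) (ler_norm M1))).
    rewrite ler_wpM2l// !indE ler_nat; case: ltP => // xr.
    rewrite (_ : enorm z < _)// -[z](addrK (y + x *: e)).
    rewrite (le_lt_trans (enormB _ _))// -addrA ltr_leD//.
    by rewrite (le_trans (enormD _ _))// lerD2l enormZ enorm_delta mulr1 ltW.
  have [zr|zr] := ltP (enorm z) (r1 + enorm y + 1).
    by rewrite -mulrA ler_pM// (le_trans (hK _ zr))// ler_norm.
  move: b1; rewrite indE ltNge zr mulr0 normr_le0 => /eqP ->.
  by rewrite normr0 !mulr0.
have I0 : [set` `]-1, 1[] (0 : R) by rewrite /= in_itv/= ltrN10 ltr01.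
have dI := @derivable_under_integral _ _ _ mu h setT measurableT _ _ _ I0 ih dh1 G G0 iG Gub.
have DI := @differentiation_under_integral _ _ _ mu h setT measurableT _ _ _ I0 ih dh1 G G0 iG Gub.
apply: DeriveDef; first exact: dI.
rewrite -derive1E DI; apply: eq_Rintegral => z _.
by rewrite partial1of2E; have [_ ->] := dh 0 z; rewrite scale0r addr0.
Qed.

Lemma continuous_corr f phi rho : locb f -> smooth phi -> supported_in rho phi ->
  continuous (corr f phi).
Proof.
move=> lf sphi supp; apply: (@continuous_of_partials _ (fun j => corr f (partial j phi))).
  by move=> j y; exact: is_derive_corr supp.
move=> j; apply: corr_locb => //.
by apply: (@test_bcs _ rho); [exact: smooth_partial|exact: supported_partial].
Qed.

Lemma c2_corr f phi rho : locb f -> smooth phi -> supported_in rho phi ->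
  c2 (corr f phi) (fun j => corr f (partial j phi)) (fun j => corr f (partial j (partial j phi))).
Proof.
move=> lf sp su; split.
- exact: continuous_corr su.
- by move=> j; exact: continuous_corr lf (smooth_partial j sp) (supported_partial j su).
- move=> j; have sp' := smooth_partial j sp; have su' := supported_partial j su.
  exact: continuous_corr lf (smooth_partial j sp') (supported_partial j su').
- by move=> j y; exact: is_derive_corr su.
- by move=> j y; exact: is_derive_corr lf (smooth_partial j sp) (supported_partial j su).
Qed.

End smooth_functions.

(** * Fixed points of one average are eigenfunctions *)

Section fixed_points.
Context {R : realType} {d : nat} (hd : (0 < d)%N) (a : R) (ha : 0 < a).
Context (t : R) (t0 : 0 < t).
Local Notation V := 'rV[R]_d.
Local Notation mu := (lebesgue_rV d).
Local Notation T := (nbsum a t : (V -> R) -> V -> R).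
Implicit Types (f phi : V -> R).

Lemma mom0_corr f phi s : locb f -> bcs phi ->
  mom0 (corr f phi) s = \int[mu]_x (bsum s f x * phi x).
Proof.
move=> lf bphi; rewrite (bsum_adjoint s lf bphi); have [mf fb] := lf; have [mphi [M [r pM]]] := bphi.
have [K fK] := fb (r + s); have mi := @measurable_ind R d s.
transitivity (\int[mu]_y \int[mu]_x (ind s y * (f x * phi (x + y)))).
  apply: eq_Rintegral => y _; rewrite -Rintegral_bcsZ//; exact: corr_bcs.
rewrite (@fubini_bcs _ _ _ (`|K| * `|M|) s (r + s)).
- apply: eq_Rintegral => x _.
  have lphi := bcs_locb bphi.
  have mg : measurable_fun setT (fun y : V => ind s y * phi (x - y)).
    by have [] := bsum_bcs_int s x lphi.
  rewrite /bsum -(Rintegral_reflection mg) -Rintegral_bcsZ.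
    by apply: eq_Rintegral => y _; rewrite indN opprK; ring.
  apply: bcs_eq (bcs_locb_ind s (locb_shiftD x lphi)) => y.
  by rewrite indN opprK.
- apply: measurable_funM; first exact: (measurableT_comp mi measurable_fst).
  apply: measurable_funM; first exact: (measurableT_comp mf measurable_snd).
  by apply: (measurableT_comp mphi); exact: measurable_rVD.
move=> y x; rewrite !normrM (ger0_norm (ind_ge0 _ _)).
rewrite (indE s y); have [ys|ys] := ltP (enorm y) s; last by rewrite mul0r !mulr_ge0 ?ind_ge0.
rewrite mul1r mulr1.
have h : `|phi (x + y)| <= `|M| * ind (r + s) x.
  apply: (le_trans (pM _)); apply: (le_trans (ler_wpM2r (ind_ge0 _ _) (ler_norm M))).
  rewrite ler_wpM2l// !indE ler_nat; case: ltP => // xr.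
  rewrite (_ : enorm x < _)// -[x](addrK y).
  by rewrite (le_lt_trans (enormB _ _))// ltrD.
have [xr|xr] := ltP (enorm x) (r + s).
  rewrite -mulrA ler_pM//; by rewrite (le_trans (fK _ xr))// ler_norm.
move: h; rewrite indE ltNge xr mulr0 normr_le0 => /eqP ->.
by rewrite normr0 !mulr0.
Qed.

Definition sumlap phi (x : V) : R := \sum_(j < d) partial j (partial j phi) x.

Lemma sumlap_bcs phi rho : smooth phi -> supported_in rho phi -> bcs (sumlap phi).
Proof.
move=> sp su; apply: bcs_sum => j; apply: (@test_bcs _ _ _ rho).
  by do 2 apply: smooth_partial.
by do 2 apply: supported_partial.
Qed.

Lemma bsum_at0 s f : locb f -> bsum s f 0 = mom0 f s.
Proof.
move=> lf; rewrite /bsum /mom0 -(Rintegral_reflection (bsum_bcs_int s 0 lf).1).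
by apply: eq_Rintegral => y _; rewrite indN sub0r opprK.
Qed.

Lemma kappa_mom0 s : @kappa R d a s = mom0 (expdot a (e1 d : 'rV[R]_d)) s.
Proof. by apply: bsum_at0; apply: (locb_expdot ha); rewrite (enorm_e1 hd). Qed.

Lemma fixed_eigen m f C phi rho : 0 <= C -> locb f -> (forall x, T f x = f x) ->
  dominated a (tempered_by C m) f -> smooth phi -> supported_in rho phi ->
  \int[mu]_x (f x * sumlap phi x) = a ^+ 2 * \int[mu]_x (f x * phi x).
Proof.
move=> + + + + sphi supp; have [n] := ubnP m; elim: n m f C => // n IH0 m f C.
rewrite ltnS => mn C0 lf Tf fC.
have IH f' C' : 0 <= C' -> locb f' -> (forall x, T f' x = f' x) ->
    forall m', (m' < m)%N -> dominated a (tempered_by C' m') f' ->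
    \int[mu]_x (f' x * sumlap phi x) = a ^+ 2 * \int[mu]_x (f' x * phi x).
  by move=> C'0 lf' Tf' m' mm; apply: IH0 => //; exact: leq_trans mm mn.
have bphi := test_bcs sphi supp; have bl := sumlap_bcs sphi supp.
pose D x := sumlap phi x - a ^+ 2 * phi x.
have bD : bcs D by apply: bcsB => //; exact: bcsZ.
suff : \int[mu]_x (f x * D x) = 0.
  move/eqP; rewrite (_ : \int[mu]_x (f x * D x) =
     \int[mu]_x (f x * sumlap phi x) - a ^+ 2 * \int[mu]_x (f x * phi x)) ?subr_eq0; first by move/eqP.
  rewrite -Rintegral_bcsZ; last exact: bcs_mul.
  rewrite -Rintegral_bcsB; [|exact: bcs_mul|by apply: bcsZ; exact: bcs_mul].
  by apply: eq_Rintegral => x _; rewrite /D; ring.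
(* The induction hypothesis for S_s f - f says that S_s f and f have the same pairing with D; for m
   = 0 they are equal. *)
have step s : 0 < s <= t -> \int[mu]_x (bsum s f x * D x) = @kappa R d a s * \int[mu]_x (f x * D x).
  move=> st; have /andP[s0 _] := st; have ks := kappa_gt0 hd ha s0.
  have lS : locb (nbsum a s f) by apply: locbZ; exact: bsum_locb.
  have -> : \int[mu]_x (bsum s f x * D x) = @kappa R d a s * \int[mu]_x (nbsum a s f x * D x).
    rewrite -Rintegral_bcsZ; last exact: bcs_mul.
    apply: eq_Rintegral => x _; rewrite /nbsum mulrA mulrA mulfV ?mul1r// gt_eqF//.
  clear mn; congr (_ * _); case: m IH fC => [|m] IH fC.
    by apply: eq_Rintegral => x _; rewrite (fixed_zero hd ha t0 x st C0 lf Tf fC).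
  have [lg Tg [C' C'0 gC]] := fixed_step hd ha t0 st C0 lf Tf fC.
  have h := IH _ _ C'0 lg Tg m (leqnn _) gC.
  have e (g : V -> R) : bcs g -> \int[mu]_x ((nbsum a s f x - f x) * g x) =
     \int[mu]_x (nbsum a s f x * g x) - \int[mu]_x (f x * g x).
    move=> bg; rewrite -Rintegral_bcsB; [|exact: bcs_mul..].
    by apply: eq_Rintegral => x _; rewrite mulrBl.
  move: h; rewrite !e//.
  have e' (g : V -> R) : locb g -> \int[mu]_x (g x * D x) =
     \int[mu]_x (g x * sumlap phi x) - a ^+ 2 * \int[mu]_x (g x * phi x).
    move=> lg'; rewrite -Rintegral_bcsZ; last exact: bcs_mul.
    rewrite -Rintegral_bcsB; [|exact: bcs_mul|by apply: bcsZ; exact: bcs_mul].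
    by apply: eq_Rintegral => x _; rewrite /D; ring.
  rewrite !e'//.
  move: (\int[mu]_x _) (\int[mu]_x _) (\int[mu]_x _) (\int[mu]_x _) => p q u v; lra.
have cc := c2_corr hd lf sphi supp.
have tt : 0 < t <= t by rewrite t0 lexx.
have corrT g : corr f g 0 = \int[mu]_x (f x * g x).
  by apply: eq_Rintegral => x _; rewrite addr0.
(* The constant c is the pairing <f, D>: applying sum_j d_j^2 - a^2 to [corr f phi] gives
   [corr f D], whose integral over B(0, s) is <bsum s f, D> = kappa s <f, D>. *)
apply: (darboux_rigid hd ha t0 cc).
- rewrite mom0_corr// corrT -kappa_mom0 mulrC -Rintegral_bcsZ; last exact: bcs_mul.
  apply: eq_Rintegral => x _; rewrite -[in RHS](Tf x) /nbsum mulrA mulrA mulfV ?mul1r//.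
  by rewrite gt_eqF// kappa_gt0.
- move=> s st; rewrite -kappa_mom0 mulrC -step// -mom0_corr//.
  apply: eq_Rintegral => y _; congr (_ * _).
  rewrite /lap /corr -Rintegral_bcs_sum; last first.
    move=> j; apply: corr_bcs => //; apply: (@test_bcs _ _ _ rho).
      by do 2 apply: smooth_partial.
    by do 2 apply: supported_partial.
  rewrite -Rintegral_bcsZ; last exact: corr_bcs.
  rewrite -Rintegral_bcsB.
  + by apply: eq_Rintegral => x _; rewrite -mulr_sumr /D /sumlap; ring.
  + have -> : (fun x : V => \sum_(j < d) f x * partial j (partial j phi) (x + y)) = (fun x => f x * sumlap phi (x + y)).
      by apply/funext => x; rewrite -mulr_sumr.
    exact: corr_bcs.
  + by apply: bcsZ; exact: corr_bcs.
Qed.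

End fixed_points.

(** * Complex sequences *)

Local Open Scope complex_scope.

Section complex_averages.
Context {R : realType} {d : nat} (hd : (0 < d)%N).
Local Notation V := 'rV[R]_d.
Local Notation mu := (lebesgue_rV d).
Implicit Types (p q : V -> R) (f g : V -> R[i]).

Lemma Rintegral_eball r p :
  \int[mu]_(x in (eball r : set V)) p x = \int[mu]_x (ind r x * p x).
Proof.
rewrite Rintegral_mkcond; apply: eq_Rintegral => x _.
rewrite patchE indE (_ : (x \in _) = (enorm x < r)); last by apply/idP/idP; rewrite inE.
by case: ltP => _; rewrite ?mul1r ?mul0r.
Qed.

Lemma cexpE (u v : R) : cexp (u +i* v) = (expR u * cos v) +i* (expR u * sin v).
Proof. by rewrite /cexp; simpc. Qed.

Lemma complex_ReIm (z : R[i]) : z = complex.Re z +i* complex.Im z.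
Proof. by case: z. Qed.

Lemma norm_complex (z : R[i]) : `|z| = (Normc.normc z)%:C.
Proof. by []. Qed.

(** As - i (i a) = a, the integrand is a real exponential, and dilation by t carries the unit ball
    to B(0, t). *)
Lemma psi_imaginary (a t : R) : 0 < a -> 0 < t ->
  psi ('i%C * a%:C) (t *: e1 d : V) = (@kappa R d a t / volume (eball t : set V))%:C.
Proof.
move=> a0 t0; rewrite /psi /cintegral.
have E (y : V) : cexp (- 'i%C * ('i%C * a%:C) * (dotp (t *: e1 d) y)%:C) =
    (expR (a * (t * dotp (e1 d) y)))%:C.
  rewrite dotpZl (_ : - 'i%C * _ * _ = (a * (t * dotp (e1 d) y)) +i* 0); last first.
    by apply/eqP; rewrite eq_complex /=; apply/andP; split; apply/eqP; ring.
  by rewrite cexpE cos0 sin0 mulr1 mulr0.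
have -> : \int[mu]_(x in eball 1) complex.Re (cexp (- 'i%C * ('i%C * a%:C) * (dotp (t *: e1 d) x)%:C)) =
   t ^- d * @kappa R d a t.
  have le1 : locb (expdot a (e1 d : V)) by apply: (locb_expdot a0); rewrite (enorm_e1 hd).
  rewrite (kappa_mom0 hd a0) /mom0 -Rintegral_scaling//; last exact: bcs_locb_ind.
  rewrite Rintegral_eball; apply: eq_Rintegral => y _; rewrite E /=.
  by rewrite /expdot dotpZr !indE enormZ gtr0_norm// gtr_pMr.
have -> : \int[mu]_(x in eball 1) complex.Im (cexp (- 'i%C * ('i%C * a%:C) * (dotp (t *: e1 d) x)%:C)) = 0.
  rewrite Rintegral_eball (_ : (fun x : V => _) = (fun x => 0 * ind 1 x)).
    by rewrite Rintegral_bcsZ ?mul0r//; exact: bcs_ind.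
  by apply/funext => y; rewrite E /= mulr0 mul0r.
simpc; congr (_%:C).
have v0 : volume (eball 1 : set V) != 0 by rewrite gt_eqF ?volume_gt0.
rewrite (volume_eball t0); field.
by rewrite v0 /= expf_neq0// gt_eqF.
Qed.

(** f itself may fail to be Borel measurable, so passing to the representatives rests on
    [ae_eq_Rintegral_any]. *)
Lemma ball_average_ae t f p q x : ae_equal f (fun y => p y +i* q y) ->
  measurable_fun setT p -> measurable_fun setT q ->
  ball_average t f x = ((volume (eball t : set V))^-1)%:C * (bsum t p x +i* bsum t q x).
Proof.
move=> fpq mp mq; rewrite /ball_average /convolution /cintegral; congr (_ * _).
rewrite !bsumE//; congr (_ +i* _); apply: ae_eq_Rintegral_any;
  by move: fpq; apply: filterS => y ->; rewrite /ind; simpc.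
Qed.

Lemma bsum_ae t p q x : ae_eq mu setT p q -> measurable_fun setT p -> measurable_fun setT q ->
  bsum t p x = bsum t q x.
Proof.
move=> pq mp mq; rewrite !bsumE//; apply: ae_eq_Rintegral_any.
by move: pq; apply: filterS => y /= ->.
Qed.

End complex_averages.

(** * From complex sequences to real orbits *)

Section reduction.
Context {R : realType} {d : nat} (hd : (0 < d)%N) (a : R) (ha : 0 < a).
Context (t : R) (t0 : 0 < t).
Local Notation V := 'rV[R]_d.
Local Notation mu := (lebesgue_rV d).
Local Notation vol := (volume (eball t : set V)).
Local Notation kap := (@kappa R d a t).
Implicit Types (p q w : V -> R) (f g : V -> R[i]).

Lemma measurable_truncation p w : measurable_fun setT p -> measurable_fun setT w ->
  measurable_fun setT (fun x => if `|p x| <= w x then p x else 0).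
Proof.
move=> mp mw; apply: measurable_fun_ifT => //.
by apply: measurable_fun_ler => //; exact: measurableT_comp.
Qed.

Lemma norm_truncation p w : (forall x, 0 <= w x) ->
  forall x, `|if `|p x| <= w x then p x else 0| <= w x.
Proof. by move=> w0 x; case: ifP => //; rewrite normr0. Qed.

Lemma Re_le_normc (z : R[i]) : `|complex.Re z| <= Normc.normc z.
Proof. by rewrite -lecR; exact: normc_ge_Re. Qed.

Lemma Im_le_normc (z : R[i]) : `|complex.Im z| <= Normc.normc z.
Proof.
have := Re_le_normc (z * 'i%C); rewrite ReiNIm normrN; move/le_trans; apply.
by rewrite Normc.normcM /= expr0n expr1n add0r sqrtr1 mulr1.
Qed.

Lemma normc_exprz (c : R[i]) (k : int) : Normc.normc c = 1 -> Normc.normc (c ^ k) = 1.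
Proof.
move=> c1; apply: complexI; rewrite -norm_complex; case: k => n.
  by rewrite -exprnP normrX norm_complex c1 expr1n.
by rewrite NegzE -exprnN normfV normrX norm_complex c1 expr1n invr1.
Qed.

(** A Borel representative inherits the bound only almost everywhere; setting its parts to 0 where
    the bound fails makes it hold at every point. *)
Lemma bounded_representative f w : lebesgue_measurable f -> measurable_fun setT w ->
  (forall x, `|f x| <= (w x)%:C) ->
  exists p q, [/\ measurable_fun setT p, measurable_fun setT q,
    forall x, `|p x| <= w x, forall x, `|q x| <= w x & ae_equal f (fun x => p x +i* q x)].
Proof.
move=> [g [mr mi] fg] mw fw.
have w0 x : 0 <= w x by rewrite -ler0c (le_trans _ (fw x)).
pose tr (u : V -> R) x := if `|u x| <= w x then u x else 0.
exists (tr (fun x => complex.Re (g x))), (tr (fun x => complex.Im (g x))); split.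
- exact: measurable_truncation.
- exact: measurable_truncation.
- exact: norm_truncation.
- exact: norm_truncation.
move: fg; apply: filterS => x fgx; have := fw x; rewrite fgx norm_complex lecR => gw.
rewrite /tr (le_trans (Re_le_normc _) gw) (le_trans (Im_le_normc _) gw).
exact: complex_ReIm.
Qed.

Lemma measurable_expnorm M : measurable_fun setT (fun x : V => M * expR (a * enorm x)).
Proof.
apply: measurable_funM => //; apply: measurableT_comp; first exact: measurable_expR.
by apply: measurable_funM => //; exact: measurable_enorm.
Qed.

Lemma exp_locb M p : measurable_fun setT p -> (forall x, `|p x| <= M * expR (a * enorm x)) -> locb p.
Proof.
move=> mp pM; split=> // r; exists (`|M| * expR (a * r)) => x xr.
rewrite (le_trans (pM x))// (le_trans (ler_wpM2r (expR_ge0 _) (ler_norm M)))//.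
by rewrite ler_wpM2l// ler_expR ler_pM2l// ltW.
Qed.

Definition orbit_with (l M : R) (r : int -> V -> R) := [/\ forall k, locb (r k),
  forall k x, nbsum a t (r k) x = l * r (k + 1) x &
  forall k x, `|r k x| <= M * expR (a * enorm x)].

(** An average depends only on the class of its argument modulo null sets. Replacing r_k by the
    rescaled average of r_(k-1) therefore alters it on a null set and makes the relation hold
    everywhere, at the cost of exp(a t) / c in the bound. *)
Lemma everywhere_orbit (r : int -> V -> R) (K c : R) : 0 < c -> 0 <= K ->
  (forall k, measurable_fun setT (r k)) ->
  (forall k x, `|r k x| <= K * expR (a * enorm x)) ->
  (forall k, ae_eq mu setT (bsum t (r k)) (fun x => vol * c * r (k + 1) x)) ->
  exists2 r', orbit_with (c * vol / kap) (K * expR (a * t) / c) r' & ae_eq mu setT (r 0) (r' 0).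
Proof.
move=> c0 K0 mr rK rT; have v0 : 0 < vol by rewrite volume_gt0.
have k0 := kappa_gt0 hd ha t0.
have lr k : locb (r k) by apply: exp_locb (rK k).
have vc : 0 < vol * c by rewrite mulr_gt0.
pose r' (k : int) x := (vol * c)^-1 * bsum t (r (k - 1)) x.
have lr' k : locb (r' k) by apply: locbZ; exact: bsum_locb.
have rr' k : ae_eq mu setT (r k) (r' k).
  have := rT (k - 1); apply: filterS => x /= h _.
  by rewrite /r' h// subrK mulrA mulVf ?mul1r// gt_eqF.
exists r' => //; split=> // k x.
  rewrite /nbsum -(bsum_ae t x (rr' k)) => //; last by have [] := lr' k.
  rewrite /r' addrK; move: (bsum t (r k) x) => b; field.
  by rewrite !gt_eqF.
rewrite /r' normrM gtr0_norm ?invr_gt0// ler_pdivrMl//.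
apply: (@le_trans _ _ (K * expR (a * (enorm x + t)) * vol)).
  apply: Rintegral_bcs_le; first exact: bsum_bcs_int.
  move=> y; apply: ind_norm_mul => yt; rewrite (le_trans (rK _ _))// ler_wpM2l//.
  by rewrite ler_expR ler_pM2l// (le_trans (enormB _ _))// lerD2l ltW.
rewrite le_eqVlt; apply/orP; left; apply/eqP; rewrite mulrDr expRD.
by move: (expR _) (expR _) => u v; field; rewrite gt_eqF.
Qed.

Lemma admissible_orbit (f : int -> V -> R[i]) (M : R) (A : R[i]) : A != 0 -> 0 <= M ->
  (forall k, lebesgue_measurable (f k)) ->
  (forall k, ae_equal (ball_average t (f k)) (fun x => A * f (k + 1) x)) ->
  (forall k x, `|f k x| <= (M * expR (a * enorm x))%:C) ->
  exists (M' : R) (r q : int -> V -> R), [/\ 0 <= M', orbit_with (Normc.normc A * vol / kap) M' r,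
    orbit_with (Normc.normc A * vol / kap) M' q & ae_equal (f 0) (fun x => r 0 x +i* q 0 x)].
Proof.
move=> A0 M0 mf fT fM; set c := Normc.normc A.
have v0 : 0 < vol by rewrite volume_gt0.
have c0 : 0 < c.
  by rewrite -ltcR /c -norm_complex normr_gt0.
have /choice[pq pqP] : forall k, exists pq : (V -> R) * (V -> R),
    [/\ measurable_fun setT pq.1, measurable_fun setT pq.2,
    forall x, `|pq.1 x| <= M * expR (a * enorm x),
    forall x, `|pq.2 x| <= M * expR (a * enorm x) &
    ae_equal (f k) (fun x => pq.1 x +i* pq.2 x)].
  move=> k; have [p [q [h1 h2 h3 h4 h5]]] := bounded_representative (mf k) (measurable_expnorm M) (fM k).
  by exists (p, q).
(* For h_k = u^k f_k the factor A becomes the real number |A|, so real and imaginary parts satisfy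
   separate relations. *)
pose u : R[i] := A / c%:C.
have cC : c%:C != 0 by rewrite gt_eqF// ltcR.
have u1 : Normc.normc u = 1.
  apply: complexI; rewrite -norm_complex normrM normfV norm_complex -/c.
  by rewrite norm_complex /= expr0n addr0 sqrtr_sqr gtr0_norm// mulfV.
have uk1 (k : int) : Normc.normc (u ^ k) = 1 by exact: normc_exprz.
have u0 : u != 0 by rewrite mulf_neq0// invr_eq0.
pose al (k : int) := complex.Re (u ^ k); pose be (k : int) := complex.Im (u ^ k).
pose p k := (pq k).1; pose q k := (pq k).2.
pose h (k : int) x : R[i] := u ^ k * (p k x +i* q k x).
pose r k x := al k * p k x - be k * q k x.
pose s k x := al k * q k x + be k * p k x.
have hE k x : h k x = r k x +i* s k x.
  by rewrite /h [u ^ k]complex_ReIm /r /s; simpc; rewrite -/(al k) -/(be k).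
have mp k : measurable_fun setT (p k) by have [] := pqP k.
have mq k : measurable_fun setT (q k) by have [] := pqP k.
have pM k x : `|p k x| <= M * expR (a * enorm x) by have [_ _ + _ _] := pqP k; exact.
have qM k x : `|q k x| <= M * expR (a * enorm x) by have [_ _ _ + _] := pqP k; exact.
have lp k : locb (p k) := exp_locb (mp k) (pM k).
have lq k : locb (q k) := exp_locb (mq k) (qM k).
have al1 k : `|al k| <= 1 by rewrite -(uk1 k) Re_le_normc.
have be1 k : `|be k| <= 1 by rewrite -(uk1 k) Im_le_normc.
have avg k : {ae mu, forall x, bsum t (r k) x +i* bsum t (s k) x =
    (vol * c)%:C * (r (k + 1) x +i* s (k + 1) x)}.
  have [_ _ _ _ fk] := pqP k; have [_ _ _ _ fk1] := pqP (k + 1).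
  have := fT k; move: fk1; apply: filterS2 => x /= fx1.
  rewrite (ball_average_ae t x fk (mp k) (mq k)) fx1 => e; rewrite -hE /h exprzDr ?unitfE// expr1z.
  have -> : bsum t (r k) x +i* bsum t (s k) x = u ^ k * (bsum t (p k) x +i* bsum t (q k) x).
    rewrite /r /s bsumB ?bsumD ?bsumZ//; try by apply: locbZ.
    by rewrite [u ^ k]complex_ReIm; simpc; rewrite -/(al k) -/(be k).
  have -> : bsum t (p k) x +i* bsum t (q k) x = vol%:C * (A * (p (k + 1) x +i* q (k + 1) x)).
    by rewrite -e mulrA -rmorphM/= mulfV ?gt_eqF// mul1r.
  have -> : A = u * c%:C by rewrite /u mulfVK.
  by rewrite rmorphM/=; ring.
have rM k x : `|r k x| <= 2 * M * expR (a * enorm x).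
  rewrite (le_trans (ler_normB _ _))// !normrM.
  have E0 := expR_ge0 (a * enorm x).
  have h1 : `|al k| * `|p k x| <= 1 * (M * expR (a * enorm x)) by apply: ler_pM.
  have h2 : `|be k| * `|q k x| <= 1 * (M * expR (a * enorm x)) by apply: ler_pM.
  lra.
have sM k x : `|s k x| <= 2 * M * expR (a * enorm x).
  rewrite (le_trans (ler_normD _ _))// !normrM.
  have h1 : `|al k| * `|q k x| <= 1 * (M * expR (a * enorm x)) by apply: ler_pM.
  have h2 : `|be k| * `|p k x| <= 1 * (M * expR (a * enorm x)) by apply: ler_pM.
  lra.
have M20 : 0 <= 2 * M by rewrite mulr_ge0.
have [| |r' or' rr'] := everywhere_orbit c0 M20 _ rM.
- by move=> k; apply: measurable_funB; exact: measurable_funM.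
- move=> k; apply: filterS (avg k) => x + _.
  by move/(congr1 (@complex.Re R)); simpc.
have [| |s' os' ss'] := everywhere_orbit c0 M20 _ sM.
- by move=> k; apply: measurable_funD; exact: measurable_funM.
- move=> k; apply: filterS (avg k) => x + _.
  by move/(congr1 (@complex.Im R)); simpc.
exists (2 * M * expR (a * t) / c), r', s'; split=> //.
  by rewrite divr_ge0 ?mulr_ge0 ?expR_ge0 ?(ltW c0).
have [_ _ _ _ f0] := pqP 0; move: f0 rr' ss'; apply: filterS3 => x -> /= <-// <-//.
by rewrite -hE /h expr0z mul1r.
Qed.

End reduction.

(** * The critical and supercritical cases *)

Section eigenfunctions.
Context {R : realType} {d : nat} (hd : (0 < d)%N) (a : R) (ha : 0 < a).
Context (t : R) (t0 : 0 < t).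
Local Notation V := 'rV[R]_d.
Local Notation mu := (lebesgue_rV d).
Local Notation vol := (volume (eball t : set V)).
Local Notation kap := (@kappa R d a t).
Implicit Types (p q : V -> R) (f g : V -> R[i]).

Lemma coord_le_norm (x : V) i : `|x 0 i| <= `|x|.
Proof.
rewrite [`|x|]mx_normrE.
exact: (le_bigmax _ (fun ij : 'I_1 * 'I_d => `|x ij.1 ij.2|) (0, i)).
Qed.

Lemma test_function_supported (phi : V -> R[i]) : test_function phi ->
  exists rho, supported_in rho (fun x => complex.Re (phi x)) /\
              supported_in rho (fun x => complex.Im (phi x)).
Proof.
move=> [_ _ /compact_bounded[M [_ MK]]].
have h x : d%:R * (`|M| + 1) < enorm x -> phi x = 0.
  move=> xM; apply/eqP/negPn/negP => px.
  have M1 : M < `|M| + 1 by rewrite (le_lt_trans (ler_norm M))// ltrDl.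
  have xle : `|x| <= `|M| + 1 := MK _ M1 x (@subset_closure _ [set y | phi y != 0] x px).
  move: xM; rewrite ltNge => /negP; apply.
  by apply: enorm_le_coord => [|i]; rewrite ?addr_ge0// (le_trans _ xle)// coord_le_norm.
by exists (d%:R * (`|M| + 1)); split=> x /h ->.
Qed.

Lemma claplacianE (phi : V -> R[i]) x : claplacian phi x =
  -1 * sumlap (fun y => complex.Re (phi y)) x +i* (-1 * sumlap (fun y => complex.Im (phi y)) x).
Proof. by congr (_ +i* _); exact/esym/mulN1r. Qed.

(** The real factor k serves both sides of the eigenvalue equation: k = -1 for the Laplacian with
    its sign, k = -c for the eigenvalue. *)
Lemma cintegral_pairing f g p q u v k : ae_equal f (fun x => p x +i* q x) ->
  (forall x, g x = (k * u x) +i* (k * v x)) -> locb p -> locb q -> bcs u -> bcs v ->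
  cintegral setT (fun x => f x * g x) =
  (k * (\int[mu]_x (p x * u x) - \int[mu]_x (q x * v x))) +i*
  (k * (\int[mu]_x (p x * v x) + \int[mu]_x (q x * u x))).
Proof.
move=> fpq guv lp lq bu bv; rewrite /cintegral; congr (_ +i* _).
  rewrite -(Rintegral_bcsB (bcs_mul lp bu) (bcs_mul lq bv)).
  rewrite -(Rintegral_bcsZ _ (bcsB (bcs_mul lp bu) (bcs_mul lq bv))).
  apply: ae_eq_Rintegral_any; apply: filterS fpq => x ->.
  by rewrite guv /=; ring.
rewrite -(Rintegral_bcsD (bcs_mul lp bv) (bcs_mul lq bu)).
rewrite -(Rintegral_bcsZ _ (bcsD (bcs_mul lp bv) (bcs_mul lq bu))).
apply: ae_eq_Rintegral_any; apply: filterS fpq => x ->.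
by rewrite guv /=; ring.
Qed.

Definition real_eigen c p := forall phi rho, smooth phi -> supported_in rho phi ->
  \int[mu]_x (p x * sumlap phi x) = c * \int[mu]_x (p x * phi x).

Lemma laplacian_eigen_real f p q c : ae_equal f (fun x => p x +i* q x) ->
  locb p -> locb q -> real_eigen c p -> real_eigen c q -> laplacian_eigen f (- c%:C).
Proof.
move=> fpq lp lq ep eq phi tphi; have [rho [sr si]] := test_function_supported tphi.
have [pr pi _] := tphi.
have br := sumlap_bcs pr sr; have bi := sumlap_bcs pi si.
have b1 := test_bcs pr sr; have b2 := test_bcs pi si.
rewrite (cintegral_pairing fpq (claplacianE phi) lp lq br bi).
have -> : (fun x => - c%:C * f x * phi x) = (fun x => f x * (- c%:C * phi x)).
  by apply/funext => x; ring.
have muphi x : - c%:C * phi x = (- c * complex.Re (phi x)) +i* (- c * complex.Im (phi x)).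
  by case: (phi x) => u v; simpc.
rewrite (cintegral_pairing fpq muphi lp lq b1 b2).
have lin (x1 x2 x3 x4 y1 y2 y3 y4 : R) : x1 = c * y1 -> x2 = c * y2 -> x3 = c * y3 -> x4 = c * y4 ->
    (-1 * (x1 - x2)) +i* (-1 * (x3 + x4)) = (- c * (y1 - y2)) +i* (- c * (y3 + y4)).
  by move=> -> -> -> ->; congr (_ +i* _); ring.
exact: (lin _ _ _ _ _ _ _ _ (ep _ _ pr sr) (eq _ _ pi si) (ep _ _ pi si) (eq _ _ pr sr)).
Qed.

Lemma critical_eigen (f : int -> V -> R[i]) (M : R) (A : R[i]) : 0 <= M ->
  `|A| = psi ('i%C * a%:C) (t *: e1 d : V) ->
  (forall k, lebesgue_measurable (f k)) ->
  (forall k, ae_equal (ball_average t (f k)) (fun x => A * f (k + 1) x)) ->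
  (forall k x, `|f k x| <= (M * expR (a * enorm x))%:C) ->
  laplacian_eigen (f 0) (- (a ^+ 2)%:C).
Proof.
move=> M0; rewrite (psi_imaginary hd ha t0) norm_complex => /complexI cA mf fT fM.
have v0 : 0 < vol by rewrite volume_gt0.
have k0 := kappa_gt0 hd ha t0.
have A0 : A != 0.
  by rewrite -normr_gt0 norm_complex cA ltcR divr_gt0.
have [M' [r [q [M'0 [lr rT rM] [lq qT qM] f0]]]] := admissible_orbit hd ha t0 A0 M0 mf fT fM.
have l1 : Normc.normc A * vol / kap = 1 by rewrite cA; field; rewrite !gt_eqF.
have fixed (s : int -> V -> R) : (forall k, locb (s k)) ->
   (forall k x, nbsum a t (s k) x = Normc.normc A * vol / kap * s (k + 1) x) ->
   (forall k x, `|s k x| <= M' * expR (a * enorm x)) -> real_eigen (a ^+ 2) (s 0).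
  move=> ls sT sM phi rho sphi su.
  have orb : orbit_seq a t s by split=> // k x; rewrite sT l1 mul1r.
  have tmp := exp_tempered hd ha M'0 sM.
  have [C C0 sC] := tmp.
  apply: (fixed_eigen hd ha t0 C0 (ls 0) _ (sC 0) sphi su) => x.
  by have [_ ->] := orb; exact: (orbit_fixed hd ha t0 orb tmp).
exact: laplacian_eigen_real f0 (lr 0) (lq 0) (fixed r lr rT rM) (fixed q lq qT qM).
Qed.

Lemma supercritical_vanish (f : int -> V -> R[i]) (M : R) (A : R[i]) : 0 <= M ->
  psi ('i%C * a%:C) (t *: e1 d : V) < `|A| ->
  (forall k, lebesgue_measurable (f k)) ->
  (forall k, ae_equal (ball_average t (f k)) (fun x => A * f (k + 1) x)) ->
  (forall k x, `|f k x| <= (M * expR (a * enorm x))%:C) ->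
  ae_equal (f 0) (fun=> 0).
Proof.
move=> M0; rewrite (psi_imaginary hd ha t0) norm_complex ltcR => cA mf fT fM.
have v0 : 0 < vol by rewrite volume_gt0.
have k0 := kappa_gt0 hd ha t0.
have A0 : A != 0.
  by rewrite -normr_gt0 norm_complex ltcR (lt_trans _ cA)// divr_gt0.
have [M' [r [q [M'0 [lr rT rM] [lq qT qM] f0]]]] := admissible_orbit hd ha t0 A0 M0 mf fT fM.
have l1 : 1 < Normc.normc A * vol / kap by rewrite ltr_pdivlMr// mul1r -ltr_pdivrMr.
apply: filterS f0 => x ->.
by rewrite (orbit_vanish hd ha t0 l1 M'0 lr rT rM) (orbit_vanish hd ha t0 l1 M'0 lq qT qM).
Qed.

End eigenfunctions.

(** * Zeros of the cosine transform *)

Section oscillation.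
Context {R : realType}.
(** The system satisfied by p = [mom0 g] and q = [mom1 g] in dimension n when the pure second
    derivatives of g sum to -g. *)
Variables (p q : R -> R) (n s0 : R).
Hypothesis dp : forall s : R, 0 < s -> is_derive s (1 : R) p (n / s * p s - q s / (2 * s)).
Hypothesis dq : forall s : R, 0 < s -> is_derive s (1 : R) q (2 * s * p s).
Hypotheses (s00 : 0 < s0) (n0 : 0 <= n) (ns0 : n <= s0).

(* Sturm comparison with [sin ((s - s0) / 2)]: the exponent of the weight [eta]
   makes the derivative of the Wronskian a multiple of [p]. *)
Lemma sturm_wronskian (s : R) : 0 < s ->
  let y (x : R) := sin ((x - s0) / 2) in
  let y' (x : R) := cos ((x - s0) / 2) / 2 in
  let eta (x : R) := expR ((1 - n) / 2 * ln x) in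
  is_derive s (1 : R) (fun x => eta x * (p x * y' x + q x * y x / (2 * x) - (n + 1) * (p x * y x) / (2 * x)))
    (eta s * (p s * y s) * (3 / 4 - (n ^+ 2 - 1) / (4 * s ^+ 2))).
Proof.
move=> s_gt0 y y' eta; have hp := dp s_gt0; have hq := dq s_gt0.
have sn : s != 0 by rewrite gt_eqF.
have hl : is_derive s (1 : R) (fun x : R => (x - s0) / 2) (2^-1).
  have -> : (fun x : R => (x - s0) / 2) = (fun x : R => 2^-1 *: (x - s0)).
    by apply/funext => x; rewrite mulrC.
  have h0 := is_derive_id s (1 : R); have h1 := is_derive_cst s0 s (1 : R).
  have h2 := is_deriveB h0 h1.
  by apply: is_derive_eq (is_deriveZ 2^-1 h2) _; rewrite /GRing.scale/= subr0 mulr1.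
have hy : is_derive s (1 : R) y (y' s).
  by apply: is_derive_eq (is_derive1_comp (is_derive_sin _) hl) _.
have hy' : is_derive s (1 : R) y' (- y s / 4).
  have hc : is_derive s (1 : R) (fun x : R => cos ((x - s0) / 2)) (- sin ((s - s0) / 2) * 2^-1).
    exact: (is_derive1_comp (is_derive_cos _) hl).
  have -> : y' = (fun x : R => 2^-1 *: cos ((x - s0) / 2)).
    by apply/funext => x; rewrite /y' mulrC.
  by apply: is_derive_eq (is_deriveZ 2^-1 hc) _; rewrite /GRing.scale/= /y; field.
have hr : is_derive s (1 : R) (fun x : R => (2 * x)^-1) (- (2 * s ^+ 2)^-1).
  have h2 : is_derive s (1 : R) (fun x : R => 2 * x) 2.
    by apply: is_derive_eq (is_deriveZ 2 (is_derive_id s (1 : R))) _; rewrite /GRing.scale/= mulr1.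
  apply: is_derive_eq (@is_deriveV _ (fun x : R => 2 * x) _ _ _ _ h2) _.
    by rewrite mulf_neq0.
  have e (w : R) : w != 0 -> - (2 * w) ^- 2 * 2 = - (2 * w ^+ 2)^-1 by move=> w0; field; rewrite ?w0 ?sn.
  exact: e.
have he : is_derive s (1 : R) eta (eta s * ((1 - n) / 2 / s)).
  have h2 : is_derive s (1 : R) (fun x : R => (1 - n) / 2 * ln x) ((1 - n) / 2 / s).
    exact: (is_deriveZ ((1 - n) / 2) (is_derive1_ln s_gt0)).
  exact: (is_derive1_comp (is_derive_expR _) h2).
have h1 := is_deriveM hp hy'.
have h2 := is_deriveM (is_deriveM hq hy) hr.
have hpy : is_derive s (1 : R) (fun x => (n + 1) * (p x * y x))
    ((n + 1) * (p s * y' s + y s * (n / s * p s - q s / (2 * s)))).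
  exact: (is_deriveZ (n + 1) (is_deriveM hp hy)).
have h3 := is_deriveM hpy hr.
apply: is_derive_eq (is_deriveM he (is_deriveB (is_deriveD h1 h2) h3)) _.
rewrite /GRing.scale/= !fctE.
move: (eta s) (p s) (q s) (y s) (y' s) => E P Q Y Y'. field.
exact: sn.
Qed.

(** y vanishes at both ends and is nonnegative between them, with slopes 1/2 and -1/2. For positive
    p the Wronskian would be positive at the left end and negative at the right one, although its
    derivative is nonnegative. *)
Lemma sturm_not_positive : ~ forall s, s0 <= s <= s0 + 2 * pi -> 0 < p s.
Proof.
move=> p0; have pi0 := pi_gt0 R; have s01 : s0 < s0 + 2 * pi by rewrite ltrDl mulr_gt0.
pose y (x : R) := sin ((x - s0) / 2); pose y' (x : R) := cos ((x - s0) / 2) / 2.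
pose eta (x : R) := expR ((1 - n) / 2 * ln x).
pose W x := eta x * (p x * y' x + q x * y x / (2 * x) - (n + 1) * (p x * y x) / (2 * x)).
have dW (x : R) : 0 < x -> is_derive x (1 : R) W
    (eta x * (p x * y x) * (3 / 4 - (n ^+ 2 - 1) / (4 * x ^+ 2))) := @sturm_wronskian x.
have cW : {within `[s0, s0 + 2 * pi], continuous W}.
  apply: derivable_within_continuous => x; rewrite in_itv/= => /andP[s0x _].
  by have [] := dW x (lt_le_trans s00 s0x).
have dW' x : x \in `]s0, s0 + 2 * pi[ -> is_derive x (1 : R) W
    (eta x * (p x * y x) * (3 / 4 - (n ^+ 2 - 1) / (4 * x ^+ 2))).
  by rewrite in_itv/= => /andP[s0x _]; apply: dW; exact: lt_trans s0x.
have [z] := MVT s01 dW' cW.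
rewrite in_itv/= => /andP[z1 z2] E.
have y0 : y s0 = 0 by rewrite /y subrr mul0r sin0.
have yE : (s0 + 2 * pi - s0) / 2 = pi :> R by field.
have y1 : y (s0 + 2 * pi) = 0 by rewrite /y yE sinpi.
have y'0 : y' s0 = 2^-1 by rewrite /y' subrr mul0r cos0 mul1r.
have y'1 : y' (s0 + 2 * pi) = - 2^-1 by rewrite /y' yE cospi mulN1r.
have W0 : 0 < W s0.
  by rewrite /W y0 y'0 !(mulr0, mul0r) addr0 subr0 mulr_gt0 ?expR_gt0// mulr_gt0// p0 ?lexx ?(ltW s01).
have W1 : W (s0 + 2 * pi) < 0.
  rewrite /W y1 y'1 !(mulr0, mul0r) addr0 subr0 pmulr_rlt0 ?expR_gt0// pmulr_rlt0 ?oppr_lt0 ?invr_gt0//.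
  by rewrite p0 ?lexx ?(ltW s01).
have : 0 <= W (s0 + 2 * pi) - W s0.
  rewrite E mulr_ge0 ?subr_ge0 ?(ltW s01)//.
  have z0 : 0 < z by exact: lt_trans z1.
  rewrite mulr_ge0//; last first.
    rewrite subr_ge0 ler_pdivrMr ?mulr_gt0 ?exprn_gt0//.
    (* As n <= s0 < z, the subtracted term is below 1/4; this is why the interval starts beyond
       n. *)
    have : n ^+ 2 <= z ^+ 2 by rewrite lerXn2r ?nnegrE ?(ltW z0)// (le_trans ns0)// ltW.
    have : 0 <= z ^+ 2 by rewrite sqr_ge0.
    lra.
  rewrite mulr_ge0 ?expR_ge0// mulr_ge0//.
    by rewrite ltW// p0// (ltW z1) (ltW z2).
  apply: sin_ge0_pi; rewrite divr_ge0 ?subr_ge0 ?(ltW z1)//=.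
  by rewrite ler_pdivrMr// mulrC lerBlDl ltW.
lra.
Qed.

End oscillation.

Lemma oscillation_zero {R : realType} (p q : R -> R) (n s0 : R) :
  (forall s : R, 0 < s -> is_derive s (1 : R) p (n / s * p s - q s / (2 * s))) ->
  (forall s : R, 0 < s -> is_derive s (1 : R) q (2 * s * p s)) ->
  0 < s0 -> 0 <= n <= s0 -> exists2 s, s0 <= s <= s0 + 2 * pi & p s = 0.
Proof.
move=> dp dq s00 /andP[n0 ns0]; apply: contrapT => noz.
have pz s : s0 <= s <= s0 + 2 * pi -> p s != 0.
  by move=> hs; apply/negP => /eqP ps; apply: noz; exists s.
have cp x y : 0 < x -> {within `[x, y], continuous p}.
  move=> x0; apply: derivable_within_continuous => z; rewrite in_itv/= => /andP[xz _].
  by have [] := dp z (lt_le_trans x0 xz).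
have pi0 := pi_gt0 R.
have zero_between s : s0 <= s <= s0 + 2 * pi -> Num.min (p s0) (p s) <= 0 <= Num.max (p s0) (p s) -> False.
  move=> /andP[ss s1] h; have [c] := IVT ss (cp _ _ s00) h; rewrite in_itv/= => /andP[c1 c2] /eqP.
  by apply/negP/pz; rewrite c1 (le_trans c2 s1).
have [p0|p0|/eqP p0] := ltgtP (p s0) 0; last first.
- by move: p0; apply/negP/pz; rewrite lexx lerDl mulr_ge0 ?(ltW pi0).
- apply: (sturm_not_positive dp dq s00 n0 ns0) => s hs; rewrite ltNge; apply/negP => ps.
  by apply: (zero_between s hs); rewrite ge_min le_max ps (ltW p0) orbT.
apply: (@sturm_not_positive _ (fun x => - p x) (fun x => - q x) n s0 _ _ s00 n0 ns0).
- move=> s sp; have h := dp s sp; apply: is_derive_eq (is_deriveN h) _.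
  by rewrite opprB mulrN mulNr opprK addrC.
- by move=> s sp; have h := dq s sp; apply: is_derive_eq (is_deriveN h) _; rewrite mulrN.
move=> s hs; rewrite oppr_gt0 ltNge; apply/negP => ps.
by apply: (zero_between s hs); rewrite ge_min le_max ps (ltW p0) orbT.
Qed.

Section cosine_transform.
Context {R : realType} {d : nat} (hd : (0 < d)%N).
Local Notation V := 'rV[R]_d.

Lemma cosine_zero (s0 : R) : d%:R <= s0 ->
  exists2 s, s0 <= s <= s0 + 2 * pi & mom0 (fun y : V => cos (y 0 (Ordinal hd))) s = 0.
Proof.
move=> ds0; have d0 : 0 < d%:R :> R by rewrite ltr0n.
have dc (x : R) : is_derive x (1 : R) cos (- sin x) := is_derive_cos x.
have dsn (x : R) : is_derive x (1 : R) (fun x : R => - sin x) (- cos x).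
  exact: (is_deriveN (is_derive_sin x)).
have cc : continuous (fun x : R => - cos x).
  by move=> x; apply: continuousN; exact: continuous_cos.
have hc := c2_coord hd dc dsn cc; have lc := locb_continuous (let: And5 c _ _ _ _ := hc in c).
apply: (oscillation_zero (q := mom1 (fun y : V => cos (y 0 (Ordinal hd)))) (n := d%:R)).
- move=> s s_gt0; apply: is_derive_eq (is_derive_mom0 hd hc s_gt0) _; congr (_ + _).
  rewrite -mulNr; congr (_ / _); rewrite -mulN1r -mom1Z//.
  by apply: eq_Rintegral => y _; rewrite (lap_coord hd (fun x => - cos x)) mulN1r.
- by move=> s s_gt0; exact: is_derive_mom1.
- by rewrite (lt_le_trans d0).
- by rewrite ds0 ltW.
Qed.

End cosine_transform.

(** * Exponential waves *)

Section waves.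
Context {R : realType} {d : nat} (hd : (0 < d)%N).
Local Notation V := 'rV[R]_d.
Local Notation mu := (lebesgue_rV d).
Let i0 : 'I_d := Ordinal hd.
Implicit Types (f g : V -> R[i]) (al be s t : R) (c : R[i]).

Definition wave al be (y : V) : R[i] :=
  (expR (al * y 0 i0) * cos (be * y 0 i0)) +i* (expR (al * y 0 i0) * sin (be * y 0 i0)).

Lemma waveD al be x y : wave al be (x + y) = wave al be x * wave al be y.
Proof.
rewrite /wave mxE !mulrDr expRD cosD sinD.
by apply/eqP; rewrite eq_complex/=; apply/andP; split; apply/eqP; ring.
Qed.

Lemma normc_wave al be y : Normc.normc (wave al be y) = expR (al * y 0 i0).
Proof.
rewrite /wave /= !exprMn -mulrDr cos2Dsin2 mulr1 sqrtr_sqr.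
by rewrite ger0_norm ?expR_ge0.
Qed.

Definition clocb f := locb (fun x => complex.Re (f x)) /\ locb (fun x => complex.Im (f x)).

Lemma clocbD f g : clocb f -> clocb g -> clocb (fun x => f x + g x).
Proof.
move=> [fr fi] [gr gi]; split.
  rewrite (_ : (fun x => _) = (fun x => complex.Re (f x) + complex.Re (g x))); first exact: locbD.
  by apply/funext => x; case: (f x) (g x) => u v [u' v'].
rewrite (_ : (fun x => _) = (fun x => complex.Im (f x) + complex.Im (g x))); first exact: locbD.
by apply/funext => x; case: (f x) (g x) => u v [u' v'].
Qed.

Lemma complex_ReM (z w : R[i]) : complex.Re (z * w) =
  complex.Re z * complex.Re w - complex.Im z * complex.Im w.
Proof. by case: z w => u v [u' v']. Qed.

Lemma complex_ImM (z w : R[i]) : complex.Im (z * w) =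
  complex.Re z * complex.Im w + complex.Im z * complex.Re w.
Proof. by case: z w => u v [u' v']. Qed.

Lemma clocbZ c f : clocb f -> clocb (fun x => c * f x).
Proof.
move=> [fr fi]; split.
  rewrite (_ : (fun x => _) = (fun x => complex.Re c * complex.Re (f x) - complex.Im c * complex.Im (f x))).
    by apply: locbB; exact: locbZ.
  by apply/funext => x; rewrite complex_ReM.
rewrite (_ : (fun x => _) = (fun x => complex.Re c * complex.Im (f x) + complex.Im c * complex.Re (f x))).
  by apply: locbD; exact: locbZ.
by apply/funext => x; rewrite complex_ImM.
Qed.

Lemma continuous_wave_part (h1 h2 : R -> R) al be : continuous h1 -> continuous h2 ->
  continuous (fun y : V => h1 (al * y 0 i0) * h2 (be * y 0 i0)).
Proof.
move=> c1 c2; apply: continuousM_rV.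
  apply: (continuous_coordT (h := fun x => h1 (al * x))) => x.
  by apply: (@continuous_comp _ _ _ (fun x => al * x) h1); [exact: mulrl_continuous|exact: c1].
apply: (continuous_coordT (h := fun x => h2 (be * x))) => x.
by apply: (@continuous_comp _ _ _ (fun x => be * x) h2); [exact: mulrl_continuous|exact: c2].
Qed.

Lemma clocb_wave al be : clocb (wave al be).
Proof.
split; apply: locb_continuous; apply: continuous_wave_part; try exact: continuous_expR.
  exact: continuous_cos.
exact: continuous_sin.
Qed.

Definition cbsum s f x : R[i] :=
  bsum s (fun y => complex.Re (f y)) x +i* bsum s (fun y => complex.Im (f y)) x.

Lemma cbsumD s f g x : clocb f -> clocb g ->
  cbsum s (fun y => f y + g y) x = cbsum s f x + cbsum s g x.
Proof.
move=> [fr fi] [gr gi]; rewrite /cbsum; simpc; rewrite -!bsumD//.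
by congr (_ +i* _); congr bsum; apply/funext => y; case: (f y) (g y) => u v [u' v'].
Qed.

Lemma cbsumZ s c f x : clocb f -> cbsum s (fun y => c * f y) x = c * cbsum s f x.
Proof.
move=> [fr fi]; rewrite /cbsum [in RHS](complex_ReIm c); simpc; rewrite -!bsumZ// -bsumB -?bsumD; try exact: locbZ.
by congr (_ +i* _); congr bsum; apply/funext => y; rewrite ?complex_ReM ?complex_ImM.
Qed.

(** The eigenvalue of [cbsum s] on [wave al be], which extends [kappa] to complex exponents. *)
Definition wave_mom al be s : R[i] :=
  mom0 (fun y => complex.Re (wave al be y)) s +i* mom0 (fun y => complex.Im (wave al be y)) s.

Lemma cbsum_wave al be s x : cbsum s (wave al be) x = wave_mom al be s * wave al be x.
Proof.
have lw := clocb_wave al be.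
have [lr li] := lw; rewrite /wave_mom -!bsum_at0// mulrC -cbsumZ//.
congr (_ +i* _); apply: eq_Rintegral => y _; by rewrite waveD sub0r.
Qed.

End waves.

(** * Exponents with an average of prescribed modulus *)

Section level_sets.
Context {R : realType} {d : nat} (hd : (0 < d)%N) (a : R) (ha : 0 < a).
Context (t : R) (t0 : 0 < t).
Local Notation V := 'rV[R]_d.
Local Notation mu := (lebesgue_rV d).
Local Notation wmom := (@wave_mom R d hd).
Let i0 : 'I_d := Ordinal hd.

Lemma wave_mom_real : wmom a 0 t = (@kappa R d a t)%:C.
Proof.
rewrite /wave_mom (kappa_mom0 hd ha); congr (_ +i* _).
  by apply: eq_Rintegral => y _; rewrite /= mul0r cos0 mulr1 /expdot (dotp_e1 hd).
transitivity (0 * mom0 ((fun=> 1) : V -> R) t); last by rewrite mul0r.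
rewrite -mom0Z; last exact: locb_cst.
by apply: eq_Rintegral => y _; rewrite /= !mul0r sin0 !mulr0.
Qed.

(** The real part is a dilate of the cosine transform; the imaginary part integrates an odd function
    over a symmetric ball. *)
Lemma wave_mom_imag xi : 0 < xi ->
  mom0 (fun y : V => cos (y 0 i0)) (xi * t) = 0 -> wmom 0 xi t = 0.
Proof.
move=> xi0 h; apply/eqP; rewrite eq_complex/=; apply/andP; split; apply/eqP.
  have lc : locb (fun y : V => cos (y 0 i0)).
    by apply: locb_continuous; apply: (continuous_coordT); exact: continuous_cos.
  transitivity (xi ^- d * mom0 (fun y : V => cos (y 0 i0)) (xi * t)); last by rewrite h mulr0.
  rewrite /mom0 -Rintegral_scaling//; last exact: bcs_locb_ind.
  apply: eq_Rintegral => y _; rewrite mul0r expR0 mul1r mxE !indE enormZ gtr0_norm//.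
  by rewrite ltr_pM2l.
set I := mom0 _ _; suff : I = - I by lra.
have lw := (clocb_wave hd 0 xi).2.
rewrite {1}/I /mom0 -Rintegral_reflection; last by have [] := bcs_locb_ind t lw.
rewrite -mulN1r /I -mom0Z//; apply: eq_Rintegral => y _.
by rewrite indN mxE !mul0r mulrN sinN; ring.
Qed.

Lemma continuous_wave_mom (h : R -> R) xi tau : 0 <= tau <= 1 -> continuous h ->
  (forall x, `|h x| <= 1) ->
  {for tau, continuous (fun tau : R => mom0 (fun y : V =>
    expR ((1 - tau) * a * y 0 i0) * h (tau * xi * y 0 i0)) t)}.
Proof.
move=> tau01 ch h1.
pose f (tau : R) (y : V) := ind t y * (expR ((1 - tau) * a * y 0 i0) * h (tau * xi * y 0 i0)).
have bf (s : R) : bcs (f s).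
  apply: bcs_locb_ind; apply: locb_continuous.
  exact: (@continuous_wave_part R d hd expR h ((1 - s) * a) (s * xi) (@continuous_expR R) ch).
(* The open interval has 0 and 1 in its interior; on it |1 - s| < 2, hence the dominating constant
   exp(2 a t). *)
have I01 : tau \in (`]-1, 2[%classic : set R) by rewrite inE/= in_itv/=; lra.
have := @continuity_under_integral R _ V mu f setT measurableT (-1) 2 _ _
   (fun y => expR (2 * a * t) * ind t y) _ _ tau I01; apply.
- by move=> s _; apply: bcs_integrable.
- apply: aeW => y _ s _; rewrite /f.
  have cl (c c' : R) : continuous (fun s : R => (c * s + c') * y 0 i0).
    move=> z; apply: cvgM; last exact: cvg_cst.
    by apply: cvgD; [exact: mulrl_continuous|exact: cvg_cst].
  have cc (k : R -> R) c c' : continuous k -> continuous (fun s : R => k ((c * s + c') * y 0 i0)).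
    move=> ck z; apply: (@continuous_comp _ _ _ (fun s : R => (c * s + c') * y 0 i0) k); first exact: cl.
    exact: ck.
  have c1 : continuous (fun s : R => expR ((1 - s) * a * y 0 i0)).
    rewrite (_ : (fun s : R => _) = (fun s => expR ((- a * s + a) * y 0 i0))); first exact/cc/continuous_expR.
    by apply/funext => z /=; congr expR; ring.
  have c2 : continuous (fun s : R => h (s * xi * y 0 i0)).
    rewrite (_ : (fun s : R => _) = (fun s => h ((xi * s + 0) * y 0 i0))); first exact: cc.
    by apply/funext => z /=; congr h; ring.
  exact: (cvgM (@cvg_cst _ (ind t y) _ _ _) (cvgM (c1 s) (c2 s))).
- by apply: bcs_integrable; apply: bcsZ; exact: bcs_ind.
- move=> s; rewrite /= in_itv/= => /andP[s1 s2]; apply: aeW => y _.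
  apply: ind_norm_mul => yt; rewrite normrM -[leRHS]mulr1; apply: ler_pM => //.
  rewrite ger0_norm ?expR_ge0// ler_expR (le_trans (ler_norm _))// !normrM.
  apply: ler_pM => //; last by rewrite (le_trans (coord_le_enorm _ _))// ltW.
  by rewrite (gtr0_norm ha) ler_pM2r// ler_norml; lra.
Qed.

(** On the segment from a to i xi the modulus of the average runs from [kappa] to 0. As L is smaller
    than [kappa], it is not attained at the start, whence tau > 0. *)
Lemma wave_level xi L : wmom 0 xi t = 0 -> 0 <= L < @kappa R d a t ->
  exists tau, 0 < tau <= 1 /\ Normc.normc (wmom ((1 - tau) * a) (tau * xi) t) = L.
Proof.
move=> w0 /andP[L0 Lk].
pose N (tau : R) := (complex.Re (wmom ((1 - tau) * a) (tau * xi) t)) ^+ 2 +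
                    (complex.Im (wmom ((1 - tau) * a) (tau * xi) t)) ^+ 2.
have nE tau : Normc.normc (wmom ((1 - tau) * a) (tau * xi) t) = Num.sqrt (N tau) by [].
have N0 : N 0 = (@kappa R d a t) ^+ 2.
  by rewrite /N subr0 mul1r mul0r wave_mom_real /= expr0n addr0.
have N1 : N 1 = 0 by rewrite /N subrr mul0r mul1r w0 /= expr0n addr0.
have cN : {within `[0, 1], continuous N}.
  apply: continuous_in_subspaceT => tau; rewrite inE/= in_itv/= => t01.
  apply: cvgD.
    have c := continuous_wave_mom (xi := xi) t01 (@continuous_cos R) (@cos_max R).
    exact: (cvgM c c).
  have c := continuous_wave_mom (xi := xi) t01 (@continuous_sin R) (@sin_max R).
  exact: (cvgM c c).
have L2 : L ^+ 2 < (@kappa R d a t) ^+ 2 by rewrite ltr_pXn2r// nnegrE// (le_trans L0)// ltW.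
have [|tau] := IVT ler01 cN (v := L ^+ 2).
  by rewrite N0 N1 ge_min le_max sqr_ge0 (ltW L2) orbT.
rewrite in_itv/= => /andP[tau0 tau1] NL; exists tau; split.
  rewrite tau1 andbT lt_neqAle tau0 andbT; apply/eqP => t0'.
  by move: NL L2; rewrite -t0' N0 => ->; rewrite ltxx.
by apply: etrans (nE tau) _; rewrite NL sqrtr_sqr ger0_norm.
Qed.

(** Segments from a to two different points of the imaginary axis meet only in a, which tau > 0
    excludes, so the exponents differ. *)
Lemma two_wave_levels L : 0 <= L < @kappa R d a t ->
  exists al1 be1 al2 be2 : R, [/\ 0 <= al1 <= a, 0 <= al2 <= a, 0 < be1, 0 < be2 &
   [/\ (al1, be1) <> (al2, be2),
    Normc.normc (wmom al1 be1 t) = L & Normc.normc (wmom al2 be2 t) = L]].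
Proof.
move=> hL; have pi0 := pi_gt0 R; have d0 : 0 < d%:R :> R by rewrite ltr0n.
have [s1 /andP[s1l s1u] z1] := cosine_zero hd (lexx (d%:R : R)).
(* This window starts 1 beyond the end of the first one, so that s1 < s2. *)
have [|s2 /andP[s2l s2u] z2] := @cosine_zero R d hd (d%:R + 2 * pi + 1); first by lra.
have s12 : s1 < s2 by lra.
have s10 : 0 < s1 by exact: lt_le_trans s1l.
have s20 : 0 < s2 by exact: lt_trans s12.
have zero s : 0 < s -> mom0 (fun y : V => cos (y 0 (Ordinal hd))) s = 0 -> wmom 0 (s / t) t = 0.
  by move=> sp z; apply: wave_mom_imag; rewrite ?divr_gt0// divfK// gt_eqF.
have [u1 [/andP[u10 u11] n1]] := wave_level (zero _ s10 z1) hL.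
have [u2 [/andP[u20 u21] n2]] := wave_level (zero _ s20 z2) hL.
have al u : 0 < u -> u <= 1 -> 0 <= (1 - u) * a <= a.
  move=> up ule; rewrite mulr_ge0 ?subr_ge0 ?(ltW ha)//= ler_piMl ?(ltW ha)//.
  by rewrite gerBl ltW.
exists ((1 - u1) * a), (u1 * (s1 / t)), ((1 - u2) * a), (u2 * (s2 / t)).
split; rewrite ?al// ?mulr_gt0 ?invr_gt0//; split=> // -[].
move=> /(mulIf (negbT (gt_eqF ha))) e; have -> : u1 = u2 by lra.
move=> /(mulfI (negbT (gt_eqF u20))) /(mulIf (invr_neq0 (negbT (gt_eqF t0)))) e'.
by move: s12; rewrite e' ltxx.
Qed.

End level_sets.

(** * Bump functions *)

Section flat_functions.
Context {R : realType}.
Implicit Types (x : R).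

(** A family that contains exp(-1/x) and whose span is closed under differentiation: flat n' = flat
    (n+2) - n flat (n+1). *)
Definition flat n x : R := if 0 < x then x^-1 ^+ n * expR (- x^-1) else 0.

Lemma flat_ge0 n x : 0 <= flat n x.
Proof.
by rewrite /flat; case: ifPn => // x0; rewrite mulr_ge0 ?expR_ge0// exprn_ge0// invr_ge0 ltW.
Qed.

Lemma flat_gt0 n x : 0 < x -> 0 < flat n x.
Proof. by move=> x0; rewrite /flat x0 mulr_gt0 ?expR_gt0// exprn_gt0// invr_gt0. Qed.

(** Quadratic decay makes the derivative at 0 vanish. It comes from (v / p)^p <= exp v with v = 1 /
    x and p = n + 2. *)
Lemma flat_le n x : flat n x <= n.+2%:R ^+ n.+2 * x ^+ 2.
Proof.
rewrite /flat; case: ifPn => x0; last by rewrite mulr_ge0 ?sqr_ge0 ?exprn_ge0.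
rewrite expRN ler_pdivrMr ?expR_gt0//.
have u0 : 0 < x^-1 by rewrite invr_gt0.
have -> : x ^+ 2 = x^-1 ^- 2 by rewrite exprVn invrK.
move: (x^-1) u0 => u u0 {x0}.
have p0 : n.+2%:R != 0 :> R by [].
have h : (u / n.+2%:R) ^+ n.+2 <= expR u.
  have -> : expR u = expR (u / n.+2%:R) ^+ n.+2 by rewrite -expRM_natl; congr expR; field.
  rewrite lerXn2r ?nnegrE ?expR_ge0 ?divr_ge0 ?(ltW u0)//.
  by rewrite (le_trans _ (expR_ge1Dx _))// lerDr.
apply: (@le_trans _ _ (n.+2%:R ^+ n.+2 / u ^+ 2 * (u / n.+2%:R) ^+ n.+2)); last first.
  by rewrite ler_wpM2l// divr_ge0 ?exprn_ge0// ltW.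
rewrite le_eqVlt; apply/orP; left; apply/eqP.
rewrite expr_div_n exprS exprS; move: (n.+2%:R : R) p0 => p p0; rewrite !exprS; field.
by rewrite p0 expf_neq0 ?p0 ?gt_eqF.
Qed.

Lemma is_derive_flat n x : is_derive x (1 : R) (flat n) (flat n.+2 x - n%:R * flat n.+1 x).
Proof.
have [x0|x0|->] := ltgtP x 0.
- have -> : flat n.+2 x - n%:R * flat n.+1 x = 0 by rewrite /flat ltNge (ltW x0) mulr0 subr0.
  apply: near_eq_is_derive (is_derive_cst (0 : R) x (1 : R)).
  by near=> y; rewrite /flat ltNge (_ : y <= 0)//; apply: ltW; near: y; exact: lt_nbhsl.
- have xn : x != 0 by rewrite gt_eqF.
  apply: (@near_eq_is_derive _ _ _ (fun y : R => y^-1 ^+ n * expR (- y^-1))).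
    by near=> y; rewrite /flat (_ : 0 < y)//; near: y; exact: lt_nbhsr.
  have hv : is_derive x (1 : R) (fun y : R => y^-1) (- x ^- 2).
    apply: is_derive_eq (@is_deriveV _ (fun y : R => y) _ _ _ xn (is_derive_id x (1 : R))) _.
    by rewrite /GRing.scale/= mulr1.
  have he : is_derive x (1 : R) (fun y : R => expR (- y^-1)) (expR (- x^-1) * x ^- 2).
    apply: is_derive_eq (is_derive1_comp (is_derive_expR _) (is_deriveN hv)) _.
    by rewrite opprK.
  have hX : is_derive x (1 : R) (fun y : R => y^-1 ^+ n) (n%:R * x^-1 ^+ n * x^-1^-1 * - x ^- 2).
    have xv : x^-1 != 0 by rewrite invr_eq0.
    exact: is_derive1_comp (is_derive_power n xv) hv.
  apply: is_derive_eq (is_deriveM hX he) _.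
  rewrite /GRing.scale/= /flat x0 !exprS exprVn.
  move: (expR _) => E; field.
  by rewrite expf_neq0.
have -> : flat n.+2 0 - n%:R * flat n.+1 0 = 0 by rewrite /flat ltxx mulr0 subr0.
apply: (is_derive_estimate (K := fun h => n.+2%:R ^+ n.+2 * `|h|) (e := 1)) => //.
  move=> h _ _; rewrite add0r mulr0 subr0 [X in _ - X]/flat ltxx subr0 ger0_norm ?flat_ge0//.
  by rewrite (le_trans (flat_le n h))// [leRHS]mulrCA -expr2 real_normK ?num_real.
rewrite -[X in _ --> X](mulr0 (n.+2%:R ^+ n.+2)); apply: cvgM; first exact: cvg_cst.
by rewrite -[X in _ --> X](normr0 R); apply: cvg_norm.
Unshelve. all: end_near. Qed.

End flat_functions.

Section smooth_class.
Context {R : realType} {d : nat} (hd : (0 < d)%N).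
Local Notation V := 'rV[R]_d.

(** Smoothness concerns all iterated partials; a class of continuous functions closed under partial
    derivatives reduces it to one derivative. *)
Inductive flat_algebra : (V -> R) -> Prop :=
| flat_algebra_cst c : flat_algebra (fun=> c)
| flat_algebra_coord n r e i : flat_algebra (fun y => flat n (r + e * y 0 i))
| flat_algebraD u v : flat_algebra u -> flat_algebra v -> flat_algebra (fun y => u y + v y)
| flat_algebraM u v : flat_algebra u -> flat_algebra v -> flat_algebra (fun y => u y * v y).

Lemma flat_algebra_derive u j : flat_algebra u -> continuous u /\
  exists2 u', flat_algebra u' & forall x, is_derive x (delta_mx 0 j) u (u' x).
Proof.
elim=> {u}.
- move=> c; split; first exact: cst_continuous.
  by exists (fun=> 0); [exact: flat_algebra_cst|move=> x; exact: is_derive_cst].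
- move=> n r e i; have dl (z : R) : is_derive z (1 : R) (fun z => flat n (r + e * z))
      ((flat n.+2 (r + e * z) - n%:R * flat n.+1 (r + e * z)) * e).
    have h : is_derive z (1 : R) (fun z => r + e * z) e.
      apply: is_derive_eq (is_deriveD (is_derive_cst r z (1 : R)) (is_deriveZ e (is_derive_id z (1 : R)))) _.
      by rewrite /GRing.scale/= add0r mulr1.
    have h2 : is_derive ((fun z => r + e * z) z) (1 : R) (flat n)
      (flat n.+2 (r + e * z) - n%:R * flat n.+1 (r + e * z)) by exact: is_derive_flat.
    exact: is_derive1_comp.
  have cf : continuous (fun z => flat n (r + e * z)) by exact: derivable_continuous dl.
  split.
    move=> y; apply: (@continuous_comp _ _ _ (fun y : V => y 0 i) (fun z => flat n (r + e * z))); last exact: cf.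
    exact: coord_continuous.
  exists (fun y => (i == j)%:R * ((flat n.+2 (r + e * y 0 i) + (- n%:R) * flat n.+1 (r + e * y 0 i)) * e)).
    by do ?[exact: flat_algebra_cst|exact: flat_algebra_coord|apply: flat_algebraM|apply: flat_algebraD].
  by move=> y; rewrite mulNr; exact: (is_derive_coordT j (dl (y 0 i))).
- move=> u v _ [cu [u' Du du]] _ [cv [v' Dv dv]]; split.
    by move=> x; exact: cvgD (cu x) (cv x).
  exists (fun y => u' y + v' y); first exact: flat_algebraD.
  by move=> x; exact: is_deriveD.
move=> u v Fu [cu [u' Du du]] Fv [cv [v' Dv dv]]; split.
  by move=> x; exact: cvgM (cu x) (cv x).
exists (fun y => u y * v' y + v y * u' y).
  by apply: flat_algebraD; exact: flat_algebraM.
by move=> x; exact: is_deriveM.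
Qed.

Lemma flat_algebra_smooth u : flat_algebra u -> smooth u.
Proof.
move=> Fu s; have Fs : flat_algebra (foldr partial u s).
  elim: s => //= j s IH; have [_ [u' Fu' du]] := flat_algebra_derive j IH.
  rewrite (_ : partial j _ = u')//; apply/funext => x.
  by rewrite /partial; have [_ ->] := du x.
split=> [x|j x].
  by have [c _] := flat_algebra_derive (Ordinal hd) Fs; exact: c.
by have [_ [u' _ du]] := flat_algebra_derive j Fs; have [] := du x.
Qed.

End smooth_class.

Section bump.
Context {R : realType} {d : nat} (hd : (0 < d)%N).
Local Notation V := 'rV[R]_d.
Local Notation mu := (lebesgue_rV d).
Implicit Types (phi : V -> R) (r : R).

(** The coefficients 1 and -1 are written out to match [flat_algebra_coord]; the support lies in the
    cube of half-side r. *)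
Definition bump r (y : V) : R := \prod_(j < d) (flat 0 (r + 1 * y 0 j) * flat 0 (r + (- 1) * y 0 j)).

Lemma smooth_bump r : smooth (bump r).
Proof.
apply: (flat_algebra_smooth hd); rewrite /bump.
elim: (index_enum _) => [|j s IH].
  by under eq_fun do rewrite big_nil; exact: flat_algebra_cst.
under eq_fun do rewrite big_cons.
by apply: flat_algebraM => //; apply: flat_algebraM; exact: flat_algebra_coord.
Qed.

Lemma bump_ge0 r y : 0 <= bump r y.
Proof. by apply: prodr_ge0 => j _; rewrite mulr_ge0 ?flat_ge0. Qed.

Lemma bump_gt0 r : 0 < r -> 0 < bump r 0.
Proof.
move=> r0; apply: prodr_gt0 => j _.
by rewrite !mxE !mulr0 addr0 mulr_gt0 ?flat_gt0.
Qed.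

Lemma bump_coord r y j : bump r y != 0 -> `|y 0 j| <= r.
Proof.
apply: contraNT; rewrite -ltNge => rj; rewrite /bump (bigD1 j)//=.
have flat0 (x : R) : x <= 0 -> flat 0 x = 0 by rewrite /flat leNgt => /negbTE ->.
rewrite (_ : _ * flat 0 _ = 0) ?mul0r//.
move: rj; rewrite ltr_normr => /orP[] h; first by rewrite [X in _ * X]flat0 ?mulr0//; lra.
by rewrite (flat0 (r + 1 * _)) ?mul0r//; lra.
Qed.

Lemma supported_bump r : 0 <= r -> supported_in (d%:R * r) (bump r).
Proof.
move=> r0 y; rewrite ltNge => /negP h; apply/eqP/negPn/negP => b0; apply: h.
by apply: enorm_le_coord => // i; exact: bump_coord.
Qed.

Lemma test_function_real phi rho : smooth phi -> supported_in rho phi ->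
  test_function (fun x => (phi x)%:C).
Proof.
move=> sp su; split => //.
  exact: (flat_algebra_smooth hd (flat_algebra_cst 0)).
have cB : closed [set x : V | enorm x <= rho].
  rewrite (_ : [set _ | _] = enorm @^-1` [set x | x <= rho])//.
  apply: preimage_closed => [x _|]; first exact: enorm_continuous.
  exact: closed_le.
have KB : closure [set x | (phi x)%:C != 0] `<=` [set x : V | enorm x <= rho].
  rewrite [X in _ `<=` X](iffLR (closure_id _) cB); apply: closure_subset => x /=.
  by apply: contraNT; rewrite -ltNge => /su ->.
apply: (subclosed_compact _ _ KB); first exact: closed_closure.
apply: bounded_closed_compact => //; exists rho; split; first exact: num_real.
move=> M rM x /= xr; rewrite [`|x|]mx_normrE.
apply: bigmax_le => [|[i j] _ /=]; first by rewrite (le_trans (enorm_ge0 x))// (le_trans xr) ?ltW.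
by rewrite ord1 (le_trans (coord_le_enorm _ _))// (le_trans xr) ?ltW.
Qed.

End bump.

(** * Waves paired with test functions *)

Section wave_pairing.
Context {R : realType} {d : nat} (hd : (0 < d)%N).
Local Notation V := 'rV[R]_d.
Local Notation mu := (lebesgue_rV d).
Let i0 : 'I_d := Ordinal hd.
Implicit Types (phi : V -> R) (f g : V -> R[i]) (al be : R).

Definition pairing f phi : R[i] :=
  (\int[mu]_x (complex.Re (f x) * phi x)) +i* (\int[mu]_x (complex.Im (f x) * phi x)).

Lemma pairingD f g phi : clocb f -> clocb g -> bcs phi ->
  pairing (fun x => f x + g x) phi = pairing f phi + pairing g phi.
Proof.
move=> [fr fi] [gr gi] bp; rewrite /pairing; simpc.
congr (_ +i* _); rewrite -Rintegral_bcsD; try exact: bcs_mul.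
  by apply: eq_Rintegral => x _; case: (f x) (g x) => u v [u' v'] /=; ring.
by apply: eq_Rintegral => x _; case: (f x) (g x) => u v [u' v'] /=; ring.
Qed.

(** Integration by parts through translation: the shift y moves to the wave, which is
    multiplicative, so the correlation is wave(-y) times the pairing; its derivative at y = 0 is
    read off. *)
Lemma pairing_wave_partial al be phi rho j : smooth phi -> supported_in rho phi ->
  pairing (wave hd al be) (partial j phi) =
  - ((i0 == j)%:R%:C * (al +i* be)) * pairing (wave hd al be) phi.
Proof.
move=> sp su; have [lr li] := clocb_wave hd al be.
have bphi := test_bcs sp su.
pose h1 (z : R) := expR (- al * z) * cos (be * z).
pose h2 (z : R) := - (expR (- al * z) * sin (be * z)).
have wN y : wave hd al be (- y) = h1 (y 0 i0) +i* h2 (y 0 i0).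
  by rewrite /wave /h1 /h2 mxE !mulrN cosN sinN !mulNr mulrN.
have lin (c z : R) : is_derive z (1 : R) (fun z => c * z) c.
  by apply: is_derive_eq (is_deriveZ c (is_derive_id z (1 : R))) _; rewrite /GRing.scale/= mulr1.
have de : is_derive (0 : R) (1 : R) (fun z => expR (- al * z)) (- al).
  have := is_derive1_comp (is_derive_expR (- al * 0)) (lin (- al) 0).
  by move/is_derive_eq; apply; rewrite mulr0 expR0 mul1r.
have dc : is_derive (0 : R) (1 : R) (fun z => cos (be * z)) 0.
  have := is_derive1_comp (is_derive_cos (be * 0)) (lin be 0).
  by move/is_derive_eq; apply; rewrite mulr0 sin0 oppr0 mul0r.
have ds : is_derive (0 : R) (1 : R) (fun z => sin (be * z)) be.
  have := is_derive1_comp (is_derive_sin (be * 0)) (lin be 0).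
  by move/is_derive_eq; apply; rewrite mulr0 cos0 mul1r.
have d1 : is_derive (0 : R) (1 : R) h1 (- al).
  apply: is_derive_eq (is_deriveM de dc) _.
  by rewrite /GRing.scale/= !mulr0 cos0 mul1r add0r.
have d2 : is_derive (0 : R) (1 : R) h2 (- be).
  apply: is_derive_eq (is_deriveN (is_deriveM de ds)) _.
  by rewrite /GRing.scale/= !mulr0 expR0 sin0 mul1r mul0r addr0.
set Jr := \int[mu]_x (complex.Re (wave hd al be x) * phi x).
set Ji := \int[mu]_x (complex.Im (wave hd al be x) * phi x).
have corrE (p : V -> R) : locb p -> forall y, corr p phi y = \int[mu]_x (p (x - y) * phi x).
  move=> lp y; rewrite /corr.
  have mg : measurable_fun setT (fun x : V => p (x - y) * phi x).
    have [mp _] := lp; have [mphi _] := bphi.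
    by apply: measurable_funM => //; apply: (measurableT_comp mp); exact: measurable_rVB.
  rewrite -(Rintegral_translation y mg).
  by apply: eq_Rintegral => x _; rewrite addrK.
have cr : corr (fun x => complex.Re (wave hd al be x)) phi =
    (fun y => h1 (y 0 i0) * Jr - h2 (y 0 i0) * Ji).
  apply/funext => y; rewrite corrE// -!Rintegral_bcsZ; try exact: bcs_mul.
  rewrite -Rintegral_bcsB; try by apply: bcsZ; exact: bcs_mul.
  apply: eq_Rintegral => x _; rewrite waveD wN complex_ReM.
  by case: (wave hd al be x) => u v /=; ring.
have ci : corr (fun x => complex.Im (wave hd al be x)) phi =
    (fun y => h2 (y 0 i0) * Jr + h1 (y 0 i0) * Ji).
  apply/funext => y; rewrite corrE// -!Rintegral_bcsZ; try exact: bcs_mul.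
  rewrite -Rintegral_bcsD; try by apply: bcsZ; exact: bcs_mul.
  apply: eq_Rintegral => x _; rewrite waveD wN complex_ImM.
  by case: (wave hd al be x) => u v /=; ring.
have D (h : R -> R) h' : is_derive (0 : R) (1 : R) h h' ->
    is_derive (0 : V) (delta_mx 0 j) (fun y : V => h (y 0 i0)) ((i0 == j)%:R * h').
  move=> dh; apply: is_derive_coordT; by rewrite mxE.
have uniq (p : V -> R) (l : R) : locb p ->
    is_derive (0 : V) (delta_mx 0 j) (corr p phi) l -> \int[mu]_x (p x * partial j phi x) = l.
  move=> lp [_ <-]; have [_ ->] := is_derive_corr j 0 lp sp su.
  by apply: eq_Rintegral => x _; rewrite addr0.
have Z (h : V -> R) (l c : R) : is_derive (0 : V) (delta_mx 0 j) h l ->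
    is_derive (0 : V) (delta_mx 0 j) (fun y => h y * c) (l * c).
  move=> dh; rewrite (_ : (fun y => _) = (fun y => c *: h y)); last first.
    by apply/funext => y; rewrite mulrC.
  by apply: is_derive_eq (is_deriveZ c dh) _; rewrite /GRing.scale/= mulrC.
have er : is_derive (0 : V) (delta_mx 0 j) (corr (fun x => complex.Re (wave hd al be x)) phi)
    ((i0 == j)%:R * - al * Jr - (i0 == j)%:R * - be * Ji).
  by rewrite cr; exact: is_deriveB (Z _ _ Jr (D _ _ d1)) (Z _ _ Ji (D _ _ d2)).
have ei : is_derive (0 : V) (delta_mx 0 j) (corr (fun x => complex.Im (wave hd al be x)) phi)
    ((i0 == j)%:R * - be * Jr + (i0 == j)%:R * - al * Ji).
  by rewrite ci; exact: is_deriveD (Z _ _ Jr (D _ _ d2)) (Z _ _ Ji (D _ _ d1)).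
have Er := uniq _ _ lr er; have Ei := uniq _ _ li ei.
rewrite /pairing Er Ei -/Jr -/Ji.
move: Jr Ji {er ei Er Ei cr ci} ((i0 == j)%:R : R) => u v w.
by apply/eqP; rewrite eq_complex/=; apply/andP; split; apply/eqP; ring.
Qed.

Lemma pairing_sum f (u : 'I_d -> V -> R) : clocb f -> (forall j, bcs (u j)) ->
  pairing f (fun x => \sum_(j < d) u j x) = \sum_(j < d) pairing f (u j).
Proof.
move=> [lr li] bu.
have H (p : V -> R) : locb p ->
    \int[mu]_x (p x * \sum_(j < d) u j x) = \sum_(j < d) \int[mu]_x (p x * u j x).
  move=> lp; rewrite -Rintegral_bcs_sum => [|j]; last exact: bcs_mul.
  by apply: eq_Rintegral => x _; rewrite mulr_sumr.
rewrite /pairing !H//.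
by apply/eqP; rewrite eq_complex/= !raddf_sum !eqxx.
Qed.

Lemma pairing_wave_sumlap al be phi rho : smooth phi -> supported_in rho phi ->
  pairing (wave hd al be) (sumlap phi) = (al +i* be) ^+ 2 * pairing (wave hd al be) phi.
Proof.
move=> sp su; rewrite /sumlap pairing_sum; last 2 first.
- exact: clocb_wave.
- move=> j; apply: (@test_bcs _ _ _ rho); first by do 2 apply: smooth_partial.
  by do 2 apply: supported_partial.
have E j : pairing (wave hd al be) (partial j (partial j phi)) =
    (i0 == j)%:R%:C * ((al +i* be) ^+ 2 * pairing (wave hd al be) phi).
  rewrite (pairing_wave_partial al be j (smooth_partial j sp) (supported_partial j su)).
  rewrite (pairing_wave_partial al be j sp su); move: (pairing _ _) => J.
  by case: (i0 == j); rewrite ?mul1r ?mul0r; ring.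
rewrite (bigD1 i0)//= big1 => [|j ji]; first by rewrite E eqxx mul1r addr0.
by rewrite E eq_sym (negbTE ji) mul0r.
Qed.

Lemma laplacian_eigen_pairing f m phi rho : clocb f -> laplacian_eigen f m ->
  smooth phi -> supported_in rho phi ->
  pairing f (sumlap phi) + m * pairing f phi = 0.
Proof.
move=> [lr li] /(_ _ (test_function_real hd _ _)) h sp su.
have := h phi rho sp su; have bp := test_bcs sp su; have bl := sumlap_bcs sp su.
have sumlap0 (x : V) : sumlap (fun=> 0) x = 0.
  have p0 j : partial j (fun=> 0 : R) = (fun=> 0) :> (V -> R).
    by apply/funext => y; rewrite /partial derive_cst.
  by rewrite /sumlap big1// => j _; rewrite !p0.
have -> : cintegral setT (fun x => f x * claplacian (fun x => (phi x)%:C) x) =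
    - pairing f (sumlap phi).
  have H (p : V -> R) : locb p -> \int[mu]_x (p x * (-1 * sumlap phi x)) = - \int[mu]_x (p x * sumlap phi x).
    move=> lp; rewrite -[RHS]mulN1r -[RHS](Rintegral_bcsZ _ (bcs_mul lp bl)).
    by apply: eq_Rintegral => x _; rewrite mulrCA.
  transitivity ((- \int[mu]_x (complex.Re (f x) * sumlap phi x)) +i*
      (- \int[mu]_x (complex.Im (f x) * sumlap phi x))); last by [].
  rewrite /cintegral -(H _ lr) -(H _ li); congr (_ +i* _); apply: eq_Rintegral => x _.
    move: (claplacian _ x) (claplacianE (fun x => (phi x)%:C) x) => z ->.
    rewrite [X in _ +i* (_ * X)](sumlap0 x); move: (sumlap _ x) => w.
    by case: (f x) => u v /=; ring.
  move: (claplacian _ x) (claplacianE (fun x => (phi x)%:C) x) => z ->.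
  rewrite [X in _ +i* (_ * X)](sumlap0 x); move: (sumlap _ x) => w.
  by case: (f x) => u v /=; ring.
have -> : cintegral setT (fun x => m * f x * (phi x)%:C) = m * pairing f phi.
  have br := bcs_mul lr bp; have bi := bcs_mul li bp.
  transitivity ((complex.Re m * \int[mu]_x (complex.Re (f x) * phi x) -
                 complex.Im m * \int[mu]_x (complex.Im (f x) * phi x)) +i*
                (complex.Re m * \int[mu]_x (complex.Im (f x) * phi x) +
                 complex.Im m * \int[mu]_x (complex.Re (f x) * phi x))); last by case: (m).
  rewrite -(Rintegral_bcsZ _ br) -(Rintegral_bcsZ _ bi) -(Rintegral_bcsZ _ bi) -(Rintegral_bcsZ _ br).
  rewrite -(Rintegral_bcsB (bcsZ _ br) (bcsZ _ bi)) -(Rintegral_bcsD (bcsZ _ bi) (bcsZ _ br)).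
  rewrite /cintegral; congr (_ +i* _); apply: eq_Rintegral => x _.
    by case: (f x) (m) => u v [u' v'] /=; ring.
  by case: (f x) (m) => u v [u' v'] /=; ring.
by move=> e; rewrite -e addrN.
Qed.

Lemma Rintegral_continuous_gt0 (g : V -> R) : continuous g -> bcs g ->
  (forall x, 0 <= g x) -> 0 < g 0 -> 0 < \int[mu]_x g x.
Proof.
move=> cg bg g0 g00.
have [rho rho0 h] := continuous_near0 cg (divr_gt0 g00 (ltr0n R 2)).
apply: (@lt_le_trans _ _ (\int[mu]_x (g 0 / 2 * ind rho x))).
  by rewrite Rintegral_bcsZ ?Rintegral_ind ?mulr_gt0 ?volume_gt0//; exact: bcs_ind.
apply: le_Rintegral_bcs => // [|x]; first by apply: bcsZ; exact: bcs_ind.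
rewrite indE; case: ltP => xr /=; last by rewrite mulr0.
have := h _ xr; rewrite ler_norml => /andP[hx _]; rewrite mulr1; lra.
Qed.

(** On the support |be y_1| <= 1 < pi / 2, so the cosine is nonnegative and the real part of the
    pairing is positive. *)
Lemma pairing_wave_bump al be r : 0 < r -> `|be| * r <= 1 ->
  pairing (wave hd al be) (bump r) != 0.
Proof.
move=> r0 ber; have sb := smooth_bump hd r; have su := @supported_bump R d r (ltW r0).
suff : 0 < complex.Re (pairing (wave hd al be) (bump r)).
  by apply: contraTneq => ->; rewrite ltxx.
have cw : continuous (fun y : V => complex.Re (wave hd al be y)).
  exact: (@continuous_wave_part R d hd expR cos al be (@continuous_expR R) (@continuous_cos R)).
apply: Rintegral_continuous_gt0.
- exact: continuousM_rV cw (smooth_continuous sb).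
- by have [lr _] := clocb_wave hd al be; exact: bcs_mul lr (test_bcs sb su).
- move=> y; have [->|b0] := eqVneq (bump r y) 0; first by rewrite mulr0.
  rewrite mulr_ge0 ?bump_ge0//= mulr_ge0 ?expR_ge0//.
  have : `|be * y 0 i0| <= 1.
    by rewrite normrM (le_trans _ ber)// ler_wpM2l// (bump_coord i0 b0).
  rewrite ler_norml => /andP[h1 h2]; have := pi_ge2 R => hpi.
  by apply: cos_ge0_pihalf; apply/andP; split; lra.
by rewrite /= mxE !mulr0 expR0 cos0 !mul1r bump_gt0.
Qed.

(** Let z_j be the exponents and J_j the pairings with the bump. Testing on the bump and on its
    first partial derivative gives two linear equations in (z_j^2 + m) J_j, the second with factors
    -z_j. As z_1 and z_2 differ, both z_j^2 + m vanish, so z_1 = -z_2, which positive imaginary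
    parts exclude. *)
Lemma two_waves_not_eigen (al1 be1 al2 be2 : R) : 0 < be1 -> 0 < be2 ->
  (al1, be1) <> (al2, be2) ->
  forall m, ~ laplacian_eigen (fun x => wave hd al1 be1 x + wave hd al2 be2 x) m.
Proof.
move=> b1 b2 ne m eig.
have lw al be := clocb_wave hd al be.
pose r := (be1 + be2)^-1; have r0 : 0 < r by rewrite invr_gt0 addr_gt0.
have br be : 0 < be -> be <= be1 + be2 -> `|be| * r <= 1.
  by move=> be0 bele; rewrite gtr0_norm// ler_pdivrMr ?addr_gt0// mul1r.
have J1 : pairing (wave hd al1 be1) (bump r) != 0.
  by apply: pairing_wave_bump => //; apply: br; lra.
have J2 : pairing (wave hd al2 be2) (bump r) != 0.
  by apply: pairing_wave_bump => //; apply: br; lra.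
have sb := smooth_bump hd r; have su := @supported_bump R d r (ltW r0).
have E phi rho : smooth phi -> supported_in rho phi ->
    ((al1 +i* be1) ^+ 2 + m) * pairing (wave hd al1 be1) phi +
    ((al2 +i* be2) ^+ 2 + m) * pairing (wave hd al2 be2) phi = 0.
  move=> sp sup; have bl := sumlap_bcs sp sup; have bp := test_bcs sp sup.
  have := laplacian_eigen_pairing (clocbD (lw al1 be1) (lw al2 be2)) eig sp sup.
  rewrite !pairingD// (pairing_wave_sumlap al1 be1 sp sup) (pairing_wave_sumlap al2 be2 sp sup).
  by move: (pairing _ phi) (pairing _ phi) => u v <-; ring.
have := E _ _ (smooth_partial i0 sb) (supported_partial i0 su).
rewrite (pairing_wave_partial al1 be1 i0 sb su) (pairing_wave_partial al2 be2 i0 sb su).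
have := E _ _ sb su; rewrite eqxx.
have s12 : al1 +i* be1 - (al2 +i* be2) != 0.
  by rewrite subr_eq0; apply/eqP => -[e1 e2]; apply: ne; rewrite e1 e2.
have s12' : al1 +i* be1 + (al2 +i* be2) != 0.
  by apply/eqP => -[_ /eqP]; rewrite gt_eqF// addr_gt0.
move: J1 J2 s12 s12'; move: (pairing _ _) (pairing _ _) (_ +i* _) (_ +i* _) => v u s2 s1.
move=> u0 v0 s12 s12' e1 e2.
have h1 : (s1 - s2) * ((s1 ^+ 2 + m) * u) = 0.
  transitivity (- s2 * ((s1 ^+ 2 + m) * u + (s2 ^+ 2 + m) * v) -
    ((s1 ^+ 2 + m) * (- (1%:R%:C * s1) * u) + (s2 ^+ 2 + m) * (- (1%:R%:C * s2) * v))).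
    by ring.
  by rewrite e1 e2 mulr0 subr0.
have m1 : s1 ^+ 2 + m = 0.
  by move/eqP: h1; rewrite !mulf_eq0 (negbTE s12) (negbTE u0) orbF => /eqP.
have m2 : s2 ^+ 2 + m = 0.
  by move/eqP: e1; rewrite m1 mul0r add0r mulf_eq0 (negbTE v0) orbF => /eqP.
have : (s1 - s2) * (s1 + s2) == 0.
  by apply/eqP; transitivity (s1 ^+ 2 + m - (s2 ^+ 2 + m)); [ring|rewrite m1 m2 subrr].
by rewrite mulf_eq0 (negbTE s12) (negbTE s12').
Qed.

End wave_pairing.

(** * The subcritical example *)

Section subcritical.
Context {R : realType} {d : nat} (hd : (0 < d)%N) (a : R) (ha : 0 < a).
Context (t : R) (t0 : 0 < t).
Local Notation V := 'rV[R]_d.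
Local Notation mu := (lebesgue_rV d).
Local Notation vol := (volume (eball t : set V)).

Lemma clocb_measurable (f : V -> R[i]) : clocb f -> lebesgue_measurable f.
Proof. by move=> [[mr _] [mi _]]; exists f => //; apply: aeW. Qed.

Lemma ball_average_cbsum (f : V -> R[i]) x : clocb f ->
  ball_average t f x = (vol^-1)%:C * cbsum t f x.
Proof.
move=> [[mr _] [mi _]]; apply: ball_average_ae => //.
by apply: aeW => y; exact: complex_ReIm.
Qed.

(** The waves are continued in k by powers of c, and modulus 1 keeps the bound uniform over all
    integers k. For A = 0 also w = 0, and c = 1 serves. *)
Lemma unit_multiplier (w A : R[i]) : Normc.normc w = Normc.normc A * vol ->
  exists2 c, Normc.normc c = 1 & (vol^-1)%:C * w = A * c.
Proof.
move=> wA; have v0 : 0 < vol by rewrite volume_gt0.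
have vC : vol%:C != 0 by rewrite gt_eqF// ltcR.
have [A0|A0] := eqVneq A 0.
  exists 1; first exact: Normc.normc1.
  by rewrite A0 mul0r (Normc.eq0_normc (_ : Normc.normc w = 0)) ?mulr0// wA A0 Normc.normc0 mul0r.
exists (w / (vol%:C * A)).
  rewrite Normc.normcM Normc.normcV Normc.normcM wA /= expr0n addr0 sqrtr_sqr gtr0_norm//.
  have nA : Normc.normc A != 0 by apply: contra_neq A0; exact: Normc.eq0_normc.
  by rewrite [X in _ / X]mulrC mulfV// mulf_neq0// gt_eqF.
have -> : (vol^-1)%:C = vol%:C^-1 by rewrite fmorphV.
by field; rewrite A0 vC.
Qed.

Lemma subcritical_example (A : R[i]) : `|A| < psi ('i%C * a%:C) (t *: e1 d : V) ->
  exists f : int -> V -> R[i], [/\ forall k, lebesgue_measurable (f k),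
    forall k, ae_equal (ball_average t (f k)) (fun x => A * f (k + 1) x),
    forall k x, `|f k x| <= (2 * expR (a * enorm x))%:C &
    forall m, ~ laplacian_eigen (f 0) m].
Proof.
rewrite (psi_imaginary hd ha t0) norm_complex ltcR => cA.
have v0 : 0 < vol by rewrite volume_gt0.
have hL : 0 <= Normc.normc A * vol < @kappa R d a t.
  by rewrite -ltr_pdivlMr// cA andbT mulr_ge0 ?sqrtr_ge0 ?(ltW v0)//; case: (A) => ? ?; exact: sqrtr_ge0.
have [al1 [be1 [al2 [be2 [h1 h2 b1 b2 [ne n1 n2]]]]]] := two_wave_levels hd ha t0 hL.
have [c1 c11 w1] := unit_multiplier n1; have [c2 c21 w2] := unit_multiplier n2.
have lw al be := clocb_wave hd al be.
pose f (k : int) x := c1 ^ k * wave hd al1 be1 x + c2 ^ k * wave hd al2 be2 x.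
have lf k : clocb (f k) by apply: clocbD; exact: clocbZ.
have nk (c : R[i]) (k : int) : Normc.normc c = 1 -> Normc.normc (c ^ k) = 1 := @normc_exprz R c k.
have nw al be x : 0 <= al <= a -> Normc.normc (wave hd al be x) <= expR (a * enorm x).
  move=> /andP[al0 ala]; rewrite normc_wave ler_expR (le_trans (ler_norm _))// normrM.
  by rewrite (ger0_norm al0) ler_pM// coord_le_enorm.
exists f; split.
- by move=> k; apply: clocb_measurable.
- move=> k; apply: aeW => x.
  rewrite ball_average_cbsum// cbsumD; [|exact: clocbZ..].
  rewrite !cbsumZ// !cbsum_wave /f.
  have u0 (c : R[i]) : Normc.normc c = 1 -> c != 0.
    by move=> c1'; apply/eqP => c0; move/eqP: c1'; rewrite c0 Normc.normc0 eq_sym oner_eq0.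
  rewrite !exprzDr ?unitfE ?u0// !expr1z.
  transitivity (c1 ^ k * ((vol^-1)%:C * wave_mom hd al1 be1 t) * wave hd al1 be1 x +
     c2 ^ k * ((vol^-1)%:C * wave_mom hd al2 be2 t) * wave hd al2 be2 x).
    by move: (c1 ^ k) (c2 ^ k) (wave_mom _ _ _ _) (wave_mom _ _ _ _) (_%:C) => ? ? ? ? ?; ring.
  rewrite w1 w2.
  by move: (c1 ^ k) (c2 ^ k) => ? ?; ring.
- move=> k x; rewrite norm_complex lecR (le_trans (le_normcD _ _))//.
  rewrite !Normc.normcM !nk// !mul1r mulr_natl mulr2n.
  by rewrite lerD// nw.
move=> m; have -> : f 0 = (fun x => wave hd al1 be1 x + wave hd al2 be2 x).
  by apply/funext => x; rewrite /f !expr0z !mul1r.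
exact: two_waves_not_eigen.
Qed.

End subcritical.

Theorem corollary3p5 (R : realType) (d : nat) (hd : (0 < d)%N)
    (t : R) (ht : 0 < t) (a : R) (ha : 0 < a) (A : R[i]) :
  let psi0 : R[i] := psi ('i%C * a%:C) (t *: e1 d) in
  let admissible (f : int -> 'rV[R]_d -> R[i]) : Prop :=
    [/\ forall k, lebesgue_measurable (f k),
        forall k, ae_equal (ball_average t (f k)) (fun x => A * f (k + 1) x) &
        exists2 M : R, 0 < M &
          forall k x, `|f k x| <= (M * expR (a * enorm x))%:C] in
  [/\ `|A| = psi0 ->
        forall f, admissible f -> laplacian_eigen (f 0) (- (a ^+ 2)%:C),
      psi0 < `|A| ->
        forall f, admissible f -> ae_equal (f 0) (fun=> 0) &
      `|A| < psi0 ->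
        exists2 f, admissible f & forall mu : R[i], ~ laplacian_eigen (f 0) mu].
Proof.
move=> psi0 admissible; split.
- move=> cA f [mf fT [M M0 fM]]; exact (critical_eigen hd ha ht (ltW M0) cA mf fT fM).
- move=> cA f [mf fT [M M0 fM]]; exact (supercritical_vanish hd ha ht (ltW M0) cA mf fT fM).
move=> /(subcritical_example hd ha ht)[f [mf fT fM fE]].
by exists f => //; split=> //; exists 2.
Qed.
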